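(* Let $\varphi\in\mathcal{S}_r\cap\mathcal{C}$ be real-valued. (1) If $\varphi(0^+)>0$, then for any $N\in\mathbb{N}$ and any $N$ distinct primes $p_1,\dots,p_N$, $$2\varphi(0^+)>\sum_{1\le i\le N}J_\varphi(\tfrac{2}{p_i})-\sum_{1\le i<j\le N}J_\varphi(\tfrac{2}{p_ip_j})+\cdots+(-1)^{N+1}J_\varphi\Big(\tfrac{2}{\prod_{i=1}^Np_i}\Big).$$ (2) If $\varphi(0^+)=0$, then either $J_\varphi(\frac2p)\ge0$ for every prime $p$, or $J_\varphi(\frac2p)\le0$ for every prime $p$. (3) Let $p$ be a prime with $p\equiv3\pmod 4$ and $k$ a positive integer. Then $J_\varphi(\frac{m}{p^k})=J_\varphi(\frac{n}{p^k})$ for all $1\le m,n\le p^k-1$ such that $p\nmid mn$ and $m-n$ is even.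
   Context: $L^2=L^2(0,1)$; each $\varphi\in L^2$ is identified with its odd $2$-periodic extension to $\mathbb{R}$. $\mathcal{C}$ is the set of $\varphi\in L^2$ such that the span of $\{\varphi(kx):k\in\mathbb{N}\}$ is dense in $L^2$. $\mathcal{S}_r$ is the class of step functions on $(0,1)$ (finitely many jumps) all of whose jump discontinuities in $(0,1)$ are rational. $J_\varphi(x)=\varphi(x^+)-\varphi(x^-)$ for $x\in\mathbb{R}$, computed for the odd $2$-periodic extension. *)

(* Defs.v *)
From HB Require Import structures.
From mathcomp Require Import all_boot all_order all_algebra.
From mathcomp Require Import all_classical all_reals all_analysis.
Set Implicit Arguments. Unset Strict Implicit. Unset Printing Implicit Defensive.
Import Order.TTheory GRing.Theory Num.Theory.
Import numFieldNormedType.Exports.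
Local Open Scope classical_set_scope.
Local Open Scope ring_scope.

(* Odd 2-periodic extension of a function given on (0,1). Values at the
   integers are irrelevant (measure zero, not seen by one-sided limits);
   we set them to 0. *)
Definition oddext {R : realType} (phi : R -> R) (x : R) : R :=
  let y := x - 2 * (Num.floor (x / 2))%:~R in
  if (0 < y) && (y < 1) then phi y
  else if (1 < y) && (y < 2) then - phi (2 - y)
  else 0.

Definition rlim0 {R : realType} (phi : R -> R) : R :=
  lim (phi y @[y --> (0:R)^'+]).

Definition Jump {R : realType} (phi : R -> R) (x : R) : R :=
  lim (oddext phi y @[y --> x^'+]) - lim (oddext phi y @[y --> x^'-]).

Definition inL2 {R : realType} (f : R -> R) : Prop :=
  measurable_fun (`]0%R, 1%R[ : set R) f /\
  (\int[@lebesgue_measure R]_(x in (`]0%R, 1%R[ : set R)) ((f x) ^+ 2)%:E < +oo)%E.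

Definition in_C {R : realType} (phi : R -> R) : Prop :=
  inL2 phi /\
  forall f : R -> R, inL2 f -> forall eps : R, 0 < eps ->
    exists (n : nat) (c : nat -> R),
      (\int[@lebesgue_measure R]_(x in (`]0%R, 1%R[ : set R))
         ((f x - \sum_(1 <= k < n.+1) c k * oddext phi (k%:R * x)) ^+ 2)%:E
       < eps%:E)%E.

Definition is_step {R : realType} (phi : R -> R) : Prop :=
  exists s : seq R, (forall t, t \in s -> 0 < t < 1) /\
    forall x y : R, 0 < x -> x <= y -> y < 1 ->
      (forall t, t \in s -> ~~ (x <= t <= y)) -> phi x = phi y.

Definition is_rational {R : realType} (x : R) : Prop :=
  exists q : rat, x = ratr q.

Definition in_Sr {R : realType} (phi : R -> R) : Prop :=
  is_step phi /\
  forall x : R, 0 < x < 1 -> Jump phi x != 0 -> is_rational x.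

(* Main.v *)
(** Write M = 2q with q a common denominator of the jumps, J(i) for the jump of
    phi at i/q, and b(n) = sum_(i < M) J(i) cos(2 pi n i / M).  Integrating
    by parts, the n-th sine coefficient of x |-> phi(kx) is b(n/k)/(2 pi n/k)
    if k | n and 0 otherwise.  Density of the dilations therefore forbids
    sum_n b(n) lam(n)/n = 0 for every completely multiplicative lam with
    |lam(p)| < 1 at all primes and lam(p) = 0 at all but finitely many.

    Fix a class u mod M whose primes have a divergent sum of reciprocals.
    Putting lam(p) = z/2 at the primes p = u mod M of a finite set Q turns the
    series, up to a nonvanishing factor, into a polynomial in z without zeros in
    |z| < 2 whose growth is at most exponential in sum_Q 1/p, while the bound of
    Jensen type on its first coefficients is quadratic in that sum.  Comparing
    the two as Q grows gives f_0 f_2 = f_1^2 for f_j the series of b(u^j n);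
    adding one more prime of the class forces f_1 = f_0 or f_1 = -f_0, and
    hence b(un) = e b(n) with a sign e.  The classes satisfying such
    a relation form a subgroup, which an elementary sieve shows to contain all
    units mod M, so that J(ui) = e(u) J(i) as well.

    If p = 3 mod 4, half the totient of p^k is odd, so every unit has an odd power
    congruent to 1 or -1 mod p^k, and J is even: this is (3).  If J(0) <> 0, or if J(M/p) <> 0 for two primes p, then e = 1, so
    b(n) depends on gcd(n, M) only, b(n) = sum_(d | n) h(d) with h supported
    on the divisors of M, and the series factors through the polynomial
    sum_(d | M) h(d) lam(d)/d in the values lam(p), which has no zero in the
    open unit polydisc.  The alternating sums of jumps are its values at points
    with coordinates 0 and 1; connecting these to the value h(1) = b(1) at 0 gives
    the signs in (1) and (2). *)
Require Import Defs.
From HB Require Import structures.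
From mathcomp Require Import all_boot all_order all_algebra.
From mathcomp Require Import all_classical all_reals all_analysis.
From mathcomp Require Import cyclic separable cyclotomic.
From mathcomp Require Import measurable_realfun.
From mathcomp Require Import complex ring lra zify.
Set Implicit Arguments.
Unset Strict Implicit.
Unset Printing Implicit Defensive.
Import Order.TTheory GRing.Theory Num.Theory.
Import numFieldNormedType.Exports.
Import ComplexField.Normc.
Local Open Scope classical_set_scope.
Local Open Scope ring_scope.
Local Open Scope complex_scope.


(** * Nonvanishing polynomials *)

Section Modulus.
Variable R : realType.
Implicit Types z w : R[i].

(** Nonvanishing is known only for the series of b itself, never for the series f_j of b(u^j n), so
    the action of a unit has to be read off from growth. For a polynomial q with q(0) = 1, the
    combination q_1^2 - 2 q_2 is the second power sum of the inverse roots, that is -2 times the z^2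
    coefficient of ln q, and for zero-free q the size of ln |q| controls it. Here ln |q| is O(B)
    with B the sum of 1/(2p) over Q, whereas q_1^2 - 2 q_2 = B^2 ((f_1/f_0)^2 - f_2/f_0) + O(B). The
    value z/2 keeps the disc of radius 2 free of zeros, so all inverse roots have modulus at most
    1/2 and ln(1 - tz) expands uniformly on the unit circle.

    The growth argument only reaches classes whose primes have divergent reciprocals. The sieve
    takes the place of Dirichlet's theorem on primes in progressions: the good classes form a
    subgroup, the primes outside it have a convergent sum of reciprocals, and such a sparse set of
    primes cannot supply a prime factor to every integer of a missing class.

    The denominator q may be replaced by any multiple, so finitely many given primes can be made to
    divide M. *)

Lemma normc_ge0 z : 0 <= normc z.
Proof. by case: z => a b; exact: sqrtr_ge0. Qed.

Lemma sqr_normcE z : normc z ^+ 2 = complex.Re z ^+ 2 + complex.Im z ^+ 2.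
Proof. by case: z => a b /=; rewrite sqr_sqrtr // addr_ge0 ?sqr_ge0. Qed.

Lemma ler_Re_normc z : `|complex.Re z| <= normc z.
Proof.
rewrite -ler_sqr ?nnegrE ?normc_ge0 // sqr_normcE real_normK ?num_real //.
by rewrite lerDl sqr_ge0.
Qed.

Lemma ler_Im_normc z : `|complex.Im z| <= normc z.
Proof.
rewrite -ler_sqr ?nnegrE ?normc_ge0 // sqr_normcE real_normK ?num_real //.
by rewrite lerDr sqr_ge0.
Qed.

Lemma normcR (x : R) : normc x%:C = `|x|.
Proof. by rewrite /= expr0n addr0 sqrtr_sqr. Qed.

Lemma normc_nat n : normc (n%:R : R[i]) = n%:R.
Proof. by rewrite -(rmorph_nat (real_complex R)) normcR normr_nat. Qed.

Lemma normcX z n : normc (z ^+ n) = normc z ^+ n.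
Proof. by elim: n => [|n IHn]; rewrite ?normc1 // !exprS normcM IHn. Qed.

Lemma ler_normcD z w : normc (z + w) <= normc z + normc w.
Proof. exact: le_normcD. Qed.

Lemma ler_normcB z w : normc z - normc w <= normc (z - w).
Proof.
by rewrite lerBlDr; have := ler_normcD (z - w) w; rewrite subrK.
Qed.

Lemma normc_prod (I : Type) (r : seq I) (P : pred I) (F : I -> R[i]) :
  normc (\prod_(i <- r | P i) F i) = \prod_(i <- r | P i) normc (F i).
Proof. by apply: big_morph; [exact: normcM | exact: normc1]. Qed.

Lemma ler_normc_sum (I : Type) (r : seq I) (P : pred I) (F : I -> R[i]) :
  normc (\sum_(i <- r | P i) F i) <= \sum_(i <- r | P i) normc (F i).
Proof.
elim/big_rec2: _ => [|i x y _ le_xy]; first by rewrite normc0.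
by apply: le_trans (ler_normcD _ _) _; rewrite lerD2l.
Qed.

Lemma normc_eq0 z : (normc z == 0) = (z == 0).
Proof. by apply/eqP/eqP => [/eq0_normc //|->]; rewrite normc0. Qed.

Lemma normc_gt0 z : (0 < normc z) = (z != 0).
Proof. by rewrite lt_def normc_ge0 normc_eq0 andbT. Qed.

Lemma ReD z w : complex.Re (z + w) = complex.Re z + complex.Re w.
Proof. by case: z w => [a b] []. Qed.

Lemma ImD z w : complex.Im (z + w) = complex.Im z + complex.Im w.
Proof. by case: z w => [a b] []. Qed.

Lemma ReN z : complex.Re (- z) = - complex.Re z. Proof. by case: z. Qed.

Lemma ReM z w :
  complex.Re (z * w) = complex.Re z * complex.Re w - complex.Im z * complex.Im w.
Proof. by case: z w => [a b] []. Qed.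

Lemma ImM z w :
  complex.Im (z * w) = complex.Re z * complex.Im w + complex.Im z * complex.Re w.
Proof. by case: z w => [a b] []. Qed.

Lemma ReZ (x : R) z : complex.Re (x%:C * z) = x * complex.Re z.
Proof. by rewrite ReM /= mul0r subr0. Qed.

Lemma ImZ (x : R) z : complex.Im (x%:C * z) = x * complex.Im z.
Proof. by rewrite ImM /= mul0r addr0. Qed.

Lemma Re_sum (I : Type) (r : seq I) (P : pred I) (F : I -> R[i]) :
  complex.Re (\sum_(i <- r | P i) F i) = \sum_(i <- r | P i) complex.Re (F i).
Proof. by apply: big_morph; [exact: ReD|]. Qed.

Lemma Im_sum (I : Type) (r : seq I) (P : pred I) (F : I -> R[i]) :
  complex.Im (\sum_(i <- r | P i) F i) = \sum_(i <- r | P i) complex.Im (F i).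
Proof. by apply: big_morph; [exact: ImD|]. Qed.

Lemma mulcJ z : z * z^* = (normc z ^+ 2)%:C.
Proof. by rewrite sqr_normcE; case: z => a b /=; apply/eqP; rewrite eq_complex /=; apply/andP; split; apply/eqP; ring. Qed.

Lemma Re_div_1B z (c : R) : 1 - c%:C * z != 0 ->
  complex.Re (z / (1 - c%:C * z)) =
  (complex.Re z - c * normc z ^+ 2) / normc (1 - c%:C * z) ^+ 2.
Proof.
rewrite -normc_eq0 -sqrf_eq0 !sqr_normcE; case: z => a b /=.
rewrite !(mul0r, subr0, addr0, sub0r) => ne0; field.
by apply: contra_neq ne0 => <-; ring.
Qed.

(** Taylor's formula along the segment from 0 to z, kept real: ln|1 - tz| is half the logarithm of
    the real quadratic D. With w = tz, the derivative of the difference collapses by the geometric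
    sum to -Re(z w^m / (1 - w)), which the mean value theorem turns into the bound. *)
Lemma ln_normc_1B z m : normc z <= 2^-1 ->
  `|ln (normc (1 - z)) + \sum_(1 <= k < m.+1) complex.Re (z ^+ k) / k%:R|
  <= 2 * 2^-1 ^+ m.+1.
Proof.
move=> hz.
pose P := \poly_(k < m.+1) (complex.Re (z ^+ k) / k%:R).
pose D := 1 - (2 * complex.Re z)%:P * 'X + (normc z ^+ 2)%:P * 'X^2 : {poly R}.
have DE t : D.[t] = normc (1 - t%:C * z) ^+ 2.
  rewrite sqr_normcE /D !hornerE sqr_normcE !(ReD, ImD, ReN, ImZ, ReZ) /=.
  by case: (z) => a b /=; ring.
have lo t : 0 <= t <= 1 -> 2^-1 <= normc (1 - t%:C * z).
  move=> /andP[t0 t1]; apply: le_trans (ler_normcB _ _).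
  rewrite normc1 normcM normcR ger0_norm // lerBrDr -lerBrDl.
  have : t * normc z <= 1 * 2^-1 by apply: ler_pM => //; apply: normc_ge0.
  by move=> h; apply: le_trans h _; lra.
have D0 t : 0 <= t <= 1 -> 0 < D.[t].
  by move=> ht; rewrite DE exprn_gt0 // (lt_le_trans _ (lo _ ht)).
pose G t := 2^-1 * ln D.[t] + P.[t].
pose dG t := 2^-1 * (D.[t]^-1 * D^`().[t]) + P^`().[t].
have dGP (t : R) : 0 <= t <= 1 -> is_derive t (1 : R) G (dG t).
  move=> ht.
  have h3 : is_derive t 1 (@ln R \o horner D) (D.[t]^-1 * D^`().[t]).
    by apply: is_derive1_comp; apply: is_derive1_ln; apply: D0.
  exact: (is_deriveD (is_deriveZ _ h3 : is_derive t 1 (2^-1 *: (@ln R \o horner D)) _)).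
have Gcont : {within `[0%R, 1%R], continuous G}.
  apply: derivable_within_continuous => t; rewrite in_itv /= => ht.
  by have [] := dGP t ht.
have dGI (t : R) : t \in `]0, 1[ -> is_derive t (1 : R) G (dG t).
  by rewrite in_itv /= => /andP[h1 h2]; apply: dGP; rewrite !ltW.
have [c] := MVT ltr01 dGI Gcont.
rewrite in_itv /= => /andP[c0 c1].
have c01 : 0 <= c <= 1 by rewrite !ltW.
have G0 : G 0 = 0.
  rewrite /G DE rmorph0 mul0r subr0 normc1 expr1n ln1 mulr0 add0r.
  by rewrite horner_coef0 coef_poly /= invr0 mulr0.
have G1 : G 1 = ln (normc (1 - z)) + \sum_(1 <= k < m.+1) complex.Re (z ^+ k) / k%:R.
  rewrite /G DE rmorph1 mul1r lnXn; last first.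
    by apply: lt_le_trans (_ : 2^-1 <= _); rewrite ?invr_gt0 // -[z in 1 - z]mul1r lo ?lexx ?ler01.
  rewrite -[ln _ *+ 2]mulr_natl mulrA mulVf ?mul1r ?pnatr_eq0 //; congr (_ + _).
  rewrite horner_poly -(big_mkord xpredT (fun k => complex.Re (z ^+ k) / k%:R * 1 ^+ k)).
  rewrite big_ltn // invr0 mulr0 mul0r add0r.
  by apply: eq_bigr => i _; rewrite expr1n mulr1.
rewrite -G1 G0 subr0 subr0 mulr1 => ->.
pose w := c%:C * z.
have w1 : 1 - w != 0 by rewrite -normc_gt0 (lt_le_trans _ (lo _ c01)) ?invr_gt0.
have -> : dG c = - complex.Re (z * w ^+ m / (1 - w)).
  have -> : z * w ^+ m / (1 - w) = z / (1 - w) - z * \sum_(i < m) w ^+ i.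
    have -> : w ^+ m = 1 - (1 - w) * \sum_(i < m) w ^+ i.
      by rewrite -[1 - w]opprB mulNr -subrX1; ring.
    rewrite mulrBr mulr1 mulrBl; congr (_ - _).
    by rewrite mulrCA mulrAC mulfV // mul1r.
  rewrite ReD ReN opprB addrC /dG; congr (_ + _); last first.
    rewrite /P mulr_sumr Re_sum.
    have -> : (\poly_(k < m.+1) (complex.Re (z ^+ k) / k%:R))^`() =
         \poly_(k < m) complex.Re (z ^+ k.+1).
      apply/polyP => i; rewrite coef_deriv !coef_poly ltnS.
      case: ifP => _; last by rewrite mul0rn.
      by rewrite -[LHS]mulr_natr divfK ?pnatr_eq0.
    rewrite horner_poly; apply: eq_bigr => i _.
    by rewrite /w exprMn mulrCA -exprS -rmorphXn ReZ mulrC.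
  rewrite Re_div_1B // DE -/w.
  have -> : D^`().[c] = 2 * (c * normc z ^+ 2 - complex.Re z).
    rewrite /D !(derivD, derivB, derivN, derivM, derivC, derivXn, derivX) !hornerE /=; ring.
  by field; rewrite normc_eq0.
rewrite normrN; apply: le_trans (ler_Re_normc _) _.
rewrite !normcM normcX normcV.
have zw : normc w <= 2^-1.
  rewrite normcM normcR (ger0_norm (ltW c0)) -[2^-1]mul1r.
  by apply: ler_pM; rewrite ?normc_ge0 // ltW.
rewrite [leRHS]mulrC exprS; apply: ler_pM; rewrite ?mulr_ge0 ?exprn_ge0 ?invr_ge0 ?normc_ge0 //.
  by apply: ler_pM; rewrite ?exprn_ge0 ?normc_ge0 // lerXn2r ?nnegrE ?normc_ge0.
by rewrite -[leRHS]invrK lef_pV2 ?posrE ?invr_gt0 ?lo // normc_gt0.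
Qed.
End Modulus.

Section RootsOfUnity.

Lemma prim_root_sum (F : fieldType) (z : F) n k : n.-primitive_root z ->
  \sum_(j < n) (z ^+ k) ^+ j = if (n %| k)%N then n%:R else 0.
Proof.
move=> zP; rewrite (prim_order_dvd zP); case: eqP => [->|/eqP zk1].
  by under eq_bigr do rewrite expr1n; rewrite sumr_const card_ord.
have := subrX1 (z ^+ k) n; rewrite -exprM mulnC exprM (prim_expr_order zP) expr1n.
by rewrite subrr => /esym/eqP; rewrite mulf_eq0 subr_eq0 (negPf zk1) => /eqP.
Qed.

Lemma prim_root_exists (F : numClosedFieldType) n : (0 < n)%N ->
  exists z : F, n.-primitive_root z.
Proof.
move=> n0; have [r rE] := closed_field_poly_normal ('X^n - 1 : {poly F}).
rewrite (monicP (monicXnsubC 1 n0)) scale1r in rE.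
have /hasP[z _ zP] : has n.-primitive_root r.
  apply: has_prim_root => //.
  - by apply/allP => z; rewrite -root_prod_XsubC -rE.
  - rewrite -separable_prod_XsubC -rE separable_Xn_sub_1 //.
    by rewrite pnatr_eq0 -lt0n.
  - by rewrite -ltnS -(size_prod_XsubC _ id) -rE size_XnsubC.
by exists z.
Qed.

End RootsOfUnity.

Section NonvanishingPolynomial.
Variable R : realType.
Implicit Types (q : {poly R[i]}) (s : seq R[i]).

Lemma ln_normc_prod s : (forall z, z \in s -> z != 0) ->
  ln (normc (\prod_(z <- s) z)) = \sum_(z <- s) ln (normc z) :> R.
Proof.
elim: s => [|z s IHs] s0; first by rewrite !big_nil normc1 ln1.
have z0 : z != 0 by apply: s0; rewrite mem_head.
have {}s0 x : x \in s -> x != 0 by move=> xs; apply: s0; rewrite inE xs orbT.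
rewrite !big_cons normcM lnM ?posrE ?normc_gt0 ?IHs //.
by rewrite prodf_seq_neq0; apply/allP => x /s0.
Qed.

(** Newton's identity for the second power sum of the inverse roots. *)
Lemma coef_prod_1B s : let q := \prod_(t <- s) (1 - t *: 'X) in
  q`_0 = 1 /\ q`_1 ^+ 2 - 2 * q`_2 = \sum_(t <- s) t ^+ 2.
Proof.
elim: s => [|t s /= [q0 IHs]].
  by rewrite /= !big_nil !coef1 /= expr0n mulr0 subr0.
rewrite !big_cons /= mulrBl mul1r -scalerAl !coefB !coefZ !coefXM /=.
by rewrite mulr0 subr0 q0; split=> //; rewrite -IHs; ring.
Qed.

Lemma poly_prod_1B q : q`_0 = 1 ->
  exists s, [/\ q = \prod_(t <- s) (1 - t *: 'X),
    size s = (size q).-1 & forall t, t \in s -> root q t^-1].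
Proof.
move=> q0; have [r rE] := closed_field_poly_normal q.
set c := lead_coef q in rE.
have c0 : c != 0.
  rewrite lead_coef_eq0; apply/eqP => qq0.
  by move: q0; rewrite qq0 coef0 => /esym/eqP; rewrite oner_eq0.
have r0 z : z \in r -> z != 0.
  move=> zr; apply/eqP => z0; have : root q 0.
    by rewrite rE rootZ // root_prod_XsubC -z0.
  by rewrite /root horner_coef0 q0 oner_eq0.
have cE : c * \prod_(z <- r) (- z) = 1.
  rewrite -[RHS]q0 -horner_coef0 [in RHS]rE hornerZ horner_prod; congr (_ * _).
  by apply: eq_bigr => z _; rewrite !hornerE.
exists [seq z^-1 | z <- r]; split; last 2 first.
- by rewrite size_map [in RHS]rE size_scale // size_prod_XsubC.
- by move=> _ /mapP[z zr ->]; rewrite invrK rE rootZ ?root_prod_XsubC.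
rewrite big_map [LHS]rE.
have -> : c = \prod_(z <- r) (- z^-1).
  apply: (@mulIf _ (\prod_(z <- r) (- z))).
    by rewrite prodf_seq_neq0; apply/allP => z /r0 /=; rewrite oppr_eq0.
  rewrite cE -big_split /= big_seq big1 // => z /r0 z0.
  by rewrite mulrNN mulVf.
elim: r r0 {rE cE} => [|z r IHr] r0; first by rewrite !big_nil scale1r.
rewrite !big_cons -IHr => [|x xr]; last by apply: r0; rewrite inE xr orbT.
have z0 : z != 0 by apply: r0; rewrite mem_head.
have <- : z^-1%:P * z%:P = 1 :> {poly R[i]} by rewrite -polyCM mulVf.
by rewrite -!mul_polyC polyCM polyCN; ring.
Qed.

(* Average ln |q| over the N-th roots of unity z against the nonnegative weights
   1 +- Re z^2; up to the error term only the coefficient of z^2 in ln q survives,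
   and ln |q| <= b. *)
Lemma nonvanishing_coef_bound_aux (s : seq R[i]) (b sg : R) m : (2 <= m)%N ->
  (sg == 1) || (sg == -1) ->
  (forall t, t \in s -> normc t <= 2^-1) ->
  (forall z, normc z = 1 -> normc (\prod_(t <- s) (1 - t * z)) <= expR b) ->
  - (sg / 4) * complex.Re (\sum_(t <- s) t ^+ 2) <=
  b + (size s)%:R * (2 * 2^-1 ^+ m.+1).
Proof.
(* With N = m + 3, z^(m+1) is the conjugate of z^2, and for k <= m the frequencies k, k + 2 and k +
   m + 1 are multiples of N only for k = 0 (the first) and k = 2 (the last). *)
move=> m2 sgP hs hb; set N := m.+3; have [z zP] := @prim_root_exists R[i] N isT.
have z1 : normc z = 1.
  apply/eqP; rewrite -(@pexpr_eq1 _ _ N) ?normc_ge0 //.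
  by rewrite -normcX (prim_expr_order zP) normc1.
pose W j : R := 1 + sg * complex.Re (z ^+ (2 * j)).
have reb k : -1 <= complex.Re (z ^+ k) <= 1.
  by rewrite -ler_norml (le_trans (ler_Re_normc _)) // normcX z1 expr1n.
have W0 j : 0 <= W j.
  rewrite /W; have := reb (2 * j)%N.
  by case/orP: sgP => /eqP->; set x := complex.Re _ => /andP[]; lra.
have WE j : (W j)%:C = 1 + (sg / 2)%:C * ((z ^+ 2) ^+ j + (z ^+ m.+1) ^+ j).
  have -> : (z ^+ m.+1) ^+ j = ((z ^+ 2) ^+ j)^*.
    have zj : (z ^+ 2) ^+ j != 0.
      by rewrite -normc_gt0 !normcX z1 !expr1n.
    apply: (mulfI zj).
    rewrite -exprMn -exprD -[(2 + _)%N]/N (prim_expr_order zP) expr1n.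
    by rewrite mulcJ !normcX z1 !expr1n.
  rewrite addcJ /W -exprM !rmorphD !rmorphM /= fmorphV rmorph1 rmorph_nat.
  by rewrite mulrA divfK // pnatr_eq0.
have sumW k : (k <= m)%N -> \sum_(j < N) (W j)%:C * (z ^+ j) ^+ k =
    (if k == 0 then N%:R else if k == 2 then N%:R * (sg / 2) else 0)%:C.
  move=> kP; transitivity (\sum_(j < N) ((z ^+ k) ^+ j + (sg / 2)%:C *
      ((z ^+ (2 + k)) ^+ j + (z ^+ (m.+1 + k)) ^+ j))).
    apply: eq_bigr => j _; rewrite WE !(exprD, exprMn) [(z ^+ j) ^+ k]exprAC.
    by ring.
  rewrite big_split -mulr_sumr big_split /= !(prim_root_sum _ zP).
  have -> : (N %| 2 + k)%N = false by apply/negP => /dvdn_leq; lia.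
  have -> : (N %| m.+1 + k)%N = (k == 2).
    apply/idP/eqP => [/dvdnP[c cE]|->]; last by rewrite addn2.
    suff : c = 1 by lia.
    by case: c cE => [|[|c]] //; rewrite !mulSn; lia.
  have -> : (N %| k)%N = (k == 0).
    by apply/idP/eqP => [/dvdn_leq|->]; rewrite ?dvdn0 //; lia.
  have -> : (N%:R : R[i]) = (N%:R : R)%:C by rewrite rmorph_nat.
  have [->|_] := eqVneq k 0%N; first by rewrite (_ : (0 == 2)%N = false) // addr0 mulr0 addr0.
  by have [_|_] := eqVneq k 2%N; rewrite !add0r ?mulr0 // [N%:R * _]mulrC [in RHS]rmorphM.
have sumW1 : \sum_(j < N) W j = N%:R.
  apply: complexI; have := sumW 0 isT; rewrite /= => <-; rewrite rmorph_sum.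
  by apply: eq_bigr => j _; rewrite expr0 mulr1.
have tz t j : t \in s -> normc (t * z ^+ j) <= 2^-1.
  by move=> /hs; rewrite normcM normcX z1 expr1n mulr1.
have up : \sum_(j < N) W j * (\sum_(t <- s) ln (normc (1 - t * z ^+ j))) <= N%:R * b.
  rewrite -sumW1 mulr_suml; apply: ler_sum => j _; apply: ler_wpM2l => //.
  have ne0 x : x \in [seq 1 - t * z ^+ j | t <- s] -> x != 0.
    move=> /mapP[t ts ->]; rewrite -normc_gt0.
    apply: lt_le_trans (ler_normcB _ _); rewrite normc1 subr_gt0.
    by apply: le_lt_trans (tz _ _ ts) _; lra.
  have := ln_normc_prod ne0; rewrite !big_map => <-.
  rewrite -[leRHS]expRK ler_ln ?posrE ?expR_gt0 //; last first.
    by rewrite normc_gt0 prodf_seq_neq0; apply/allP => t ts /=; apply/ne0/map_f.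
  by apply: hb; rewrite normcX z1 expr1n.
set E := 2 * 2^-1 ^+ m.+1.
have lo : \sum_(j < N) W j * (\sum_(t <- s) (- E - \sum_(1 <= k < m.+1) complex.Re ((t * z ^+ j) ^+ k) / k%:R)) <= N%:R * b.
  apply: le_trans up; apply: ler_sum => j _; apply: ler_wpM2l => //.
  rewrite big_seq [leRHS]big_seq; apply: ler_sum => t ts.
  by have := ln_normc_1B m (tz t j ts); rewrite ler_norml -/E => /andP[]; lra.
have loE : \sum_(j < N) W j * (\sum_(t <- s) (- E - \sum_(1 <= k < m.+1) complex.Re ((t * z ^+ j) ^+ k) / k%:R)) =
    N%:R * (- (size s)%:R * E - sg / 4 * complex.Re (\sum_(t <- s) t ^+ 2)).
  under eq_bigr => j _ do rewrite mulr_sumr.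
  rewrite exchange_big /= Re_sum mulr_sumr.
  transitivity (\sum_(t <- s) N%:R * (- E - sg / 4 * complex.Re (t ^+ 2))); last first.
    rewrite -mulr_sumr sumrB big_const_seq count_predT iter_addr_0 -mulr_sumr.
    by rewrite -mulr_natl; ring.
  apply: eq_bigr => t _.
  under eq_bigr => j _ do rewrite mulrBr.
  rewrite big_split /= -mulr_suml sumW1 sumrN mulrBr; congr (_ - _).
  under eq_bigr => j _ do rewrite mulr_sumr.
  rewrite exchange_big /=.
  (* Of the frequencies 1 <= k <= m only k = 2 meets the weight: sg/2 from the weight and 1/2 from
     the logarithmic series give sg/4. *)
  rewrite (eq_big_nat _ _ (F2 := fun k => if k == 2%N
      then N%:R * (sg / 4 * complex.Re (t ^+ 2)) else 0)).
    by rewrite -big_mkcond big_nat1_eq /= ltnS m2.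
  move=> k /andP[k1 km].
  under eq_bigr => j _ do rewrite mulrA -ReZ exprMn mulrCA.
  rewrite -mulr_suml -Re_sum -mulr_sumr sumW // -[k == 0%N]negbK -lt0n k1 /=.
  have [->|_] := eqVneq k 2%N; last by rewrite mulr0 /= mul0r.
  by rewrite mulrC ReM /= !mulr0 subr0; field.
rewrite loE ler_pM2l ?ltr0n // in lo.
by lra.
Qed.

(** The truncation error of the averaged bound vanishes as m grows, and the two signs of the weight
    give the two sides of the absolute value. *)
Lemma nonvanishing_coef_bound q (b : R) : q`_0 = 1 ->
  (forall z, root q z -> 2 <= normc z) ->
  (forall z, normc z = 1 -> normc q.[z] <= expR b) ->
  `|complex.Re (q`_1 ^+ 2 - 2 * q`_2)| <= 4 * b.
Proof.
move=> q0 hr hb; have [s [sE _ sr]] := poly_prod_1B q0.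
have [_] := coef_prod_1B s; rewrite -sE => ->.
have hs t : t \in s -> normc t <= 2^-1.
  move=> /sr/hr; have [->|t0] := eqVneq t 0; first by rewrite normc0 invr_ge0.
  rewrite normcV => h; rewrite -[normc t]invrK.
  by rewrite lef_pV2 ?posrE ?invr_gt0 ?normc_gt0.
have hb' z : normc z = 1 -> normc (\prod_(t <- s) (1 - t * z)) <= expR b.
  move=> /hb; rewrite sE horner_prod; congr (normc _ <= _).
  by apply: eq_bigr => t _; rewrite !hornerE.
set S := complex.Re _.
have key sg : (sg == 1) || (sg == -1) -> - (sg / 4) * S <= b.
  move=> sgP; apply/ler_addgt0Pr => e e0.
  have [n ne] : exists n, (size s)%:R * (2 * 2^-1 ^+ n.+3) <= e.
    have [n _ /(_ n (leqnn _)) /= nE] := near_infty_natSinv_lt (PosNum (divr_gt0 e0 (ltr0Sn R (size s)))).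
    exists n; have h2 : 2^-1 ^+ n.+2 <= n.+1%:R^-1 :> R.
      by rewrite exprVn lef_pV2 ?posrE ?ltr0n ?exprn_gt0 // -natrX ler_nat; apply/ltnW/ltnW/ltn_expl.
    rewrite (exprS _ n.+2) mulVKf //.
    rewrite ltr_pdivlMr ?ltr0n // in nE; apply: le_trans (ltW nE); rewrite mulrC.
    by apply: ler_pM; rewrite ?exprn_ge0 ?invr_ge0 ?ler_nat.
  by apply: le_trans (@nonvanishing_coef_bound_aux s b sg n.+2 isT sgP hs hb') _; rewrite lerD2l.
have := key 1; have := key (-1); rewrite !eqxx orbT => /(_ isT) h1 /(_ isT) h2.
by rewrite ler_norml; apply/andP; split; lra.
Qed.

(** q(1) is q(0) times a product of factors 1 - t with |t| <= 1. The constant depends on the degree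
    only, so the bound survives limits of polynomials and serves as a Hurwitz-type statement. *)
Lemma nonvanishing_disc_bound q : (forall z, root q z -> 1 <= normc z) ->
  normc q.[1] <= 2 ^+ (size q).-1 * normc q.[0].
Proof.
move=> hr; have q0 : q`_0 != 0.
  rewrite -horner_coef0; apply/negP => /hr; rewrite normc0 => /le_lt_trans/(_ ltr01).
  by rewrite ltxx.
pose q' := (q`_0)^-1 *: q.
have qE : q = q`_0 *: q' by rewrite scalerA mulfV // scale1r.
have q'0 : q'`_0 = 1 by rewrite coefZ mulVf.
have [s [sE ss sr]] := poly_prod_1B q'0.
have hs t : t \in s -> normc t <= 1.
  move=> /sr; rewrite rootZ ?invr_eq0 // => /hr; have [->|t0] := eqVneq t 0; first by rewrite normc0.
  by rewrite normcV invf_ge1 ?normc_gt0.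
rewrite {1}qE hornerZ normcM horner_coef0 mulrC ler_wpM2r ?normc_ge0 //.
rewrite -(size_scale q (invr_neq0 q0)) -/q' -ss sE horner_prod normc_prod.
elim: s hs {sE ss sr} => [|t s IHs] hs; first by rewrite big_nil.
rewrite big_cons exprS; apply: ler_pM; rewrite ?normc_ge0 //.
- by rewrite prodr_ge0 // => x _; rewrite normc_ge0.
- rewrite !hornerE; apply: le_trans (ler_normcD _ _) _; rewrite normc1.
  have -> : normc (- t) = normc t by exact: normcN.
  by rewrite lerD2l hs // mem_head.
- by apply: IHs => x xs; apply: hs; rewrite inE xs orbT.
Qed.

End NonvanishingPolynomial.

(** * Twisted Dirichlet series of bounded sequences *)

Section CompletelyMultiplicative.
Variable R : realType.
Implicit Types xi : nat -> R[i].

(** The completely multiplicative function with prime values xi. The value 0 at 0 is compatible with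
    multiplicativity and lets sums start at 0. *)
Definition lam xi n : R[i] :=
  if n == 0%N then 0 else \prod_(p < n.+1 | prime p) xi p ^+ logn p n.

Lemma lam0 xi : lam xi 0 = 0. Proof. by []. Qed.

Lemma lam_wide xi n N : (0 < n)%N -> (n < N)%N ->
  lam xi n = \prod_(p < N | prime p) xi p ^+ logn p n.
Proof.
move=> n0 nN; rewrite /lam gtn_eqF //.
rewrite (big_ord_widen_cond _ prime (fun p => xi p ^+ logn p n) nN).
rewrite big_mkcondr /=; apply: eq_bigr => p pp.
case: ifPn => // np; rewrite lognE pp n0 /= ifF //.
by apply: contraNF np => /dvdn_leq; rewrite ltnS; apply.
Qed.

Lemma lam1 xi : lam xi 1 = 1.
Proof. by rewrite /lam big1 //= => p _; rewrite logn1. Qed.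

Lemma lamM xi m n : lam xi (m * n)%N = lam xi m * lam xi n.
Proof.
have [->|m0] := posnP m; first by rewrite mul0n lam0 mul0r.
have [->|n0] := posnP n; first by rewrite muln0 lam0 mulr0.
rewrite !(@lam_wide _ _ (m * n)%N.+1) ?muln_gt0 ?m0 ?n0 // ?ltnS ?leq_pmulr ?leq_pmull //.
by rewrite -big_split /=; apply: eq_bigr => p _; rewrite lognM // exprD.
Qed.

Lemma lam_prime xi p : prime p -> lam xi p = xi p.
Proof.
move=> pp; rewrite (lam_wide xi (prime_gt0 pp) (ltnSn p)).
rewrite (bigD1 (Ordinal (ltnSn p))) //= logn_prime // eqxx expr1 big1 ?mulr1 //.
move=> q /andP[qp nq]; rewrite logn_prime // [val q == p]negbTE ?expr0 //.
Qed.

Lemma lam_coprime xi xi' n : (forall p, prime p -> (p %| n)%N -> xi p = xi' p) ->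
  lam xi n = lam xi' n.
Proof.
move=> h; have [->//|n0] := posnP n; rewrite /lam gtn_eqF //.
apply: eq_bigr => p pp; have [pn|pn] := boolP (p %| n)%N; first by rewrite h.
by rewrite lognE pp n0 (negPf pn).
Qed.

Lemma lam_eq0 xi p n : prime p -> (p %| n)%N -> xi p = 0 -> lam xi n = 0.
Proof.
by move=> pp /dvdnP[m ->] x0; rewrite lamM (lam_prime _ pp) x0 mulr0.
Qed.

Lemma normc_lam_le1 xi n : (forall p, normc (xi p) <= 1) -> normc (lam xi n) <= 1.
Proof.
move=> h; rewrite /lam; case: eqP => _; first by rewrite normc0.
rewrite normc_prod; apply: prodr_ile1 => p _; rewrite normc_ge0 normcX /=.
by rewrite exprn_ile1 ?normc_ge0.
Qed.

Definition upd xi p z : nat -> R[i] := fun q => if q == p then z else xi q.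

(** The Euler factor at p in recursive form, which together with [admissible_ind] replaces infinite
    products. *)
Lemma lam_upd xi p z n : prime p -> xi p = 0 ->
  lam (upd xi p z) n =
  lam xi n + (if (p %| n)%N then z * lam (upd xi p z) (n %/ p)%N else 0).
Proof.
move=> pp x0; have [pn|pn] := boolP (p %| n)%N.
  rewrite (lam_eq0 pp pn x0) add0r -{1}(divnK pn) mulnC lamM lam_prime //.
  by rewrite /upd eqxx.
rewrite addr0; apply: lam_coprime => q _ qn; rewrite /upd; case: eqP => // qp.
by rewrite -qp qn in pn.
Qed.

Definition admissible xi :=
  (exists s : seq nat, forall p, p \notin s -> xi p = 0) /\
  forall p, normc (xi p) < 1.

Lemma admissible_upd xi p z : admissible xi -> normc z < 1 -> admissible (upd xi p z).
Proof.
move=> [[s hs] h1] z1; split; last by move=> q; rewrite /upd; case: eqP.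
exists (p :: s) => q; rewrite inE negb_or => /andP[qp /hs].
by rewrite /upd (negPf qp).
Qed.

Lemma admissible0 : admissible (fun=> 0).
Proof. by split; [exists [::] | move=> p; rewrite normc0]. Qed.

(* Every admissible family arises from 0 by finitely many updates at primes. *)
Lemma admissible_ind (P : (nat -> R[i]) -> Prop) :
  P (fun=> 0) ->
  (forall xi xi', (forall p, prime p -> xi p = xi' p) -> P xi -> P xi') ->
  (forall xi p z, admissible xi -> prime p -> xi p = 0 -> normc z < 1 ->
     P xi -> P (upd xi p z)) ->
  forall xi, admissible xi -> P xi.
Proof.
move=> P0 Pext Pupd xi [[s]]; elim: s xi => [|p s IHs] xi hs h1.
  by apply: Pext P0 => p _; rewrite hs.
have IH : P (upd xi p 0).
  apply: IHs => q; rewrite /upd; have [_|qp] := eqVneq q p; rewrite ?normc0 //.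
  by move=> qs; apply: hs; rewrite inE negb_or qp.
have [pp|npp] := boolP (prime p); last first.
  apply: Pext IH => q; rewrite /upd; case: eqP => // ->.
  by rewrite (negPf npp).
have : P (upd (upd xi p 0) p (xi p)).
  apply: Pupd => //; last by rewrite /upd eqxx.
  by apply: admissible_upd; rewrite ?normc0 //; split=> //; exists (p :: s).
by apply: Pext => q _; rewrite /upd; case: eqP => [->|].
Qed.

Lemma sum_multiples (V : nmodType) (h : nat -> V) p Y : (0 < p)%N ->
  \sum_(n < (p * Y)%N) (if (p %| n)%N then h (n %/ p)%N else 0) = \sum_(m < Y) h m.
Proof.
move=> p0; elim: Y => [|Y IHY]; first by rewrite muln0 !big_ord0.
rewrite mulnSr big_split_ord /= IHY [RHS]big_ord_recr /=; congr (_ + _).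
rewrite (bigD1 (Ordinal p0)) //= addn0 dvdn_mulr // mulKn // big1 ?addr0 //.
move=> i i0; rewrite dvdn_addr ?dvdn_mulr // gtnNdvd //.
by rewrite lt0n; apply: contraNneq i0 => i0; apply/eqP/val_inj.
Qed.

(** Switching on a prime p multiplies the bound by 1/(1 - |z|): the multiples of p below X
    contribute at most |z| times the same partial sum S, so S <= C + |z| S. *)
Lemma lam_summable xi : admissible xi ->
  exists C, forall X, \sum_(n < X) normc (lam xi n) <= C.
Proof.
move: xi; apply: admissible_ind.
- exists 1 => X; apply: (@le_trans _ _ (\sum_(n < X) (if n == 1%N :> nat then 1 else 0))).
    apply: ler_sum => n _; case: eqP => [->|n1]; first by rewrite lam1 normc1.
    have [->|n0] := posnP n; first by rewrite lam0 normc0.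
    rewrite (@lam_eq0 _ (pdiv n)) ?normc0 ?pdiv_dvd ?pdiv_prime //; lia.
  rewrite -(big_mkord xpredT (fun n => if n == 1%N then 1 else 0)) -big_mkcond.
  by rewrite big_nat1_eq; case: ifP.
- move=> xi xi' e [C hC]; exists C => X.
  rewrite (eq_bigr (fun n : 'I_X => normc (lam xi n))); first exact: hC.
  by move=> n _; rewrite (@lam_coprime xi xi') // => p pp _; apply: e.
move=> xi p z [_ xi1] pp x0 z1 [C hC].
have C0 : 0 <= C by have := hC 0%N; rewrite big_ord0.
exists (C / (1 - normc z)) => X; rewrite ler_pdivlMr ?subr_gt0 //.
set xi' := upd xi p z; set S := \sum_(n < X) _.
suff : S <= C + normc z * S by lra.
have {1}-> : S = \sum_(n < X) normc (lam xi n + (if (p %| n)%N then z * lam xi' (n %/ p)%N else 0)).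
  by apply: eq_bigr => n _; rewrite -lam_upd.
apply: (@le_trans _ _ (\sum_(n < X) (normc (lam xi n) +
    normc (if (p %| n)%N then z * lam xi' (n %/ p)%N else 0)))).
  by apply: ler_sum => n _; exact: ler_normcD.
rewrite big_split; apply: lerD; first exact: hC.
have -> : \sum_(n < X) normc (if (p %| n)%N then z * lam xi' (n %/ p)%N else 0)
  = \sum_(n < X) (if (p %| n)%N then normc z * normc (lam xi' (n %/ p)%N) else 0).
  by apply: eq_bigr => n _; case: ifP; rewrite ?normc0 ?normcM.
apply: (@le_trans _ _ (\sum_(n < (p * X)%N) (if (p %| n)%N then normc z * normc (lam xi' (n %/ p)%N) else 0))).
  rewrite -(big_mkord xpredT (fun n => if (p %| n)%N then normc z * normc (lam xi' (n %/ p)%N) else 0)).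
  rewrite -(big_mkord xpredT (fun n => if (p %| n)%N then normc z * normc (lam xi' (n %/ p)%N) else 0)).
  rewrite (@big_cat_nat _ _ _ X 0 (p * X)%N) //= ?leq_pmull ?prime_gt0 // lerDl.
  by apply: sumr_ge0 => n _; case: ifP => // _; rewrite mulr_ge0 ?normc_ge0.
by rewrite (@sum_multiples _ (fun m => normc z * normc (lam xi' m))) ?prime_gt0 // -mulr_sumr.
Qed.

End CompletelyMultiplicative.

Section DirichletSeries.
Variable R : realType.
Implicit Types (xi : nat -> R[i]) (g : nat -> R).

Definition cvgC (u : nat -> R[i]) (l : R[i]) :=
  (complex.Re (u n) @[n --> \oo] --> complex.Re l) /\
  (complex.Im (u n) @[n --> \oo] --> complex.Im l).

Lemma cvgC_unique u l l' : cvgC u l -> cvgC u l' -> l = l'.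
Proof.
move=> [re im] [re' im']; apply/eqP; rewrite eq_complex.
by rewrite (cvg_unique _ re re') ?(cvg_unique _ im im') ?eqxx.
Qed.

Lemma cvgCD u v k l : cvgC u k -> cvgC v l -> cvgC (fun n => u n + v n) (k + l).
Proof.
move=> [re im] [re' im']; split.
  by rewrite ReD; under eq_fun do rewrite ReD; apply: cvgD.
by rewrite ImD; under eq_fun do rewrite ImD; apply: cvgD.
Qed.

Lemma cvgCM c u k : cvgC u k -> cvgC (fun n => c * u n) (c * k).
Proof.
move=> [re im]; split.
  rewrite ReM; under eq_fun do rewrite ReM.
  by apply: cvgB; apply: cvgM => //; apply: cvg_cst.
rewrite ImM; under eq_fun do rewrite ImM.
by apply: cvgD; apply: cvgM => //; apply: cvg_cst.
Qed.

Lemma cvgC_mul u k p : (0 < p)%N -> cvgC u k -> cvgC (fun n => u (p * n)%N) k.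
Proof.
move=> p0 [re im].
have sub : (p * n)%N @[n --> \oo] --> \oo.
  by apply: cvg_mulnl.
split; [exact: cvg_comp re | exact: cvg_comp im].
Qed.

Lemma cvgC_cst k : cvgC (fun=> k) k.
Proof. by split; exact: cvg_cst. Qed.

Definition psum g xi X : R[i] := \sum_(n < X) (g n / n%:R)%:C * lam xi n.

Definition dser g xi : R[i] :=
  Complex (limn (fun X => complex.Re (psum g xi X)))
          (limn (fun X => complex.Im (psum g xi X))).

Definition bounded_seq g := exists G, forall n, `|g n| <= G.

Lemma dser_cvg g xi : bounded_seq g -> admissible xi -> cvgC (psum g xi) (dser g xi).
Proof.
move=> [G hG] /lam_summable[C hC].
have main (f : R[i] -> R) : (forall z, `|f z| <= normc z) -> f 0 = 0 ->
    {morph f : x y / x + y} -> cvgn (fun X => f (psum g xi X)).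
  move=> f1 f0 fD.
  have -> : (fun X => f (psum g xi X)) = series (fun n => f ((g n / n%:R)%:C * lam xi n)).
    by apply/funext => X; rewrite /series /= big_mkord /psum (big_morph f fD f0).
  apply: normed_cvg; apply: nondecreasing_is_cvgn.
    by apply: nondecreasing_series => n *; apply: normr_ge0.
  exists (G * C) => _ [X _ <-]; rewrite /normed_series_of seriesEord.
  apply: (@le_trans _ _ (\sum_(n < X) G * normc (lam xi n))).
    apply: ler_sum => n _; apply: le_trans (f1 _) _.
    rewrite normcM normcR ler_wpM2r ?normc_ge0 //.
    rewrite normrM normfV normr_nat; apply: le_trans (hG n).
    have [->|n0] := posnP n; first by rewrite invr0 mulr0.
    by rewrite ler_pdivrMr ?ltr0n // ler_peMr // ler1n.
  by rewrite -mulr_sumr ler_wpM2l // (le_trans _ (hG 0%N)).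
split.
  exact: (main (@complex.Re R) (@ler_Re_normc R) erefl (@ReD R)).
exact: (main (@complex.Im R) (@ler_Im_normc R) erefl (@ImD R)).
Qed.

Lemma dser_ext g xi g' xi' : (forall n, (0 < n)%N -> g n = g' n) ->
  (forall p, prime p -> xi p = xi' p) -> dser g xi = dser g' xi'.
Proof.
move=> eg exi; suff e : psum g xi = psum g' xi' by rewrite /dser e.
apply/funext => X; apply: eq_bigr => n _.
have [->|n0] := posnP n; first by rewrite !lam0 !mulr0.
by rewrite eg // (@lam_coprime _ xi xi') // => *; apply: exi.
Qed.

Lemma bounded_seq_mul g k : bounded_seq g -> bounded_seq (fun n => g (k * n)%N).
Proof. by move=> [G hG]; exists G. Qed.

(** Partial sums are taken along multiples of p. The limit stays the same, and the terms divisible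
    by p then form an exact partial sum of the series of g(pn). *)
Lemma dser_upd g xi p z : bounded_seq g -> admissible xi -> prime p -> xi p = 0 ->
  normc z < 1 ->
  dser g (upd xi p z) =
  dser g xi + z / p%:R * dser (fun n => g (p * n)%N) (upd xi p z).
Proof.
move=> bg axi pp x0 z1; set xi' := upd xi p z.
have axi' := admissible_upd p axi z1.
have p0 := prime_gt0 pp.
apply: cvgC_unique (cvgC_mul p0 (dser_cvg bg axi')) _.
have -> : (fun n => psum g xi' (p * n)%N) = (fun n => psum g xi (p * n)%N +
    z / p%:R * psum (fun n => g (p * n)%N) xi' n).
  apply/funext => Y; rewrite {1}/psum.
  under eq_bigr => n _ do rewrite lam_upd // mulrDr.
  rewrite big_split; congr (_ + _) => /=.
  rewrite /psum -(@sum_multiples _ (fun m => (g (p * m)%N / m%:R)%:C * lam xi' m) p) // mulr_sumr.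
  apply: eq_bigr => n _; case: ifP => [pn|]; last by rewrite !mulr0.
  have -> : (p * (n %/ p) = n)%N by rewrite mulnC divnK.
  rewrite -{2}(divnK pn) natrM invfM !rmorphM /= !fmorphV !rmorph_nat.
  by ring.
apply: cvgCD; first exact: cvgC_mul (dser_cvg bg axi).
exact: cvgCM (dser_cvg (bounded_seq_mul p bg) axi').
Qed.

Lemma dser0 g : bounded_seq g -> dser g (fun=> 0) = (g 1%N)%:C.
Proof.
move=> bg; apply: cvgC_unique (dser_cvg bg (admissible0 R)) _.
have e : forall n, psum g (fun=> 0) n.+2 = (g 1%N)%:C.
  move=> n; rewrite /psum !big_ord_recl /= lam0 lam1 mulr0 add0r divr1 mulr1.
  rewrite big1 ?addr0 // => i _; rewrite (@lam_eq0 _ _ (pdiv (bump 0 (bump 0 i)))) ?mulr0 //.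
    by rewrite pdiv_prime.
  exact: pdiv_dvd.
split; apply: cvg_near_cst.
  by exists 2%N => // -[|[|n]] //= _; rewrite e.
by exists 2%N => // -[|[|n]] //= _; rewrite e.
Qed.

End DirichletSeries.

(** * Recovering coefficients from the twisted series *)

Section Uniqueness.
Variable R : realType.
Implicit Types (xi : nat -> R[i]) (g : nat -> R).

Lemma dser_lin g g' (a a' : R) xi : bounded_seq g -> bounded_seq g' -> admissible xi ->
  dser (fun n => a * g n + a' * g' n) xi = a%:C * dser g xi + a'%:C * dser g' xi.
Proof.
move=> bg bg' axi.
have b3 : bounded_seq (fun n => a * g n + a' * g' n).
  case: bg bg' => [G hG] [G' hG']; exists (`|a| * G + `|a'| * G') => n.
  by rewrite (le_trans (ler_normD _ _)) // !normrM lerD // ler_wpM2l.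
apply: cvgC_unique (dser_cvg b3 axi) _.
have -> : psum (fun n => a * g n + a' * g' n) xi =
    (fun X => a%:C * psum g xi X + a'%:C * psum g' xi X).
  apply/funext => X; rewrite /psum !mulr_sumr -big_split /=.
  apply: eq_bigr => n _; rewrite mulrDl -!mulrA rmorphD !rmorphM /=.
  by ring.
by apply: cvgCD; apply: cvgCM; exact: dser_cvg.
Qed.

Lemma dser_real g xi : bounded_seq g -> admissible xi ->
  (forall p, complex.Im (xi p) = 0) -> complex.Im (dser g xi) = 0.
Proof.
move=> bg axi xr; have [_ im] := dser_cvg bg axi.
apply: cvg_unique im _ => //; apply: cvg_near_cst.
near=> X; rewrite /psum Im_sum big1 // => n _.
have realE (z : R[i]) : (z \is Num.real) = (complex.Im z == 0).
  by case: z => a b; rewrite complex_real.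
apply/eqP; rewrite -realE rpredM //; first by rewrite realE.
rewrite /lam; case: eqP => _; first by rewrite real0.
by apply: rpred_prod => p _; apply: rpredX; rewrite realE xr.
Unshelve. all: by end_near. Qed.

Definition smooth K n := forall p, prime p -> (p %| n)%N -> (p <= K)%N.

(* The character [n |-> n^-k] restricted to [K]-smooth numbers. *)
Definition npow K k p : R[i] :=
  if prime p && (p <= K)%N then (p%:R^-1 ^+ k)%:C else 0.

Lemma npow_admissible K k : (0 < k)%N -> admissible (npow K k).
Proof.
move=> k0; split.
  exists (iota 0 K.+1) => p; rewrite mem_iota /= add0n ltnS => pK.
  by rewrite /npow (negPf pK) andbF.
move=> p; rewrite /npow; case: ifPn => [/andP[pp _]|_]; last by rewrite normc0.
rewrite normcR ger0_norm ?exprn_ge0 ?invr_ge0 ?ler0n // exprn_ilt1 -?lt0n ?invr_ge0 ?ler0n //.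
by rewrite invf_lt1 ?ltr0n ?prime_gt0 // ltr1n prime_gt1.
Qed.

Lemma npow_real K k p : complex.Im (npow K k p) = 0.
Proof. by rewrite /npow; case: ifP. Qed.

Lemma lam_npow K k n : (0 < n)%N -> smooth K n ->
  lam (npow K k) n = (n%:R^-1 ^+ k)%:C.
Proof.
elim/ltn_ind: n => n IHn n0 sn; have [n1|n1] := leqP n 1.
  have -> : n = 1%N by lia.
  by rewrite lam1 invr1 expr1n.
have pp := pdiv_prime n1; have pn := pdiv_dvd n; set p := pdiv n in pp pn.
have := divnK pn; rewrite mulnC => <-; set m := (n %/ p)%N.
have m0 : (0 < m)%N by rewrite divn_gt0 ?prime_gt0 // dvdn_leq.
rewrite lamM lam_prime // IHn ?ltn_Pdiv ?prime_gt1 //; last first.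
  by move=> q qp qm; apply: sn => //; apply: dvdn_trans qm (dvdn_div pn).
by rewrite /npow pp sn // natrM invfM exprMn rmorphM.
Qed.

Lemma normc_lam_npow K k n : (0 < n)%N -> normc (lam (npow K k) n) <= n%:R^-1 ^+ k.
Proof.
move=> n0; have [sn|] := pselect (smooth K n).
  by rewrite lam_npow // normcR ger0_norm ?exprn_ge0 ?invr_ge0.
move=> /existsNP[p /not_implyP[pp /not_implyP[pn pK]]].
rewrite (lam_eq0 pp pn) ?normc0 ?exprn_ge0 ?invr_ge0 //.
by rewrite /npow; case: ifP => // /andP[_ /pK].
Qed.

Lemma sum_inv_sqr n Y : (0 < n)%N ->
  \sum_(i < Y) ((n.+1 + i)%:R^-1 ^+ 2 : R) <= n%:R^-1 - (n + Y)%:R^-1.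
Proof.
move=> n0; elim: Y => [|Y IHY]; first by rewrite big_ord0 addn0 subrr.
rewrite big_ord_recr /= addSn addnS.
apply: le_trans (lerD IHY (lexx _)) _.
have x0 : 0 < (n + Y)%:R :> R by rewrite ltr0n addn_gt0 n0.
rewrite -natr1; move: (n + Y)%:R x0 => x x0.
rewrite -addrA lerD2l -subr_ge0.
have -> : - (x + 1)^-1 - (- x^-1 + (x + 1)^-1 ^+ 2) = x^-1 * (x + 1)^-1 ^+ 2.
  by field; rewrite !gt_eqF ?addr_gt0.
by rewrite mulr_ge0 ?exprn_ge0 ?invr_ge0 ?addr_ge0 ?ltW.
Qed.

(** Leading term argument: when the total vanishes, the first smooth term g(n)/n^(k+2) is cancelled
    by the tail, whose m-th term is at most G (n+1)^(-k) m^(-2). *)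
Lemma dser_npow_lead g G n K k : (forall m, `|g m| <= G) -> (0 < n)%N -> smooth K n ->
  (forall m, (0 < m < n)%N -> smooth K m -> g m = 0) ->
  dser g (npow K k.+1) = 0 -> `|g n| * n%:R^-1 ^+ k.+2 <= G * n.+1%:R^-1 ^+ k.
Proof.
move=> hG n0 sn small z0.
have bg : bounded_seq g by exists G.
have G0 : 0 <= G by apply: le_trans (hG 0%N).
have [re _] := dser_cvg bg (@npow_admissible K k.+1 isT); rewrite z0 /= in re.
set c := g n * n%:R^-1 ^+ k.+2.
have cE : `|c| = `|g n| * n%:R^-1 ^+ k.+2.
  by rewrite normrM (@ger0_norm _ (n%:R^-1 ^+ _)) // exprn_ge0 ?invr_ge0.
have re' : `|c - complex.Re (psum g (npow K k.+1) X)| @[X --> \oo] --> `|c - 0|.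
  by apply: cvg_norm; apply: cvgB => //; apply: cvg_cst.
rewrite subr0 cE in re'; apply: (ler_cvg_to re' (cvg_cst _)).
near=> X.
have nX : (n < X)%N by near: X; exact: nbhs_infty_gt.
have [Y ->] : exists Y, X = (n.+1 + Y)%N by exists (X - n.+1)%N; rewrite subnKC.
rewrite /psum big_split_ord /= big_ord_recr /=.
rewrite big1 ?add0r; last first.
  move=> i _; have [->|i0] := posnP i; first by rewrite lam0 mulr0.
  have [si|] := pselect (smooth K i).
    by rewrite small ?mul0r ?i0 ?ltn_ord.
  move=> /existsNP[p /not_implyP[pp /not_implyP[pn pK]]].
  rewrite (lam_eq0 pp pn) ?mulr0 //.
  by rewrite /npow; case: ifP => // /andP[_ /pK].
rewrite lam_npow // ReD ReZ /= -mulrA -exprS -/c opprD addNKr normrN.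
apply: le_trans (ler_Re_normc _) _; apply: le_trans (ler_normc_sum _ _ _) _.
apply: (@le_trans _ _ (\sum_(i < Y) G * n.+1%:R^-1 ^+ k * (n.+1 + i)%:R^-1 ^+ 2)).
  apply: ler_sum => i _; rewrite normcM normcR normrM normfV normr_nat.
  rewrite -!mulrA; apply: ler_pM; rewrite ?mulr_ge0 ?invr_ge0 ?normc_ge0 ?normr_ge0 ?ler0n //.
  apply: (@le_trans _ _ ((n.+1 + i)%:R^-1 * (n.+1 + i)%:R^-1 ^+ k.+1)).
    by rewrite ler_wpM2l ?invr_ge0 // normc_lam_npow.
  rewrite -exprS -[k.+2]addn2 exprD ler_wpM2r ?exprn_ge0 ?invr_ge0 //.
  rewrite lerXn2r ?nnegrE ?invr_ge0 //.
  by rewrite lef_pV2 ?posrE ?ltr0n ?ler_nat ?leq_addr.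
rewrite -mulr_sumr ler_piMr ?mulr_ge0 ?exprn_ge0 ?invr_ge0 //.
apply: le_trans (sum_inv_sqr _ n0) _.
apply: (@le_trans _ _ (n%:R^-1)); first by rewrite gerBl invr_ge0.
by rewrite invf_le1 ?ltr0n // ler1n.
Unshelve. all: by end_near. Qed.

(** The leading term loses against (n/(n+1))^k as k grows. Vanishing is asked for arbitrarily large
    k only, because the application offers two relations for each k, of which one recurs infinitely
    often. *)
Lemma dser_npow_eq0 g K : bounded_seq g ->
  (forall k0, exists2 k, (k0 <= k)%N & dser g (npow K k.+1) = 0) ->
  forall n, (0 < n)%N -> smooth K n -> g n = 0.
Proof.
move=> [G hG] hk; elim/ltn_ind => n IHn n0 sn; apply/eqP; apply/negP => /negP gn0.
pose r : R := n%:R / n.+1%:R.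
have r0 : 0 <= r by rewrite divr_ge0.
have r1 : `|r| < 1.
  by rewrite ger0_norm // ltr_pdivrMr ?ltr0n // mul1r ltr_nat.
have e0 : 0 < `|g n| by rewrite normr_gt0.
have : G * n%:R ^+ 2 * r ^+ k @[k --> \oo] --> G * n%:R ^+ 2 * 0.
  by apply: cvgM; [exact: cvg_cst | exact: cvg_expr].
rewrite mulr0 => /cvgr_lt /(_ _ e0)[k0 _ hk0].
have [k kk0 z0] := hk k0.
have small m : (0 < m < n)%N -> smooth K m -> g m = 0.
  by move=> /andP[m0 mn]; apply: IHn.
have := dser_npow_lead hG n0 sn small z0.
rewrite exprVn ler_pdivrMr ?exprn_gt0 ?ltr0n // => le1.
suff : `|g n| <= G * n%:R ^+ 2 * r ^+ k by rewrite leNgt (hk0 k kk0).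
apply: le_trans le1 _; rewrite -[k.+2]addn2 exprD /r exprMn.
by rewrite le_eqVlt; apply/orP; left; apply/eqP; ring.
Qed.

End Uniqueness.

(** * Residue classes rich in primes *)

Section PrimeClass.
Variables (R : realType) (M : nat) (b : nat -> R).
Hypothesis M0 : (0 < M)%N.
Hypothesis per : forall m n, m = n %[mod M] -> b m = b n.
Hypothesis nonvanishing : forall xi, admissible xi -> dser b xi != 0.

Lemma periodic_bounded : bounded_seq b.
Proof.
exists (\sum_(i < M) `|b i|) => n.
rewrite (@per n (n %% M)) ?modn_mod // (bigD1 (Ordinal (ltn_pmod n M0))) //=.
by rewrite lerDl sumr_ge0.
Qed.

Variable u : nat.
Hypothesis coMu : coprime u M.

(** A multiple of the order of u mod M, so that F is r-periodic in its index; the factor 3 gives r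
    >= 3, which leaves the coefficients of 1, z and z^2 untouched by truncation at r. *)
Let r := (3 * totient M)%N.

Let r3 : (3 <= r)%N.
Proof. by rewrite /r leq_pmulr // totient_gt0. Qed.

Let F j xi : R[i] := dser (fun n => b (u ^ j * n)%N) xi.

Let bF j : bounded_seq (fun n => b (u ^ j * n)%N).
Proof. exact/bounded_seq_mul/periodic_bounded. Qed.

Let F_per j xi : F (j + r)%N xi = F j xi.
Proof.
have ur : u ^ r = 1 %[mod M].
  rewrite /r [(3 * _)%N]mulnC expnM -modnXm (Euler_exp_totient coMu).
  by rewrite modnXm exp1n.
apply: dser_ext => // n _; apply: per.
by rewrite expnD -mulnA mulnCA -modnMml ur modnMml mul1n.
Qed.

Let F_upd j xi p z : admissible xi -> prime p -> xi p = 0 -> normc z < 1 ->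
  p = u %[mod M] ->
  F j (upd xi p z) = F j xi + z / p%:R * F j.+1 (upd xi p z).
Proof.
move=> axi pp x0 z1 pu; rewrite /F dser_upd //; congr (_ + _ * _).
apply: dser_ext => // n _; apply: per.
by rewrite mulnCA -modnMml pu modnMml expnS mulnA.
Qed.

(** Applying [F_upd] r times returns to the index j by periodicity, so the geometric series in w =
    z/p closes up into a polynomial of degree below r. *)
Let F_geom j xi p z : admissible xi -> prime p -> xi p = 0 -> normc z < 1 ->
  p = u %[mod M] ->
  (1 - (z / p%:R) ^+ r) * F j (upd xi p z) =
  \sum_(i < r) (z / p%:R) ^+ i * F (j + i)%N xi.
Proof.
move=> axi pp x0 z1 pu; set w := z / p%:R.
suff iter k : F j (upd xi p z) =
    \sum_(i < k) w ^+ i * F (j + i)%N xi + w ^+ k * F (j + k)%N (upd xi p z).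
  by rewrite mulrBl mul1r {1}(iter r) F_per addrK.
elim: k => [|k IHk]; first by rewrite big_ord0 add0r mul1r addn0.
by rewrite {1}IHk F_upd // -/w big_ord_recr /= addnS exprSr; ring.
Qed.

(** * Deformation along finitely many primes of the class *)

Section Deformation.
Variable xi : nat -> R[i].
Hypothesis axi : admissible xi.

Fixpoint deform (Q : seq nat) (z : R[i]) : nat -> R[i] :=
  if Q is p :: Q' then upd (deform Q' z) p z else xi.

(* [(qpoly Q 0).[z]] is, up to the nonvanishing factor in [qpoly_horner], the
   series obtained from [xi] by assigning z/2 to all the primes in Q. *)
Fixpoint qpoly (Q : seq nat) j : {poly R[i]} :=
  if Q is p :: Q' then
    \sum_(i < r) ((2 * p%:R)^-1 ^+ i) *: ('X^i * qpoly Q' (j + i)%N)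
  else (F j xi)%:P.

Definition in_class Q := [/\ uniq Q, all prime Q,
  (forall p, p \in Q -> p = u %[mod M]) & (forall p, p \in Q -> xi p = 0)].

Let in_class_cons p Q : in_class (p :: Q) ->
  [/\ in_class Q, prime p, p = u %[mod M], xi p = 0 & p \notin Q].
Proof.
move=> [/= /andP[pQ uQ] /andP[pp aQ] hm hx]; split=> //; [|by apply: hm; rewrite mem_head | by apply: hx; rewrite mem_head].
by split=> // q qQ; [apply: hm | apply: hx]; rewrite inE qQ orbT.
Qed.

Lemma deform_admissible Q z : normc z < 1 -> admissible (deform Q z).
Proof. by move=> z1; elim: Q => //= p Q IH; exact: admissible_upd. Qed.

Lemma deform_notin Q z p : p \notin Q -> deform Q z p = xi p.
Proof.
elim: Q => //= q Q IHQ; rewrite inE negb_or => /andP[/negPf pq /IHQ].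
by rewrite /upd pq.
Qed.

Lemma qpoly_horner Q j z : in_class Q -> normc z < 2 ->
  (qpoly Q j).[z] =
  \prod_(p <- Q) (1 - (z / 2 / p%:R) ^+ r) * F j (deform Q (z / 2)).
Proof.
move=> cQ z2; elim: Q cQ j => [|p Q IHQ] cQ j /=.
  by rewrite hornerC big_nil mul1r.
have [{}/IHQ IHQ pp pu px pQ] := in_class_cons cQ.
have z1 : normc (z / 2) < 1.
  by rewrite normcM normcV normc_nat ltr_pdivrMr // mul1r.
rewrite big_cons -mulrA mulrCA F_geom ?deform_notin //; last exact: deform_admissible.
rewrite mulr_sumr horner_sum; apply: eq_bigr => i _.
rewrite !hornerE IHQ; set Pi := \prod_(_ <- _) _.
rewrite -!mulrA invfM !exprMn /=; ring.
Qed.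

(** The scalar factors are the complete homogeneous symmetric polynomials of degree 0, 1, 2 in the
    numbers 1/(2p). *)
Lemma qpoly_coef Q j :
  let B := \sum_(p <- Q) (2 * p%:R)^-1 in
  let B2 := \sum_(p <- Q) (2 * p%:R)^-1 ^+ 2 in
  [/\ (qpoly Q j)`_0 = F j xi, (qpoly Q j)`_1 = B * F j.+1 xi &
      (qpoly Q j)`_2 = (B ^+ 2 + B2) / 2 * F j.+2 xi].
Proof.
elim: Q j => [|p Q IHQ] j /=.
  by rewrite !big_nil !coefC /= expr0n add0r !mul0r.
rewrite !big_cons; set c := (2 * p%:R)^-1.
have cE k : (\sum_(i < r) c ^+ i *: ('X^i * qpoly Q (j + i)%N))`_k =
    \sum_(i < r) (if (k < i)%N then 0 else c ^+ i * (qpoly Q (j + i)%N)`_(k - i)).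
  by rewrite coef_sum; apply: eq_bigr => i _; rewrite coefZ coefXnM; case: ifP; rewrite ?mulr0.
rewrite !cE; have [r' ->] : exists r', r = r'.+3 by exists (r - 3)%N; lia.
rewrite !big_ord_recl /= !big1_eq !addr0 !addn0 !subn0 /bump /= addn1 addn2.
rewrite expr0 expr1 !mul1r.
have [e0 e1 e2] := IHQ j; have [e3 e4 _] := IHQ j.+1; have [e5 _ _] := IHQ j.+2.
by rewrite e0 e1 e2 e3 e4 e5; split=> //; field.
Qed.

(** Each prime multiplies the bound by at most 1/(1 - c) with c = 1/(2p), and 1/(1 - c) <= exp(2c)
    for 0 <= c <= 1/2. *)
Lemma qpoly_bound Q C z : normc z <= 1 -> all prime Q ->
  (forall j, normc (F j xi) <= C) ->
  forall j, normc (qpoly Q j).[z] <= C * expR (2 * \sum_(p <- Q) (2 * p%:R)^-1).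
Proof.
move=> z1 aQ hC; have C0 : 0 <= C := le_trans (normc_ge0 _) (hC 0%N).
elim: Q aQ => [|p Q IHQ] /= => [_ j|/andP[pp /IHQ {}IHQ] j].
  by rewrite big_nil hornerC mulr0 expR0 mulr1.
rewrite big_cons mulrDr expRD mulrCA horner_sum.
set E := C * expR _ in IHQ *; set c : R := (2 * p%:R)^-1.
have E0 : 0 <= E by rewrite mulr_ge0 ?expR_ge0.
have p2 : 2 <= p%:R :> R by rewrite ler_nat prime_gt1.
have c0 : 0 <= c by rewrite invr_ge0; lra.
have c4 : c <= 2^-1 by rewrite lef_pV2 ?posrE //; lra.
apply: le_trans (ler_normc_sum _ _ _) _.
apply: (@le_trans _ _ (\sum_(i < r) c ^+ i * E)).
  apply: ler_sum => i _; rewrite hornerZ hornerM hornerXn !normcM !normcX; apply: ler_pM.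
  - by rewrite ?exprn_ge0 ?normc_ge0.
  - by rewrite mulr_ge0 ?exprn_ge0 ?normc_ge0.
  - by rewrite /c normcV normcM !normc_nat.
  - rewrite -[E]mul1r; apply: ler_pM; rewrite ?exprn_ge0 ?normc_ge0 ?IHQ //.
    by rewrite exprn_ile1 ?normc_ge0.
rewrite -mulr_suml ler_wpM2r //.
have : (1 - c) * \sum_(i < r) c ^+ i <= 1.
  by rewrite -opprB mulNr -subrX1 opprB gerBl exprn_ge0.
have e1 : 1 <= (1 - c) * expR (2 * c).
  have := expR_ge1Dx (2 * c); have := expR_ge0 (2 * c).
  by move=> h1 h2; apply: (@le_trans _ _ ((1 - c) * (1 + 2 * c))); [nra | apply: ler_wpM2l => //; lra].
move=> e2; have c1 : 0 < 1 - c by lra.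
by rewrite -(ler_pM2l c1); apply: le_trans e1.
Qed.

Let F_bounded : exists C, forall j, normc (F j xi) <= C.
Proof.
have r0 : (0 < r)%N by apply: leq_trans r3.
exists (\sum_(i < r) normc (F i xi)) => j.
have -> : F j xi = F (j %% r)%N xi.
  rewrite [in LHS](divn_eq j r); elim: (j %/ r)%N => [|k IHk]; first by rewrite mul0n add0n.
  by rewrite mulSn -addnA addnC F_per.
rewrite (bigD1 (Ordinal (ltn_pmod j r0))) // lerDl.
by apply: sumr_ge0 => i _; rewrite normc_ge0.
Qed.

Hypothesis unbounded : forall K : R, exists Q : seq nat,
  [/\ uniq Q, all prime Q, forall p, p \in Q -> p = u %[mod M] &
      K < \sum_(p <- Q) p%:R^-1].

(** Dropping the primes of Q that lie in the support list of xi costs at most 1 for each element of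
    that list. *)
Lemma unbounded_class (K : R) : exists2 Q, in_class Q & K < \sum_(p <- Q) p%:R^-1.
Proof.
have [[s hs] _] := axi.
have [Q [uQ aQ mQ KQ]] := unbounded (K + (size s)%:R).
pose Q1 := [seq p <- Q | p \notin s]; pose Q2 := [seq p <- Q | p \in s].
exists Q1.
  split; first exact: filter_uniq.
  - by apply/allP => p; rewrite mem_filter => /andP[_ /(allP aQ)].
  - by move=> p; rewrite mem_filter => /andP[_ /mQ].
  - by move=> p; rewrite mem_filter => /andP[/hs].
have : \sum_(p <- Q) p%:R^-1 = \sum_(p <- Q2) p%:R^-1 + \sum_(p <- Q1) p%:R^-1 :> R.
  by rewrite (bigID (mem s)) /= !big_filter.
suff : \sum_(p <- Q2) p%:R^-1 <= (size s)%:R :> R by move: KQ; lra.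
apply: (@le_trans _ _ (\sum_(p <- Q2) 1)).
  rewrite big_seq [leRHS]big_seq; apply: ler_sum => p.
  rewrite mem_filter => /andP[_ /(allP aQ) pp].
  by rewrite invf_le1 ?ltr0n ?ler1n prime_gt0.
rewrite big_const_seq count_predT iter_addr_0 ler_nat.
apply: uniq_leq_size; first exact: filter_uniq.
by move=> p; rewrite mem_filter => /andP[].
Qed.

Hypothesis xi_real : forall p, complex.Im (xi p) = 0.

Let fr j : R := complex.Re (F j xi).

Let frE j : F j xi = (fr j)%:C.
Proof.
have : complex.Im (F j xi) = 0 by exact: dser_real.
rewrite /fr; by case: (F j xi) => a c /= ->.
Qed.

Lemma fr0_neq0 : fr 0 != 0.
Proof.
have := nonvanishing axi; apply: contra_neq => e; transitivity (F 0 xi).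
  by apply: dser_ext => // n _; rewrite expn0 mul1n.
by rewrite frE e.
Qed.

(** For q normalised to q_0 = 1, q_1^2 - 2 q_2 equals B^2 D - B2 e with 0 <= B2 <= B, while the
    coefficient bound is 4 (kap + 2 B). A quadratic in B is thus bounded by a linear expression, and
    letting B grow forces D = 0. *)
Lemma log_linear : fr 0 * fr 2 = fr 1 ^+ 2.
Proof.
have f0 := fr0_neq0.
have [C hC] := F_bounded.
have C0 : 0 < C.
  by apply: lt_le_trans (hC 0%N); rewrite frE normcR normr_gt0.
pose kap := ln (C / `|fr 0|); pose e := fr 2 / fr 0.
pose D := (fr 1 / fr 0) ^+ 2 - e.
have main Q B : in_class Q -> B = \sum_(p <- Q) (2 * p%:R)^-1 ->
    B ^+ 2 * `|D| <= 4 * kap + (8 + `|e|) * B.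
  move=> cQ BE; pose B2 : R := \sum_(p <- Q) (2 * p%:R)^-1 ^+ 2.
  have [_ aQ _ _] := cQ.
  have [q0 q1 q2] := qpoly_coef Q 0.
  pose q := (F 0 xi)^-1 *: qpoly Q 0.
  have F0 : F 0 xi != 0 by rewrite frE; apply: contra_neq f0 => /complexI.
  have e0 : q`_0 = 1 by rewrite coefZ q0 mulVf.
  have rt z : root q z -> 2 <= normc z.
    rewrite rootZ ?invr_eq0 // /root; apply: contraLR; rewrite -ltNge => z2.
    rewrite qpoly_horner // mulf_neq0 //.
      rewrite prodf_seq_neq0; apply/allP => p pQ /=; rewrite subr_eq0 eq_sym.
      apply/negP => /eqP /(congr1 (@normc R)); rewrite normcX normc1; apply/eqP.
      rewrite lt_eqF // exprn_ilt1 ?normc_ge0 //; first by rewrite -lt0n (leq_trans _ r3).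
      rewrite !normcM !normcV !normc_nat.
      have p1 : 1 < p%:R :> R by rewrite ltr1n prime_gt1 // (allP aQ).
      rewrite ltr_pdivrMr ?mul1r; last by lra.
      by rewrite ltr_pdivrMr //; lra.
    have -> : F 0 (deform Q (z / 2)) = dser b (deform Q (z / 2)).
      by apply: dser_ext => // n _; rewrite expn0 mul1n.
    apply: nonvanishing; apply: deform_admissible.
    by rewrite normcM normcV normc_nat ltr_pdivrMr // mul1r.
  have bd z : normc z = 1 -> normc q.[z] <= expR (kap + 2 * B).
    move=> z1; rewrite hornerZ normcM normcV frE normcR mulrC.
    rewrite ler_pdivrMr ?normr_gt0 //.
    apply: le_trans (qpoly_bound _ aQ hC 0) _; first by rewrite z1.
    rewrite -BE.
    rewrite expRD /kap lnK ?posrE ?divr_gt0 ?normr_gt0 //.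
    by rewrite mulrAC divfK ?normr_eq0.
  have := nonvanishing_coef_bound e0 rt bd.
  rewrite !coefZ q1 q2 !frE.
  have BC : \sum_(p <- Q) (2 * p%:R)^-1 = B%:C.
    rewrite BE rmorph_sum; apply: eq_bigr => p _.
    by rewrite fmorphV rmorphM !rmorph_nat.
  have B2C : \sum_(p <- Q) (2 * p%:R)^-1 ^+ 2 = B2%:C.
    rewrite rmorph_sum; apply: eq_bigr => p _.
    by rewrite rmorphXn fmorphV rmorphM !rmorph_nat.
  rewrite BC B2C [X in complex.Re X](_ : _ = (B ^+ 2 * D - B2 * e)%:C); last first.
    rewrite /D /e !(rmorphB, rmorphM, rmorphXn, fmorphV).
    by field; apply: contra_neq f0 => /complexI.
  rewrite [complex.Re _]/=.
  have B0 : 0 <= B by rewrite BE; apply: sumr_ge0 => p _; rewrite invr_ge0.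
  have B20 : 0 <= B2 by apply: sumr_ge0 => p _; rewrite exprn_ge0 ?invr_ge0.
  have B2B : B2 <= B.
    rewrite /B2 BE big_seq [leRHS]big_seq; apply: ler_sum => p /(allP aQ) pp.
    have p1 : 1 < p%:R :> R by rewrite ltr1n prime_gt1.
    by rewrite expr2 ler_piMr ?invr_ge0 ?invf_le1 //; lra.
  move=> le1; rewrite -[X in X * `|D|]ger0_norm ?exprn_ge0 // -normrM.
  have : `|B ^+ 2 * D| <= `|B ^+ 2 * D - B2 * e| + `|B2 * e|.
    by rewrite -{1}[B ^+ 2 * D](subrK (B2 * e)) ler_normD.
  rewrite [`|B2 * e|]normrM (ger0_norm B20).
  have : B2 * `|e| <= B * `|e| by rewrite ler_wpM2r.
  by move: le1; lra.
have D0 : D = 0.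
  apply/eqP; rewrite -normr_le0 leNgt; apply/negP => D0.
  (* K |D| is |D| plus all the coefficients on the right of [main], so for B > K >= 1 the quadratic
     term wins. *)
  pose K := 1 + `|kap| * 4 / `|D| + (8 + `|e|) / `|D|.
  have [Q cQ KQ] := unbounded_class (2 * K).
  have := main Q _ cQ erefl; set B := \sum_(p <- Q) _.
  have BE : \sum_(p <- Q) p%:R^-1 = 2 * B.
    by rewrite mulr_sumr; apply: eq_bigr => p _; rewrite invfM mulVKf.
  rewrite BE ltr_pM2l // in KQ.
  have KE : K * `|D| = `|D| + 4 * `|kap| + (8 + `|e|).
    by rewrite /K; field; rewrite gt_eqF.
  have k0 := normr_ge0 kap; have kk := ler_norm kap; have e0 := normr_ge0 e.
  have K1 : 1 <= K.
    by rewrite /K -addrA lerDl addr_ge0 // divr_ge0 ?mulr_ge0 ?addr_ge0 ?ltW.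
  have BD : `|D| + 4 * `|kap| + (8 + `|e|) <= B * `|D| by rewrite -KE ler_wpM2r // ltW.
  have B1 : 1 <= B by lra.
  have h1 : B * (`|D| + 4 * `|kap| + (8 + `|e|)) <= B * (B * `|D|).
    by rewrite ler_wpM2l //; lra.
  have h2 : `|kap| <= B * `|kap| by rewrite ler_peMl.
  have h3 : 0 < B * `|D| by rewrite mulr_gt0 //; lra.
  rewrite expr2 -mulrA => h4.
  have : B * (`|D| + 4 * `|kap| + (8 + `|e|)) =
    B * `|D| + 4 * (B * `|kap|) + (8 + `|e|) * B by ring.
  by move: h1 h2 h3 h4 kk; lra.
move: D0; rewrite /D /e => /eqP; rewrite subr_eq0 => /eqP.
by move=> /(congr1 (fun x => x * fr 0 ^+ 2)); rewrite expr_div_n divfK ?expf_neq0 // => ->; field.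
Qed.

End Deformation.

Hypothesis unbounded : forall K : R, exists Q : seq nat,
  [/\ uniq Q, all prime Q, forall p, p \in Q -> p = u %[mod M] &
      K < \sum_(p <- Q) p%:R^-1].

(** [log_linear] is applied after giving one more prime p of the class the value p w, w real and
    small. With P_j(w) the sum of f_(j+i) w^i over i < r, it reads P_0 P_2 = P_1^2, and periodicity
    gives X P_(j+1) = P_j - f_j W with W = 1 - X^r. Hence f_0 P_1 = f_1 P_0, then P_0 (f_0 - f_1 X)
    = f_0^2 W. So f_0 / f_1 is a real r-th root of unity, that is 1 or -1. *)
Lemma dser_shift_sign xi : admissible xi -> (forall p, complex.Im (xi p) = 0) ->
  dser (fun n => b (u * n)%N) xi = dser b xi \/
  dser (fun n => b (u * n)%N) xi = - dser b xi.
Proof.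
move=> axi xr.
have F1E : dser (fun n => b (u * n)%N) xi = F 1 xi.
  by apply: dser_ext => // n _; rewrite expn1.
have F0E : dser b xi = F 0 xi by apply: dser_ext => // n _; rewrite expn0 mul1n.
rewrite F1E F0E.
pose fr xi j : R := complex.Re (F j xi).
have frE xi' j : admissible xi' -> (forall p, complex.Im (xi' p) = 0) -> F j xi' = (fr xi' j)%:C.
  move=> axi' xr'; have : complex.Im (F j xi') = 0 by exact: dser_real.
  by rewrite /fr; case: (F j xi') => a c /= ->.
have [Q [uQ aQ mQ xQ] KQ] := unbounded_class axi unbounded 0.
have [p pQ] : exists p, p \in Q.
  by case: Q KQ {uQ aQ mQ xQ} => [|p Q _]; [rewrite big_nil ltxx | exists p; rewrite mem_head].
have pp := allP aQ p pQ; have {mQ}pu := mQ p pQ; have {xQ}xp := xQ p pQ.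
have p0 : 0 < p%:R :> R by rewrite ltr0n prime_gt0.
pose P j := \poly_(i < r) fr xi (j + i)%N.
have PE j (w : R) : `|w| < p%:R^-1 -> let xi' := upd xi p (p%:R * w)%:C in
    (1 - w ^+ r) * fr xi' j = (P j).[w].
  move=> w1 xi'.
  have pw1 : normc (p%:R * w)%:C < 1.
    by rewrite normcR normrM normr_nat mulrC -ltr_pdivlMr // mul1r.
  have axi' : admissible xi' by exact: admissible_upd.
  have xr' q : complex.Im (xi' q) = 0 by rewrite /xi' /upd; case: eqP.
  have := F_geom j axi pp xp pw1 pu; rewrite -/xi' frE //.
  have -> : (p%:R * w)%:C / p%:R = w%:C :> R[i].
    by rewrite rmorphM rmorph_nat mulrC mulKf // pnatr_eq0 -lt0n prime_gt0.
  move=> e; apply: complexI; rewrite rmorphM rmorphB rmorphXn rmorph1 e.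
  rewrite horner_poly rmorph_sum; apply: eq_bigr => i _.
  by rewrite frE // rmorphM rmorphXn mulrC.
have w0 (w : R) : `|w| < p%:R^-1 -> 1 - w ^+ r != 0.
  move=> w1; rewrite subr_eq0 eq_sym; apply/negP => /eqP /(congr1 Num.norm).
  rewrite normrX normr1; apply/eqP; rewrite lt_eqF // exprn_ilt1 ?normr_ge0 //.
    by rewrite -lt0n (leq_trans _ r3).
  by apply: lt_trans w1 _; rewrite invf_lt1 // ltr1n prime_gt1.
have idP : P 0 * P 2 = P 1 ^+ 2.
  apply/eqP; rewrite -subr_eq0; apply/negP => /negP S0; set S := _ - _ in S0.
  (* The nodes stay below 1/p, where [PE] holds, and there are more of them than the degree of S
     allows as roots. *)
  pose rs := [seq (p%:R * (i.+2)%:R)^-1 | i <- iota 0 (size S)] : seq R.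
  have : (size rs < size S)%N.
    apply: max_poly_roots => //.
      apply/allP => _ /mapP[i _ ->]; set w := _^-1.
      have w1 : `|w| < p%:R^-1.
        rewrite ger0_norm ?invr_ge0 ?mulr_ge0 // ltf_pV2 ?posrE ?mulr_gt0 //.
        by rewrite ltr_pMr // ltr1n.
      rewrite /root /S hornerD hornerN hornerM horner_exp -!PE //.
      have pw1 : normc (p%:R * w)%:C < 1.
        by rewrite normcR normrM normr_nat mulrC -ltr_pdivlMr // mul1r.
      have axi' := admissible_upd p axi pw1.
      have xr' q : complex.Im (upd xi p (p%:R * w)%:C q) = 0 by rewrite /upd; case: eqP.
      have := log_linear axi' unbounded xr'; rewrite -/(fr _ _) -/(fr _ _) -/(fr _ _) => e.
      by rewrite exprMn -e subr_eq0; apply/eqP; ring.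
    rewrite map_inj_uniq ?iota_uniq // => i j /invr_inj /(mulfI _).
    by rewrite pnatr_eq0 -lt0n prime_gt0 // => /(_ isT) /eqP; rewrite eqr_nat => /eqP [].
  by rewrite size_map size_iota ltnn.
pose f j := fr xi j; pose W : {poly R} := 1 - 'X^r.
have shift j : 'X * P j.+1 = P j - (f j)%:P * W.
  apply/polyP => i; rewrite coefXM coefB coefCM /W coefB coef1 coefXn !coef_poly.
  case: i => [|i] /=.
    rewrite (leq_trans _ r3) // addn0 (_ : (0 == r)%N = false) ?subr0 ?mulr1 ?subrr //.
    by apply/eqP => r0; move: r3; rewrite -r0.
  rewrite sub0r mulrN opprK addSnnS; have [ir|ir|ir] := ltngtP i.+1 r.
  - by rewrite mulr0 addr0.
  - by rewrite mulr0 addr0.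
  - by rewrite ir mulr1 add0r /fr F_per.
have Wr : W`_r = -1.
  by rewrite coefB coef1 coefXn eqxx gtn_eqF ?sub0r // (leq_trans _ r3).
have W0 : W != 0.
  by apply: contra_eq_neq Wr => ->; rewrite coef0 eq_sym oppr_eq0 oner_neq0.
have E1 : P 1 * (f 0)%:P = P 0 * (f 1)%:P.
  apply: (mulfI W0); apply/eqP; rewrite -subr_eq0; apply/eqP.
  transitivity (P 0 * ('X * P 2) - ('X * P 1) * P 1); first by rewrite !shift; ring.
  by rewrite mulrCA -mulrA -expr2 -mulrBr idP subrr mulr0.
have E2 : P 0 * ((f 0)%:P - (f 1)%:P * 'X) = (f 0)%:P ^+ 2 * W.
  transitivity (P 0 * (f 0)%:P - (P 0 * (f 1)%:P) * 'X); first by ring.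
  rewrite -E1; transitivity (P 0 * (f 0)%:P - ('X * P 1) * (f 0)%:P); first by ring.
  by rewrite shift; ring.
have f0 : f 0 != 0 by exact: (fr0_neq0 axi xr).
rewrite !frE // -/(f 0) -/(f 1).
(* If f_1 = 0, the coefficients of X^r in [E2] disagree, since P 0 has degree below r. *)
have [f10|f1] := eqVneq (f 1) 0.
  move: E2; rewrite f10 polyC0 mul0r subr0 => /(congr1 (fun q : {poly R} => q`_r)).
  rewrite coefMC coef_poly ltnn mul0r -polyC_exp coefCM Wr mulrN1 => /esym/eqP.
  by rewrite oppr_eq0 expf_eq0 (negPf f0).
have := congr1 (fun q => q.[f 0 / f 1]) E2; rewrite !(hornerM, hornerD, hornerN, hornerC, hornerX, hornerXn, horner_exp).
rewrite mulrCA divff // mulr1 subrr mulr0 => /esym/eqP.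
rewrite !mulf_eq0 ?expf_eq0 (negPf f0) /= subr_eq0 eq_sym => /eqP e1.
have : `|f 0 / f 1| == 1.
  by rewrite -(@pexpr_eq1 _ _ r) ?normr_ge0 -?normrX ?e1 ?normr1 // (leq_trans _ r3).
rewrite eqr_norml ler01 andbT => /orP[] /eqP /(congr1 ( *%R^~ (f 1))).
  by rewrite divfK // mul1r => ->; left.
by rewrite divfK // mulN1r => ->; right; rewrite rmorphN opprK.
Qed.

(** The sign given by [dser_shift_sign] may vary with the twist. For fixed K one sign occurs for
    arbitrarily large k, which settles all K-smooth n; comparing at n = 1, which is smooth for every
    K and has b(1) != 0, shows that the sign does not depend on K. *)
Lemma unit_shift : exists2 e : R, (e == 1) || (e == -1) & forall n, b (u * n)%N = e * b n.
Proof.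
have bb := periodic_bounded.
have bu := bounded_seq_mul u bb.
have b1 : b 1%N != 0.
  have := nonvanishing (admissible0 R); rewrite dser0 //.
  by apply: contra_neq => ->.
have sgn K : exists2 e : R, (e == 1) || (e == -1) &
    forall n, (0 < n)%N -> smooth K n -> b (u * n)%N = e * b n.
  have sm (e : R) : (e == 1) || (e == -1) ->
      (forall k0, exists2 k, (k0 <= k)%N & dser (fun n => b (u * n)%N) (npow R K k.+1)
         = e%:C * dser b (npow R K k.+1)) ->
      exists2 e : R, (e == 1) || (e == -1) &
        forall n, (0 < n)%N -> smooth K n -> b (u * n)%N = e * b n.
    move=> eP ek; exists e => // n n0 sn; apply/eqP; rewrite -subr_eq0; apply/eqP.
    pose g n := 1 * b (u * n)%N + (- e) * b n.
    have bg : bounded_seq g.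
      case: bu bb => [G hG] [G' hG']; exists (G + `|e| * G') => m.
      rewrite /g mul1r mulNr (le_trans (ler_normB _ _)) // normrM.
      by rewrite lerD // ler_wpM2l.
    have : g n = 0.
      apply: (dser_npow_eq0 bg _ n0 sn) => k0; have [k kk0 ke] := ek k0.
      exists k => //; rewrite dser_lin //; last exact: npow_admissible.
      by rewrite ke rmorph1 mul1r rmorphN mulNr subrr.
    by rewrite /g mul1r mulNr.
  have [h|h] := pselect (forall k0, exists2 k, (k0 <= k)%N &
    dser (fun n => b (u * n)%N) (npow R K k.+1) = 1%:C * dser b (npow R K k.+1)).
    by apply: (sm 1); rewrite ?eqxx.
  apply: (sm (-1)); rewrite ?eqxx ?orbT // => k0.
  move/existsNP: h => [k1 hk1]; exists (maxn k0 k1); first exact: leq_maxl.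
  have [e|->] := dser_shift_sign (@npow_admissible R K (maxn k0 k1).+1 isT) (npow_real R K _).
    by exfalso; apply: hk1; exists (maxn k0 k1); rewrite ?leq_maxr // rmorph1 mul1r.
  by rewrite rmorphN rmorph1 mulN1r.
have sm1 K : smooth K 1 by move=> p pp /dvdn_leq -/(_ isT); have := prime_gt1 pp; lia.
have [e eP he] := sgn 1%N; exists e => //.
have main n : (0 < n)%N -> b (u * n)%N = e * b n.
  move=> n0; have [e' _ he'] := sgn n.
  have -> : e = e'.
    by apply: (mulIf b1); rewrite -he // -he'.
  by apply: he' => // p _ /dvdn_leq; apply.
(* The index 0 is invisible to the series; by periodicity it is treated as M. *)
case=> [|n]; last exact: main.
have := main M M0; rewrite (@per (u * M)%N 0%N) ?modnMl ?mod0n // (@per M 0%N) ?modnn ?mod0n //.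
by rewrite muln0.
Qed.

End PrimeClass.

(** * The sieve *)

Section PrimesOutsideSubgroup.
Variable R : realType.

Lemma sum_blocks (V : nmodType) (F : nat -> V) N L :
  \sum_(n < N * L) F n = \sum_(j < L) \sum_(i < N) F (N * j + i)%N.
Proof.
elim: L => [|L IHL]; first by rewrite muln0 !big_ord0.
by rewrite mulnSr big_split_ord big_ord_recr /= IHL.
Qed.

Section Blocks.
Variables (N : nat) (Q : pred nat).
Hypothesis N0 : (0 < N)%N.
Hypothesis Qper : forall j i, Q (N * j + i)%N = Q i.
Let c := #|[pred i : 'I_N | Q i]|.

Let cE (x : R) : \sum_(i < N | Q i) x = c%:R * x.
Proof.
by rewrite sumr_const -[LHS]mulr_natl.
Qed.

Let sumE L : \sum_(n < N * L.+1 | Q n) n%:R^-1 =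
  \sum_(j < L.+1) \sum_(i < N | Q i) (N * j + i)%:R^-1 :> R.
Proof.
rewrite big_mkcond.
transitivity (\sum_(j < L.+1) \sum_(i < N)
    (if Q (N * j + i)%N then (N * j + i)%:R^-1 else 0) : R).
  exact: (sum_blocks (fun n => if Q n then n%:R^-1 else 0 : R)).
by apply: eq_bigr => j _; rewrite [RHS]big_mkcond; apply: eq_bigr => i _; rewrite Qper.
Qed.

(** Block j contains c terms, each between 1/(N(j+1)) and 1/(Nj). Block 0 is dropped here and
    bounded by N in [sum_inv_le], so the sum is c/N times a harmonic sum up to a constant. *)
Lemma sum_inv_ge L : c%:R / N%:R * (\sum_(j < L) j.+2%:R^-1) <=
  \sum_(n < N * L.+1 | Q n) n%:R^-1 :> R.
Proof.
rewrite sumE big_ord_recl -[leLHS]add0r lerD //.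
  by apply: sumr_ge0.
rewrite mulr_sumr; apply: ler_sum => j _.
rewrite -mulrA -cE; apply: ler_sum => i _.
rewrite -invfM -natrM lef_pV2 ?posrE ?ltr0n //; last 2 first.
- by rewrite muln_gt0 N0.
- by rewrite addn_gt0 muln_gt0 N0.
by rewrite ler_nat /bump /= [leqRHS]mulnS addnC leq_add2r ltnW.
Qed.

Lemma sum_inv_le L : \sum_(n < N * L.+1 | Q n) n%:R^-1 <=
  N%:R + c%:R / N%:R * (\sum_(j < L) j.+1%:R^-1) :> R.
Proof.
rewrite sumE big_ord_recl lerD //.
  apply: (@le_trans _ _ (\sum_(i < N) 1)); last by rewrite sumr_const card_ord.
  rewrite big_mkcond; apply: ler_sum => i _; case: ifP => // _; rewrite muln0 add0n.
  by have [->|i0] := posnP i; rewrite ?invr0 // invf_le1 ?ler1n ?ltr0n.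
rewrite mulr_sumr; apply: ler_sum => j _.
rewrite -mulrA -cE; apply: ler_sum => i _.
rewrite -invfM -natrM lef_pV2 ?posrE ?ltr0n //; last 2 first.
- by rewrite addn_gt0 muln_gt0 N0.
- by rewrite muln_gt0 N0.
by rewrite ler_nat /bump /= leq_addr.
Qed.

End Blocks.

Lemma harmonic_unbounded (K : R) : exists L, K < \sum_(j < L) j.+2%:R^-1.
Proof.
apply: contrapT => /forallNP h; apply: (@dvg_harmonic R).
apply: nondecreasing_is_cvgn.
  by apply: nondecreasing_series => n _ _; apply: harmonic_ge0.
exists (1 + K) => _ [[|L] _ <-]; rewrite seriesEord /=.
  rewrite big_ord0; have := h 0%N; rewrite big_ord0 => /negP; rewrite -leNgt; lra.
rewrite big_ord_recl; apply: lerD; first by rewrite /harmonic invr1.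
by have /negP := h L; rewrite -leNgt.
Qed.

Variables (M : nat) (H : nat -> Prop).
Hypothesis M0 : (0 < M)%N.
Hypothesis H1 : H 1%N.
Hypothesis HM : forall m n, H m -> H n -> H (m * n)%N.
Hypothesis Hmod : forall m n, m = n %[mod M] -> H m -> H n.
Hypothesis bounded_class : forall u, coprime u M -> ~ H u ->
  exists K : R, forall Q : seq nat, uniq Q -> all prime Q ->
    (forall p, p \in Q -> p = u %[mod M]) -> \sum_(p <- Q) p%:R^-1 <= K.

Let E p := [&& prime p, coprime p M & ~~ `[< H p >]].

Let H_of_primes n : (0 < n)%N -> (forall p, prime p -> (p %| n)%N -> H p) -> H n.
Proof.
elim/ltn_ind: n => n IHn n0 hp; have [n1|n1] := leqP n 1.
  by have -> : n = 1%N by lia.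
have pp := pdiv_prime n1; have pn := pdiv_dvd n.
rewrite -(divnK pn); apply: HM; last exact: hp.
apply: IHn; first by rewrite ltn_Pdiv ?prime_gt1.
  by rewrite divn_gt0 ?pdiv_gt0 // dvdn_leq.
by move=> q qp qm; apply: hp => //; apply: dvdn_trans qm (dvdn_div pn).
Qed.

(** Split by residues mod M: a class that meets E lies outside H, so [bounded_class] applies to
    it. *)
Let Esum_bounded : exists K : R, forall n, \sum_(p < n | E p) p%:R^-1 <= K.
Proof.
suff /boolp.choice[K hK] : forall c : nat, exists k : R,
    forall n, \sum_(p < n | E p && (p %% M == c)%N) p%:R^-1 <= k.
  exists (\sum_(c < M) K c) => n.
  rewrite (partition_big (fun p : 'I_n => Ordinal (ltn_pmod p M0)) xpredT) //=.
  apply: ler_sum => c _; apply: le_trans (hK c n).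
  by rewrite le_eqVlt; apply/orP; left; apply/eqP/eq_bigl.
move=> c.
have [[u [Eu uc]]|no] := pselect (exists u, E u /\ (u %% M = c)%N); last first.
  exists 0 => n; rewrite big1 // => p /andP[Ep /eqP pc].
    by exfalso; apply: no; exists p.
  have /and3P[_ uM /asboolPn nHu] := Eu.
  have [k hk] := bounded_class uM nHu; exists k => n.
  rewrite -(big_mkord (fun p => E p && (p %% M == c)%N) (fun p => p%:R^-1 : R)).
  rewrite -big_filter; apply: hk; first by rewrite filter_uniq ?iota_uniq.
    by apply/allP => p; rewrite mem_filter => /andP[/andP[/and3P[]]].
  by move=> p; rewrite mem_filter uc => /andP[/andP[_ /eqP]].
Qed.

Let Etail (d : R) : 0 < d -> exists Y, forall n, \sum_(p < n | E p && (Y <= p)%N) p%:R^-1 <= d.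
Proof.
move=> d0; have [K hK] := Esum_bounded.
pose e n : R := \sum_(p < n | E p) p%:R^-1.
have nd : nondecreasing_seq e.
  apply/nondecreasing_seqP => n; rewrite /e [leRHS]big_mkcond big_ord_recr /= -big_mkcond.
  by rewrite lerDl; case: ifP.
have cv : cvgn e by apply: nondecreasing_is_cvgn => //; exists K => _ [n _ <-]; exact: hK.
have : \forall n \near \oo, lim (e @ \oo) - d < e n.
  by apply: (cvgr_gt _ cv); rewrite ltrBlDr ltrDl.
move=> [Y _ /(_ Y (leqnn Y)) /= eY]; exists Y => n.
have le_lim := nondecreasing_cvgn_le nd cv (maxn n Y).
suff : \sum_(p < n | E p && (Y <= p)%N) p%:R^-1 <= e (maxn n Y) - e Y by lra.
apply: (@le_trans _ _ (\sum_(p < maxn n Y | E p && (Y <= p)%N) p%:R^-1)).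
  rewrite (big_ord_widen_cond (maxn n Y) (fun p => E p && (Y <= p)%N) (fun p => p%:R^-1)) ?leq_maxl //.
  by rewrite big_mkcondr /=; apply: ler_sum => p _; case: ifP.
rewrite /e (big_ord_widen_cond (maxn n Y) E (fun p => p%:R^-1) (leq_maxr _ _)).
rewrite [X in _ <= X - _](bigID (fun p : 'I_(maxn n Y) => (Y <= p)%N)) /= lerBrDr lerD2l.
by rewrite le_eqVlt; apply/orP; left; apply/eqP/eq_bigl => p; rewrite -ltnNge.
Qed.

(* If a is not in H, every n = a mod M has a prime factor outside H; keeping only
   n coprime to the small primes outside H makes the logarithmic density of such
   n too small. *)
Theorem class_in_subgroup a : coprime a M -> H a.
Proof.
move=> aM; apply: contrapT => nHa.
(* Half of 1/M, the least proportion of the class a among the residues coprime to P found in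
   [c1a]. *)
have d0' : 0 < (2 * M%:R)^-1 :> R by rewrite invr_gt0 mulr_gt0 ?ltr0n.
have [Y hY] := Etail d0'.
pose P := (\prod_(p < Y | E p) p)%N.
have PM : coprime P M.
  rewrite /P; apply: (big_ind (fun x => coprime x M)); first exact: coprime1n.
    by move=> x y xM yM; rewrite coprimeMl xM.
  by move=> p /and3P[].
have P0 : (0 < P)%N by rewrite prodn_cond_gt0 // => p /and3P[/prime_gt0].
pose N := (M * P)%N; have N0 : (0 < N)%N by rewrite muln_gt0 M0.
pose Qa n := coprime n P && (n == a %[mod M])%N.
have Qcop j i : coprime (N * j + i) P = coprime i P.
  by rewrite -coprime_modl -modnDml /N -mulnA mulnCA modnMr add0n coprime_modl.
have Qa_per j i : Qa (N * j + i)%N = Qa i.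
  by rewrite /Qa Qcop -modnDml /N -mulnA modnMr add0n.
have cover n : (0 < n)%N -> Qa n -> exists p, [/\ E p, (Y <= p)%N & (p %| n)%N].
  move=> n0 /andP[nP /eqP na]; apply: contrapT => no; apply: nHa.
  apply: (Hmod na); apply: H_of_primes => // p pp pn.
  apply: contrapT => nHp; apply: no; exists p.
  have Ep : E p.
    rewrite /E pp /= asboolF // andbT; apply: coprime_dvdl pn _.
    by rewrite -coprime_modl na coprime_modl.
  split=> //; rewrite leqNgt; apply/negP => pY.
  have : (p %| P)%N by rewrite /P (bigD1 (Ordinal pY)) //= dvdn_mulr.
  move=> pP; have : (p %| gcdn n P)%N by rewrite dvdn_gcd pn.
  by rewrite (eqP nP) dvdn1 => /eqP p1; rewrite p1 in pp.
pose c1 := #|[pred i : 'I_N | coprime i P]|.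
pose ca := #|[pred i : 'I_N | Qa i]|.
(* By the Chinese remainder theorem, a residue coprime to P is determined by its class mod M and by
   the residue in the class a that agrees with it mod P. *)
have c1a : (c1 <= M * ca)%N.
  pose f (i : 'I_N) := (Ordinal (ltn_pmod i M0), Ordinal (ltn_pmod (chinese M P a i) N0)).
  have MP : coprime M P by rewrite coprime_sym.
  have f_inj : {in [pred i : 'I_N | coprime i P] &, injective f}.
    move=> i j _ _ [ij e]; apply: val_inj => /=.
    have eP : i = j %[mod P].
      move/(congr1 (modn^~ P)): e; rewrite !modn_dvdm ?dvdn_mull //.
      by rewrite !chinese_modr.
    have := chinese_remainder MP i j; rewrite ij eP !eqxx => /eqP.
    by rewrite !modn_small.
  rewrite /c1 /ca -(card_in_image f_inj) -[X in (X * _)%N]card_ord -cardX.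
  apply: subset_leq_card; apply/fintype.subsetP => x /fintype.imageP[i iP ->].
  rewrite !inE /= /Qa modn_dvdm ?dvdn_mulr // chinese_modl // eqxx andbT.
  by rewrite -coprime_modl modn_dvdm ?dvdn_mull // chinese_modr // coprime_modl.
have c10 : (0 < c1)%N.
  apply/card_gt0P; exists (Ordinal (ltn_pmod 1 N0)).
  by rewrite inE /= -(Qcop (1 %/ N)%N) mulnC -divn_eq coprime1n.
(* Each n counted by [Qa] is p m with p in E, p >= Y and m coprime to P, so the sum is at most the
   tail of reciprocals over E times the sum over integers coprime to P. *)
have main X : \sum_(n < X | Qa n) n%:R^-1 <=
    (2 * M%:R)^-1 * \sum_(n < X | coprime n P) n%:R^-1 :> R.
  set T := \sum_(n < X | coprime n P) _.
  apply: (@le_trans _ _ (\sum_(n < X | Qa n) \sum_(p < X | [&& E p, (Y <= p)%N & (p %| n)%N]) n%:R^-1)).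
    apply: ler_sum => n Qn; have [->|n0] := posnP n.
      by rewrite invr0 big1.
    have [p [Ep Yp pn]] := cover n n0 Qn.
    have pX : (p < X)%N by apply: leq_ltn_trans (ltn_ord n); apply: dvdn_leq.
    rewrite (bigD1 (Ordinal pX)) /= ?Ep ?Yp ?pn // lerDl.
    by apply: sumr_ge0.
  rewrite (exchange_big_dep (fun p : 'I_X => E p && (Y <= p)%N)) /=; last first.
    by move=> n p _ /and3P[-> ->].
  apply: (@le_trans _ _ (\sum_(p < X | E p && (Y <= p)%N) p%:R^-1 * T)); last first.
    by rewrite -mulr_suml ler_wpM2r ?hY //; apply: sumr_ge0.
  apply: ler_sum => p /andP[Ep Yp].
  have pp : prime p by case/and3P: Ep.
  pose h m : R := p%:R^-1 * (if coprime m P then m%:R^-1 else 0).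
  have h0 m : 0 <= h m by rewrite mulr_ge0 ?invr_ge0 //; case: ifP.
  have -> : p%:R^-1 * T = \sum_(m < X) h m.
    by rewrite -mulr_sumr /T [in LHS]big_mkcond.
  rewrite -(sum_multiples h X (prime_gt0 pp)).
  rewrite big_mkcond -(big_mkord xpredT (fun n => if Qa n && [&& E p, (Y <= p)%N & (p %| n)%N] then n%:R^-1 : R else 0)).
  rewrite -(big_mkord xpredT (fun n => if (p %| n)%N then h (n %/ p)%N else 0)).
  rewrite [leRHS](@big_cat_nat _ _ _ X 0 (p * X)%N) //= ?leq_pmull ?prime_gt0 //.
  rewrite -[leLHS]addr0; apply: lerD; last by apply: sumr_ge0 => n _; case: ifP.
  apply: ler_sum => n _; case: ifP => [/and4P[/andP[nP _] _ _ pn]|_]; last by case: ifP.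
  rewrite pn /h (coprime_dvdl _ nP); last exact: dvdn_div.
  by rewrite -invfM -natrM mulnC divnK.
have [L hL] := harmonic_unbounded (((2 * M%:R)^-1 * N%:R + ca%:R / N%:R) / (ca%:R / N%:R / 2)).
have ca0 : (0 < ca)%N by move: c1a c10; case: (ca) => //; rewrite muln0; lia.
have t0 : 0 < ca%:R / N%:R :> R by rewrite divr_gt0 ?ltr0n.
have := @sum_inv_ge N Qa N0 Qa_per L; rewrite -/ca => h1.
have := @sum_inv_le N (fun n => coprime n P) N0 Qcop L; rewrite -/c1 => h2.
have := main (N * L.+1)%N; move: h1 h2.
set S := \sum_(_ < _ | Qa _) _; set T := \sum_(_ < _ | coprime _ _) _.
set A := \sum_(j < L) _ in hL *; set B := \sum_(j < L) _.
have BA : B <= 1 + A.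
  rewrite /B /A; case: (L) => [|l]; first by rewrite !big_ord0 addr0.
  rewrite big_ord_recl invr1 lerD2l big_ord_recr /= lerDl.
  by rewrite invr_ge0.
rewrite ltr_pdivrMr ?(divr_gt0 t0) // in hL.
have d0 : 0 <= (2 * M%:R)^-1 :> R by rewrite invr_ge0.
have cc : (2 * M%:R)^-1 * (c1%:R / N%:R) <= ca%:R / N%:R / 2 :> R.
  rewrite invfM.
  rewrite [leRHS](_ : _ = ca%:R * (2^-1 / N%:R)); last by ring.
  rewrite [leLHS](_ : _ = c1%:R / M%:R * (2^-1 / N%:R)); last by ring.
  rewrite ler_wpM2r ?mulr_ge0 ?invr_ge0 //.
  by rewrite ler_pdivrMr ?ltr0n // -natrM ler_nat mulnC.
have B0 : 0 <= B by apply: sumr_ge0.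
move=> h1 h2 h3.
have h4 : (2 * M%:R)^-1 * T <= (2 * M%:R)^-1 * (N%:R + c1%:R / N%:R * B) by rewrite ler_wpM2l.
have h5 := ler_wpM2r B0 cc.
have h6 : ca%:R / N%:R / 2 * B <= ca%:R / N%:R / 2 * (1 + A) by rewrite ler_wpM2l // divr_ge0 // ltW.
move: t0 hL h1 h3 h4 h5 h6; clear.
move: N%:R (2 * M%:R)^-1 (c1%:R / N%:R) (ca%:R / N%:R) => nN d y t.
by lra.
Qed.

End PrimesOutsideSubgroup.

(** * The finite cosine transform *)

Section Cosines.
Variable R : realType.
Implicit Types (x y a : R).

Lemma cosD2pin x n : cos (x + 2 * pi * n%:R) = cos x.
Proof.
have -> : 2 * pi * n%:R = (pi *+ 2) *+ n :> R by rewrite -[RHS]mulr_natr -[pi *+ 2]mulr_natl.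
exact: periodicn (@cosD2pi R) n x.
Qed.

Lemma sinD2pin x n : sin (x + 2 * pi * n%:R) = sin x.
Proof.
have -> : 2 * pi * n%:R = (pi *+ 2) *+ n :> R by rewrite -[RHS]mulr_natr -[pi *+ 2]mulr_natl.
exact: periodicn (@sinD2pi R) n x.
Qed.

Definition cosq (M n : nat) : R := cos (2 * pi * (n%:R / M%:R)).

Lemma cos_mod a n n' k : (0 < k)%N -> n = n' %[mod k] ->
  cos (a + 2 * pi * (n%:R / k%:R)) = cos (a + 2 * pi * (n'%:R / k%:R)).
Proof.
move=> k0 nn'; have kn0 : k%:R != 0 :> R by rewrite pnatr_eq0 -lt0n.
suff red m : cos (a + 2 * pi * (m%:R / k%:R)) = cos (a + 2 * pi * ((m %% k)%:R / k%:R)).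
  by rewrite red nn' -red.
have -> : a + 2 * pi * (m%:R / k%:R) = (a + 2 * pi * ((m %% k)%:R / k%:R)) + 2 * pi * (m %/ k)%:R.
  by rewrite {1}(divn_eq m k) natrD natrM; field.
by rewrite cosD2pin.
Qed.

Lemma cosq_mod M n n' : (0 < M)%N -> n = n' %[mod M] -> cosq M n = cosq M n'.
Proof. by move=> M0 e; rewrite /cosq -[2 * pi * _]add0r -[in RHS](add0r (2 * pi * _)); apply: cos_mod. Qed.

(** When k does not divide n, the factor 2 sin(b/2) is nonzero, since b/2 lies strictly between 0
    and pi, and it makes the sum telescope. The phase a is what the sine coefficients of dilations
    require. *)
Lemma cos_sum a n k : (0 < k)%N ->
  \sum_(l < k) cos (a + 2 * pi * ((n * l)%:R / k%:R)) = if (k %| n)%N then k%:R * cos a else 0.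
Proof.
move=> k0; have kn0 : k%:R != 0 :> R by rewrite pnatr_eq0 -lt0n.
have red (l : 'I_k) : cos (a + 2 * pi * ((n * l)%:R / k%:R)) =
    cos (a + 2 * pi * ((n %% k * l)%:R / k%:R)).
  by apply: cos_mod => //; rewrite modnMml.
under eq_bigr do rewrite red.
rewrite /dvdn; set r := (n %% k)%N; case: eqP => [->|/eqP r0].
  under eq_bigr do rewrite mul0n mul0r mulr0 addr0.
  by rewrite sumr_const card_ord mulr_natl.
rewrite -lt0n in r0; have rk : (r < k)%N by rewrite ltn_mod.
pose b : R := 2 * pi * (r%:R / k%:R).
have s0 : sin (b / 2) != 0.
  rewrite gt_eqF // sin_gt0_pi // /b.
  have -> : 2 * pi * (r%:R / k%:R) / 2 = pi * (r%:R / k%:R) :> R by field.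
  rewrite mulr_gt0 ?pi_gt0 ?divr_gt0 ?ltr0n //=.
  by rewrite -[ltRHS]mulr1 ltr_pM2l ?pi_gt0 // ltr_pdivrMr ?ltr0n // mul1r ltr_nat.
apply: (mulfI s0); apply: (@mulfI _ 2); first by rewrite pnatr_eq0.
rewrite !mulr0 !mulr_sumr.
pose S l := sin (a + b * l%:R - b / 2).
transitivity (\sum_(l < k) (S l.+1 - S l)).
  apply: eq_bigr => l _.
  have -> : 2 * pi * ((r * l)%:R / k%:R) = b * l%:R by rewrite /b natrM; ring.
  have -> : S l.+1 = sin ((a + b * l%:R) + b / 2) by rewrite /S -natr1; congr sin; field.
  by rewrite /S sinB sinD; ring.
rewrite -(big_mkord xpredT (fun l => S l.+1 - S l)) telescope_sumr // /S mulr0 addr0.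
have -> : a + b * k%:R - b / 2 = a - b / 2 + 2 * pi * r%:R by rewrite /b; field.
by rewrite sinD2pin subrr.
Qed.

Lemma cosq_sum n k : (0 < k)%N ->
  \sum_(l < k) cosq k (n * l) = if (k %| n)%N then k%:R else 0.
Proof.
move=> k0; have := cos_sum 0 n k0; rewrite cos0 mulr1 => <-.
by apply: eq_bigr => l _; rewrite add0r.
Qed.

Lemma cosqM k m n : cosq k m * cosq k n =
  2^-1 * (cos (2 * pi * (m%:R / k%:R) + 2 * pi * (n%:R / k%:R))
        + cos (2 * pi * (m%:R / k%:R) - 2 * pi * (n%:R / k%:R))).
Proof. by rewrite /cosq cosD cosB; field. Qed.

End Cosines.

(** * Units modulo M and their action on periodic sequences *)

Section UnitsModM.

(** M splits into the part built from the primes of d and a part coprime to d; the lift is w on the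
    first and 1 on the second. *)
Lemma unit_lift M d w : (0 < M)%N -> (d %| M)%N -> coprime w d ->
  exists2 u, coprime u M & u = w %[mod d].
Proof.
move=> M0 dM wd; have d0 : (0 < d)%N by apply: dvdn_gt0 dM.
have [d1|d1] := eqVneq d 1%N.
  by exists 1%N; rewrite ?coprime1n // d1 !modn1.
have w0 : (0 < w)%N.
  by rewrite lt0n; apply: contraNneq d1 => w0; move: wd; rewrite w0 /coprime gcd0n.
set M1 := (M`_\pi(d))%N; set M2 := (M`_\pi(d)^')%N.
have co : coprime M1 M2 by rewrite coprime_partC.
have dM1 : (d %| M1)%N.
  by rewrite -(part_pnat_id (pnat_pi d0)) partn_dvd.
have wM1 : coprime w M1.
  rewrite coprime_sym; apply: (@pnat_coprime \pi(d)); first exact: part_pnat.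
  by rewrite -coprime_pi' // coprime_sym.
exists (chinese M1 M2 w 1).
  rewrite -(partnC \pi(d) M0) -/M1 -/M2 coprimeMr.
  rewrite -[coprime _ M1]coprime_modl -[coprime _ M2]coprime_modl.
  by rewrite chinese_modl // chinese_modr // !coprime_modl wM1 coprime1n.
by rewrite -(modn_dvdm _ dM1) chinese_modl // modn_dvdm.
Qed.

Lemma modn_cancel_unit M u i j : coprime u M ->
  u * i = u * j %[mod M] -> i = j %[mod M].
Proof.
move=> uM; wlog ij : i j / (i <= j)%N => [h|].
  by have [/h//|/ltnW/h] := leqP i j => + /esym e => /(_ e).
move=> /esym/eqP; rewrite eqn_mod_dvd ?leq_mul // -mulnBr Gauss_dvdr 1?coprime_sym //.
by rewrite -eqn_mod_dvd // => /eqP.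
Qed.

Lemma sum_unit (V : nmodType) M u (F : nat -> V) : (0 < M)%N -> coprime u M ->
  (forall m n, m = n %[mod M] -> F m = F n) ->
  \sum_(n < M) F (u * n)%N = \sum_(n < M) F n.
Proof.
move=> M0 uM per; pose h (n : 'I_M) := Ordinal (ltn_pmod (u * n) M0).
have h_inj : injective h.
  move=> i j [/(modn_cancel_unit uM)]; rewrite !modn_small // => ij.
  exact: val_inj.
rewrite [RHS](reindex_inj h_inj) /=; apply: eq_bigr => n _.
by apply: per; rewrite modn_mod.
Qed.

End UnitsModM.

Section Eigen.
Variables (R : realType) (M : nat) (b : nat -> R).
Hypothesis M0 : (0 < M)%N.
Hypothesis per : forall m n, m = n %[mod M] -> b m = b n.
Hypothesis nonvanishing : forall xi, admissible xi -> dser b xi != 0.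

Theorem unit_eigen u : coprime u M ->
  exists2 e : R, (e == 1) || (e == -1) & forall n, b (u * n)%N = e * b n.
Proof.
pose H u := exists2 e : R, (e == 1) || (e == -1) & forall n, b (u * n)%N = e * b n.
apply: (@class_in_subgroup R M H M0).
- by exists 1; rewrite ?eqxx // => n; rewrite mul1n mul1r.
- move=> m n [e eP em] [f fP fn]; exists (e * f).
    by case/orP: eP => /eqP ->; case/orP: fP => /eqP ->; rewrite ?mulN1r ?mul1r ?opprK ?eqxx ?orbT.
  by move=> k; rewrite -mulnA em fn mulrA.
- move=> m n mn [e eP em]; exists e => // k; rewrite -em; apply: per.
  by rewrite -modnMml -mn modnMml.
move=> v vM nHv; apply: contrapT => /forallNP unb; apply: nHv.
apply: (unit_shift M0 per nonvanishing vM) => K.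
have /existsNP[Q /not_implyP[uQ /not_implyP[aQ /not_implyP[mQ /negP KQ]]]] := unb K.
by exists Q; split=> //; rewrite ltNge.
Qed.

End Eigen.

Section EvenPeriodic.
Variables (R : realType) (M : nat) (J : nat -> R).
Hypothesis M0 : (0 < M)%N.
Hypothesis Jper : forall i j, i = j %[mod M] -> J i = J j.
Hypothesis Jeven : forall i j, (M %| i + j)%N -> J i = J j.

Definition dual n : R := \sum_(i < M) J i * cosq R M (n * i).

Lemma dual_per m n : m = n %[mod M] -> dual m = dual n.
Proof.
move=> mn; apply: eq_bigr => i _; congr (_ * _); apply: cosq_mod => //.
by rewrite -modnMml mn modnMml.
Qed.

Let sum_single k (x : R) : \sum_(i < M) (if (M %| i + k)%N then x else 0) = x.
Proof.
have kM : (k %% M < M)%N by rewrite ltn_mod.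
have P0 : ((M - k %% M) %% M < M)%N by rewrite ltn_mod.
have dv : (M %| (M - k %% M) %% M + k)%N.
  by rewrite /dvdn modnDml -modnDmr subnK ?modnn // ltnW.
rewrite (bigD1 (Ordinal P0)) //= dv big1 ?addr0 // => i ni.
case: ifP => // ik; case/eqP: ni; apply: val_inj => /=.
have : i + k = (M - k %% M) %% M + k %[mod M] by rewrite (eqP ik) (eqP dv).
by move=> /eqP; rewrite eqn_modDr modn_small // modn_mod => /eqP.
Qed.

(** Orthogonality of cosines leaves the two indices i = j and i = -j mod M, each with weight M/2,
    and evenness makes them contribute equally. *)
Lemma dual_inv j : J j = M%:R^-1 * \sum_(n < M) dual n * cosq R M (n * j).
Proof.
have MR0 : M%:R != 0 :> R by rewrite pnatr_eq0 -lt0n.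
wlog jM : j / (j < M)%N => [h|].
  rewrite (@Jper j (j %% M)) ?modn_mod // {1}h ?ltn_mod //; congr (_ * _).
  by apply: eq_bigr => n _; congr (_ * _); apply: cosq_mod => //; rewrite modnMmr.
apply: (mulfI MR0); rewrite mulrA mulfV // mul1r.
have prod n i : cosq R M (n * i) * cosq R M (n * j) =
    2^-1 * (cosq R M ((i + j) * n) + cosq R M ((i + (M - j)) * n)).
  rewrite cosqM; congr (_ * (_ + _)).
    by rewrite /cosq !natrM natrD; congr cos; ring.
  rewrite -[LHS](cosD2pin _ n) /cosq !natrM natrD natrB ?(ltnW jM) //.
  by congr cos; field.
transitivity (\sum_(i < M) \sum_(n < M) J i * (2^-1 * (cosq R M ((i + j) * n) + cosq R M ((i + (M - j)) * n)))); last first.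
  rewrite exchange_big; apply: eq_bigr => n _; rewrite /dual mulr_suml.
  by apply: eq_bigr => i _; rewrite -mulrA prod.
have inner (i : 'I_M) : \sum_(n < M) J i * (2^-1 * (cosq R M ((i + j) * n) + cosq R M ((i + (M - j)) * n))) =
    (if (M %| i + j)%N then M%:R / 2 * J j else 0) + (if (M %| i + (M - j))%N then M%:R / 2 * J j else 0).
  rewrite -!mulr_sumr big_split /= !cosq_sum // mulrDr mulrDr; congr (_ + _).
    by case: ifP => [/Jeven ->|]; rewrite ?mulr0 //; ring.
  case: ifP => [h|]; rewrite ?mulr0 // (@Jper i j); first by ring.
  have e : (i + M = (i + (M - j)) + j)%N by lia.
  by rewrite -(modnDr i M) e -modnDml (eqP h) add0n.
under eq_bigr do rewrite inner.
by rewrite big_split /= !sum_single; field.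
Qed.

Hypothesis nonvanishing : forall xi, admissible xi -> dser dual xi != 0.

(** Inversion carries the eigenvalue relation from the transform to J: multiplication by u permutes
    the residues, and e^2 = 1. *)
Lemma J_unit u : coprime u M -> exists2 e : R, (e == 1) || (e == -1) &
  (forall n, dual (u * n)%N = e * dual n) /\ (forall j, J (u * j)%N = e * J j).
Proof.
move=> uM; have [e eP he] := unit_eigen M0 dual_per nonvanishing uM.
exists e => //; split=> // j.
have ee : e * e = 1 by case/orP: eP => /eqP ->; rewrite ?mulrNN mulr1.
suff -> : J j = e * J (u * j)%N by rewrite mulrA ee mul1r.
rewrite (dual_inv j) (dual_inv (u * j)%N).
rewrite -(@sum_unit _ M u (fun n => dual n * cosq R M (n * j))) //; last first.
  move=> m n mn; rewrite (dual_per mn); congr (_ * _); apply: cosq_mod => //.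
  by rewrite -modnMml mn modnMml.
rewrite mulrCA; congr (_ * _); rewrite mulr_sumr; apply: eq_bigr => n _.
by rewrite he -mulrA mulnCA mulnA.
Qed.

(** If t is odd and u^t is 1 or -1 mod p^k, then J(i c) = J(u^t i c) = e^t J(i c) = e J(i c) = J(u i
    c), by periodicity or evenness. So units leave J unchanged on multiples of c, and a unit takes m
    to n mod 2 p^k. *)
Lemma J_prime3 p k m n : prime p -> (p %% 4 = 3)%N -> (0 < k)%N -> (2 * p ^ k %| M)%N ->
  ~~ (p %| m)%N -> ~~ (p %| n)%N -> m = n %[mod 2] ->
  J (m * (M %/ (2 * p ^ k)))%N = J (n * (M %/ (2 * p ^ k)))%N.
Proof.
move=> pp p3 k0 dM pm pn mn2.
set N := (2 * p ^ k)%N in dM *; set c := (M %/ N)%N.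
have cN : (c * N = M)%N by rewrite divnK.
have pkM : (p ^ k %| M)%N by apply: dvdn_trans dM; rewrite dvdn_mull.
have M2 : (2 %| M)%N by apply: dvdn_trans dM; rewrite dvdn_mulr.
have podd : odd p by rewrite (divn_eq p 4) p3 oddD oddM andbF.
have scale i j : i = j %[mod N] -> J (i * c)%N = J (j * c)%N.
  by move=> ij; apply: Jper; rewrite -cN mulnC [(j * _)%N]mulnC -!muln_modr ij.
have co2 : coprime 2 (p ^ k) by rewrite coprimeXr // coprime2n.
have modN i j : i = j %[mod 2] -> i = j %[mod p ^ k] -> i = j %[mod N].
  by move=> h1 h2; apply/eqP; rewrite chinese_remainder // h1 h2 !eqxx.
have fix_unit u i : coprime u M -> J (u * i * c)%N = J (i * c)%N.
  move=> uM; have [e eP [_ he]] := J_unit uM.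
  suff [s sE] : exists s, J (u ^ s.*2.+1 * i * c)%N = J (i * c)%N.
    have pw t x : J (u ^ t * x)%N = e ^+ t * J x.
      by elim: t => [|t IH]; rewrite ?mul1n ?mul1r // expnS -mulnA he IH exprS mulrA.
    rewrite -mulnA he -[in RHS]sE -mulnA pw exprS -muln2 [(s * 2)%N]mulnC exprM.
    by case/orP: eP => /eqP ->; rewrite ?sqrrN expr1n ?expr1n mulr1.
  (* Half the totient of p^k, odd because p = 4l + 3 gives p - 1 = 2(2l + 1). *)
  pose t := (p ^ k.-1 * (p %/ 4).*2.+1)%N; pose s := t./2.
  have sE : s.*2.+1 = t.
    have := odd_double_half t; rewrite {1}/t oddM oddX podd orbT /= odd_double /=.
    by rewrite add1n.
  have tot : totient (p ^ k) = (2 * t)%N.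
    have pE : p.-1 = (2 * (p %/ 4).*2.+1)%N.
      by move: (divn_eq p 4); rewrite p3; move: (p %/ 4)%N => x ->; clear; lia.
    by rewrite totient_pfactor // pE -mulnA [((p %/ 4).*2.+1 * _)%N]mulnC.
  have uodd : odd u.
    by rewrite -coprime2n coprime_sym (coprime_dvdr M2).
  have u0 : (0 < u)%N by case: (u) uodd.
  have up : coprime u (p ^ k) by apply: coprime_dvdr uM.
  (* p^k divides (u^t - 1)(u^t + 1), and the odd prime p cannot divide both factors. *)
  have ut : u ^ t = 1 %[mod p ^ k] \/ (p ^ k %| u ^ t + 1)%N.
    have x0 : (0 < u ^ t)%N by rewrite expn_gt0 u0.
    have dv : (p ^ k %| (u ^ t - 1) * (u ^ t + 1))%N.
      rewrite -subn_sqr exp1n -eqn_mod_dvd ?expn_gt0 ?u0 //.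
      by rewrite -expnM mulnC -tot; apply/eqP/Euler_exp_totient.
    have [p1|p1] := boolP (p %| u ^ t - 1)%N; last first.
      by right; rewrite -(Gauss_dvdr _ (_ : coprime (p ^ k) (u ^ t - 1))) // coprimeXl // prime_coprime.
    left; apply/eqP; rewrite eqn_mod_dvd //.
    rewrite -(Gauss_dvdl _ (_ : coprime (p ^ k) (u ^ t + 1))) //.
    rewrite coprimeXl // prime_coprime //; apply/negP => p2.
    have : (p %| (u ^ t + 1) - (u ^ t - 1))%N by rewrite dvdn_sub.
    have -> : ((u ^ t + 1) - (u ^ t - 1) = 2)%N by move: (u ^ t)%N x0; clear; lia.
    by rewrite dvdn_prime2 // => /eqP p2'; rewrite p2' in podd.
  exists s; rewrite sE; case: ut => ut.
    apply: scale; apply: modN; last by rewrite -modnMml ut modnMml mul1n.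
    by rewrite -modnMml [(u ^ t %% 2)%N]modn2 oddX uodd orbT mul1n.
  apply: Jeven; rewrite -mulnDl -{1}cN [(c * N)%N]mulnC dvdn_mul //.
  rewrite -[X in (_ + X)%N]mul1n -mulnDl dvdn_mulr // Gauss_dvd // ut.
  by rewrite dvdn2 oddD oddX uodd orbT.
have [u uM uE] : exists2 u, coprime u M & u * m = n %[mod p ^ k].
  have mp : coprime m (p ^ k) by rewrite coprimeXr // coprime_sym prime_coprime.
  have np : coprime n (p ^ k) by rewrite coprimeXr // coprime_sym prime_coprime.
  have [|u uM uE] := @unit_lift M (p ^ k) (n * m ^ (totient (p ^ k)).-1) M0 pkM.
    by rewrite coprimeMl np coprimeXl.
  exists u => //; rewrite -modnMml uE modnMml -mulnA -expnSr prednK ?totient_gt0 ?expn_gt0 ?prime_gt0 //.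
  by rewrite -modnMmr Euler_exp_totient // modnMmr muln1.
rewrite -(fix_unit u m uM); apply: scale; apply: modN => //.
rewrite -mn2 -modnMml [(u %% 2)%N]modn2 -coprime2n.
by rewrite coprime_sym (coprime_dvdr M2 uM) mul1n.
Qed.

End EvenPeriodic.

Lemma cvgC_sum (R : realType) (I : Type) (r : seq I) (P : pred I)
    (u : I -> nat -> R[i]) (l : I -> R[i]) :
  (forall i, P i -> cvgC (u i) (l i)) ->
  cvgC (fun n => \sum_(i <- r | P i) u i n) (\sum_(i <- r | P i) l i).
Proof.
move=> h; elim: r => [|i r IHr].
  by rewrite big_nil; under eq_fun do rewrite big_nil; exact: cvgC_cst.
rewrite big_cons; under eq_fun do rewrite big_cons.
by case: ifP => [/h hi|_] //; exact: cvgCD.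
Qed.

Lemma moebius_exists (R : zmodType) (B : nat -> R) K :
  exists h : nat -> R, forall n, (0 < n <= K)%N ->
    B n = \sum_(d < n.+1 | (d %| n)%N) h d.
Proof.
elim: K => [|K [h hK]]; first by exists (fun=> 0) => n; lia.
exists (fun d => if d == K.+1 then B K.+1 - \sum_(d < K.+1 | (d %| K.+1)%N) h d else h d).
move=> n /andP[n0]; rewrite leq_eqVlt => /orP[/eqP ->|nK].
  rewrite [RHS]big_mkcond big_ord_recr /= dvdnn eqxx -big_mkcond /=.
  rewrite [X in X + _](_ : _ = \sum_(d < K.+1 | (d %| K.+1)%N) h d) ?subrKC //.
  by apply: eq_bigr => d _; rewrite ltn_eqF.
rewrite hK ?n0 //; apply: eq_bigr => d _; rewrite ltn_eqF //.
by rewrite (leq_trans (ltn_ord d)).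
Qed.

(** * Unit-invariant sequences *)

Section TrivialCharacter.
Variables (R : realType) (M : nat) (b : nat -> R).
Hypothesis M0 : (0 < M)%N.
Hypothesis per : forall m n, m = n %[mod M] -> b m = b n.
Hypothesis nonvanishing : forall xi, admissible xi -> dser b xi != 0.
Hypothesis unit_inv : forall u n, coprime u M -> b (u * n)%N = b n.

(** With g the gcd, n/g is invertible mod M/g; lifting its inverse to a unit mod M moves n to g. *)
Lemma b_gcd n : b n = b (gcdn n M).
Proof.
set g := gcdn n M; have g0 : (0 < g)%N by rewrite gcdn_gt0 M0 orbT.
set n' := (n %/ g)%N; set M' := (M %/ g)%N.
have nE : (n' * g = n)%N by rewrite divnK // dvdn_gcdl.
have ME : (M' * g = M)%N by rewrite divnK // dvdn_gcdr.
have M'0 : (0 < M')%N by rewrite divn_gt0 // dvdn_leq // dvdn_gcdr.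
have co : coprime n' M'.
  by rewrite /coprime -(eqn_pmul2r g0) mul1n muln_gcdl nE ME.
have [|u uM uE] := @unit_lift M M' (n' ^ (totient M').-1) M0 (dvdn_div (dvdn_gcdr _ _)).
  by rewrite coprimeXl.
rewrite -(unit_inv n uM); apply: per; rewrite -nE -ME mulnA -muln_modl.
rewrite -modnMml uE modnMml -expnSr prednK ?totient_gt0 // Euler_exp_totient //.
by rewrite muln_modl mul1n.
Qed.

Lemma divisor_expansion : exists h : nat -> R, forall n,
  b n = \sum_(d < M.+1 | (d %| M)%N && (d %| n)%N) h d.
Proof.
have [h hE] := moebius_exists b M; exists h => n.
rewrite b_gcd hE; last by rewrite gcdn_gt0 M0 orbT dvdn_leq ?dvdn_gcdr.
have gM : ((gcdn n M).+1 <= M.+1)%N by rewrite ltnS dvdn_leq ?dvdn_gcdr.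
rewrite (big_ord_widen_cond _ (fun d => (d %| gcdn n M)%N) h gM).
apply: eq_bigl => d; rewrite ltnS.
apply/andP/andP => [[]|[dM dn]]; first by rewrite dvdn_gcd => /andP[].
have dg : (d %| gcdn n M)%N by rewrite dvdn_gcd dM dn.
by rewrite dg dvdn_leq // gcdn_gt0 M0 orbT.
Qed.

Variable h : nat -> R.
Hypothesis hE : forall n, b n = \sum_(d < M.+1 | (d %| M)%N && (d %| n)%N) h d.

(** The multiples of d form a subgroup of Z/M whose cosine sum at frequency M/e is M/d if e divides
    d and 0 otherwise. Through [dual_inv] this evaluates J(M/e). *)
Lemma fourier_divisor e : (e %| M)%N ->
  M%:R^-1 * \sum_(n < M) b n * cosq R M (n * (M %/ e)) =
  \sum_(d < M.+1 | (d %| M)%N && (e %| d)%N) h d / d%:R.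
Proof.
move=> eM; have e0 : (0 < e)%N by apply: dvdn_gt0 eM.
under eq_bigr do rewrite hE mulr_suml.
rewrite (exchange_big_dep (fun d : 'I_M.+1 => (d %| M)%N)) /=; last by move=> ? ? _ /andP[].
rewrite mulr_sumr [RHS]big_mkcondr; apply: eq_bigr => d dM.
have d0 : (0 < d)%N by apply: dvdn_gt0 dM.
set k := (M %/ d)%N; have dk : (d * k = M)%N by rewrite mulnC divnK.
have k0 : (0 < k)%N by rewrite divn_gt0 // dvdn_leq.
have R0 n : (0 < n)%N -> n%:R != 0 :> R by move=> n0; rewrite pnatr_eq0 -lt0n.
pose G m := h d * cosq R k (M %/ e * m).
have -> : \sum_(n < M | (d %| M)%N && (d %| n)%N) h d * cosq R M (n * (M %/ e)) =
    \sum_(n < (d * k)%N) (if (d %| n)%N then G (n %/ d)%N else 0).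
  rewrite dk big_mkcond; apply: eq_bigr => n _; rewrite dM /=; case: ifP => // dn.
  rewrite /G /cosq; congr (_ * cos (_ * _)); rewrite -{1}(divnK dn) -[in M%:R]dk !natrM.
  by field; rewrite !R0.
rewrite (sum_multiples G k d0) -mulr_sumr cosq_sum //.
have -> : (k %| M %/ e)%N = (e %| d)%N.
  by rewrite -(dvdn_pmul2r e0) divnK // -[X in (_ %| X)%N]dk [(d * k)%N]mulnC dvdn_pmul2l.
case: ifP => _; last by rewrite !mulr0.
by rewrite -{1}dk natrM; field; rewrite !R0.
Qed.

Definition dpoly (xi : nat -> R[i]) : R[i] :=
  \sum_(d < M.+1 | (d %| M)%N) (h d / d%:R)%:C * lam xi d.

(** Substituting n = dm separates the two factors. Partial sums run to multiples of M, so that for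
    each d dividing M the terms divisible by d form a complete partial sum. *)
Lemma dser_dpoly xi : admissible xi -> dser b xi = dpoly xi * dser (fun=> 1) xi.
Proof.
move=> axi; have b1 : bounded_seq (fun _ : nat => 1 : R) by exists 1 => n; rewrite normr1.
have bb := periodic_bounded M0 per.
apply: cvgC_unique (cvgC_mul M0 (dser_cvg bb axi)) _.
have -> : (fun Y => psum b xi (M * Y)%N) = (fun Y =>
    \sum_(d < M.+1 | (d %| M)%N) (h d / d%:R)%:C * lam xi d *
       psum (fun=> 1) xi ((M %/ d) * Y)%N).
  apply/funext => Y; rewrite {1}/psum.
  under eq_bigr do rewrite hE mulr_suml rmorph_sum mulr_suml.
  rewrite (exchange_big_dep (fun d : 'I_M.+1 => (d %| M)%N)) /=; last by move=> ? ? _ /andP[].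
  apply: eq_bigr => d dM; have d0 : (0 < d)%N by apply: dvdn_gt0 dM.
  pose G m := (h d / d%:R)%:C * lam xi d * ((1 / m%:R)%:C * lam xi m).
  transitivity (\sum_(n < (d * (M %/ d * Y))%N) (if (d %| n)%N then G (n %/ d)%N else 0)).
    rewrite mulnA [(d * _)%N]mulnC divnK // big_mkcond; apply: eq_bigr => n _.
    rewrite dM /=; case: ifP => // dn; rewrite -{1 2}(divnK dn) natrM invfM lamM /G div1r.
    by rewrite !rmorphM /=; ring.
  by rewrite (sum_multiples G) // -mulr_sumr.
rewrite /dpoly mulr_suml; apply: cvgC_sum => d dM.
apply: cvgCM; apply: cvgC_mul; last exact: dser_cvg.
by rewrite divn_gt0 ?(dvdn_gt0 _ dM) // dvdn_leq.
Qed.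

End TrivialCharacter.

(** * Values of the divisor polynomial on the boundary of the polydisc *)

Section DivisorPolynomial.
Variables (R : realType) (M : nat) (h : nat -> R) (T : pred nat).
Hypothesis M0 : (0 < M)%N.
Hypothesis nonvanishing : forall xi, admissible xi -> dpoly M h xi != 0.

(** [cT] and [aT] count prime factors with multiplicity inside and outside T. On the two-parameter
    family [xi] (z on T, t elsewhere) the divisor polynomial becomes W_t(z), with W_t(0) = G(t) and
    W_t(1) = A(t). *)
Let cT d := (\sum_(p < M.+1 | prime p && T p) logn p d)%N.
Let aT d := (\sum_(p < M.+1 | prime p && ~~ T p) logn p d)%N.
Let xi (t : R) (z : R[i]) p : R[i] :=
  if (p <= M)%N then if T p then z else t%:C else 0.

Let xi_admissible t z : 0 <= t < 1 -> normc z < 1 -> admissible (xi t z).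
Proof.
move=> /andP[t0 t1] z1; split.
  exists (iota 0 M.+1) => p; rewrite mem_iota /= add0n ltnS /xi => pM.
  by rewrite (negPf pM).
move=> p; rewrite /xi; case: ifP => _; last by rewrite normc0.
by case: ifP => // _; rewrite normcR ger0_norm.
Qed.

Let lam_xi t z d : (d %| M)%N -> lam (xi t z) d = t%:C ^+ aT d * z ^+ cT d.
Proof.
move=> dM; have d0 : (0 < d)%N by apply: dvdn_gt0 dM.
have dlt : (d < M.+1)%N by rewrite ltnS; exact: dvdn_leq.
rewrite (lam_wide _ d0 dlt) (bigID (fun p : 'I_M.+1 => T p)) /= mulrC.
rewrite !expr_sum; congr (_ * _); apply: eq_bigr => p /andP[_ Tp].
  by rewrite /xi -ltnS ltn_ord (negPf Tp).
by rewrite /xi -ltnS ltn_ord Tp.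
Qed.

Let W t : {poly R[i]} := \sum_(d < M.+1 | (d %| M)%N)
  (h d / d%:R * t ^+ aT d)%:C *: 'X^(cT d).
Let A : {poly R} := \sum_(d < M.+1 | (d %| M)%N) (h d / d%:R) *: 'X^(aT d).
Let G : {poly R} := \sum_(d < M.+1 | (d %| M)%N && (cT d == 0%N)) (h d / d%:R) *: 'X^(aT d).

Let W_horner t z : (W t).[z] = dpoly M h (xi t z).
Proof.
rewrite /W /dpoly horner_sum; apply: eq_bigr => d dM.
by rewrite lam_xi // hornerZ hornerXn mulrA -rmorphXn -rmorphM.
Qed.

Let W_root t z : 0 <= t < 1 -> root (W t) z -> 1 <= normc z.
Proof.
move=> t1; rewrite /root W_horner leNgt; apply: contraL => z1.
by apply: nonvanishing; apply: xi_admissible.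
Qed.

Let W0 t : (W t).[0] = (G.[t])%:C.
Proof.
rewrite /W /G !horner_sum rmorph_sum big_mkcondr; apply: eq_bigr => d dM.
rewrite !hornerZ !hornerXn expr0n; case: eqP => _; last by rewrite mulr0.
by rewrite mulr1.
Qed.

Let W1 t : (W t).[1] = (A.[t])%:C.
Proof.
rewrite /W /A !horner_sum rmorph_sum; apply: eq_bigr => d dM.
by rewrite !hornerZ !hornerXn expr1n mulr1.
Qed.

Let size_W : exists D, forall t, ((size (W t)).-1 <= D)%N.
Proof.
exists (\sum_(d < M.+1) cT d)%N => t; rewrite -subn1 leq_subLR add1n.
apply: leq_trans (size_sum _ _ _) _; apply/bigmax_leqP => d _.
apply: leq_trans (size_scale_leq _ _) _; rewrite size_polyXn ltnS.
by rewrite (bigD1 d) //= leq_addr.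
Qed.

(** W_t has no zero in the open unit disc and its degree is bounded independently of t, so W_t(1) is
    controlled by W_t(0) uniformly in t < 1. *)
Let A_le_G : exists2 K : R, 0 <= K & forall t, 0 <= t < 1 -> `|A.[t]| <= K * `|G.[t]|.
Proof.
have [D hD] := size_W; exists (2 ^+ D); first by rewrite exprn_ge0.
move=> t t1; have := nonvanishing_disc_bound (fun z => @W_root t z t1).
rewrite W0 W1 !normcR => /le_trans -> //; rewrite ler_wpM2r //.
by rewrite ler_eXn2l ?ltr1n.
Qed.

Let GE : G.[1] = \sum_(d < M.+1 | (d %| M)%N && (cT d == 0%N)) h d / d%:R.
Proof.
by rewrite horner_sum; apply: eq_bigr => d _; rewrite hornerZ hornerXn expr1n mulr1.
Qed.

Let AE : A.[1] = \sum_(d < M.+1 | (d %| M)%N) h d / d%:R.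
Proof.
by rewrite horner_sum; apply: eq_bigr => d _; rewrite hornerZ hornerXn expr1n mulr1.
Qed.

Let cT_eq0 (d : nat) : (d %| M)%N -> (cT d == 0%N) = [forall p : 'I_M.+1, prime p && T p ==> ~~ (p %| d)%N].
Proof.
move=> dM; have d0 : (0 < d)%N by apply: dvdn_gt0 dM.
rewrite /cT sum_nat_eq0; apply: eq_forallb => p.
case: (boolP (prime p)) => //= pp; case: (T p) => //=.
by rewrite lognE pp d0 /=; case: (p %| d)%N.
Qed.

Let G0 : G.[0] = h 1%N.
Proof.
apply: complexI; rewrite -W0 W_horner /dpoly.
have M1 : (1 < M.+1)%N by rewrite ltnS.
rewrite (bigD1 (Ordinal M1)) ?dvd1n //= lam1 divr1 mulr1 big1 ?addr0 // => d /andP[dM d1].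
rewrite (@lam_eq0 _ _ (pdiv d)) ?mulr0 ?pdiv_dvd //; last first.
  by rewrite /xi !if_same.
rewrite pdiv_prime // ltn_neqAle eq_sym; apply/andP; split; last exact: dvdn_gt0 dM.
by apply: contra d1 => /eqP d1; apply/eqP/val_inj.
Qed.

(* G(t) is the value of the divisor polynomial at 0 on the primes in T and at t on
   the others; it does not vanish for 0 <= t < 1, and G(0) = h(1). *)
Lemma divisor_sum_sign :
  0 <= h 1%N * \sum_(d < M.+1 | (d %| M)%N &&
     [forall p : 'I_M.+1, prime p && T p ==> ~~ (p %| d)%N]) h d / d%:R.
Proof.
have -> : \sum_(d < M.+1 | (d %| M)%N && [forall p : 'I_M.+1, prime p && T p ==> ~~ (p %| d)%N]) h d / d%:R = G.[1].
  by rewrite GE; apply: eq_bigl => d; case: (boolP (d %| M)%N) => //= dM; rewrite cT_eq0.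
rewrite leNgt; apply/negP => lt0; pose p := - (h 1%N *: G).
have := @poly_ivt R p 0 1 ler01; rewrite !hornerN !hornerZ G0.
case; first by rewrite oppr_le0 -expr2 sqr_ge0 oppr_ge0 ltW.
move=> x /andP[x0]; rewrite le_eqVlt => /orP[/eqP ->|x1].
  by rewrite /root hornerN hornerZ oppr_eq0 lt_eqF.
rewrite /root hornerN hornerZ oppr_eq0 mulf_eq0 => /orP[/eqP h0|/eqP Gx].
  by rewrite h0 mul0r ltxx in lt0.
have : root (W x) 0 by rewrite /root W0 Gx rmorph0.
by move=> /(W_root (introT andP (conj x0 x1))); rewrite normc0 ler10.
Qed.

(** The bound |A| <= K |G| on [0,1) passes to the limit t = 1, so G(1) = 0 would force A(1) = 0. *)
Lemma divisor_sum_neq0 :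
  \sum_(d < M.+1 | (d %| M)%N) h d / d%:R != 0 ->
  \sum_(d < M.+1 | (d %| M)%N &&
     [forall p : 'I_M.+1, prime p && T p ==> ~~ (p %| d)%N]) h d / d%:R != 0.
Proof.
have -> : \sum_(d < M.+1 | (d %| M)%N && [forall p : 'I_M.+1, prime p && T p ==> ~~ (p %| d)%N]) h d / d%:R = G.[1].
  by rewrite GE; apply: eq_bigl => d; case: (boolP (d %| M)%N) => //= dM; rewrite cT_eq0.
rewrite -AE; apply: contra_neq => G1; have [K K0 hK] := A_le_G.
apply/eqP; rewrite -normr_le0.
pose f (p : {poly R}) (t : R) := `|p.[t]|.
have cf p : f p t @[t --> 1^'-] --> f p 1.
  apply: cvg_norm; apply: cvg_at_left_filter; exact: continuous_horner.
have -> : 0 = K * f G 1 by rewrite /f G1 normr0 mulr0.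
apply: (ler_cvg_to (cf A) (cvgM (cvg_cst K) (cf G))).
near=> t; apply: hK; apply/andP; split.
  by near: t; apply: nbhs_left_ge; exact: ltr01.
by near: t; exact: nbhs_left_lt.
Unshelve. all: by end_near. Qed.

End DivisorPolynomial.

(** * Inclusion-exclusion over sets of primes *)

Lemma prod_primes_dvd (I : eqType) (p : I -> nat) (s : seq I) d :
  injective p -> (forall i, prime (p i)) -> uniq s ->
  ((\prod_(i <- s) p i)%N %| d)%N = all (fun i => (p i %| d)%N) s.
Proof.
move=> pinj pp; elim: s => [|i s IHs] /=; first by rewrite big_nil dvd1n.
case/andP=> si us; rewrite big_cons Gauss_dvd ?IHs //.
rewrite big_seq; apply: (big_ind (coprime (p i))) => [|x y|j js]; first exact: coprimen1.
  by rewrite coprimeMr => -> ->.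
rewrite prime_coprime // dvdn_prime2 //; apply: contra si => /eqP/pinj ->.
by [].
Qed.

(** Expansion of the product over i of 1 - [P i]. *)
Lemma sum_subsets_sign (R : comNzRingType) (I : finType) (P : pred I) :
  \sum_(X : {set I}) (-1) ^+ #|X| * ([forall i in X, P i])%:R =
  ([forall i, ~~ P i])%:R :> R.
Proof.
have /esym := bigA_distr 1 +%R (fun i => if P i then -1 else 0) (fun _ : I => 1 : R).
rewrite (_ : \prod_i _ = ([forall i, ~~ P i])%:R) => [<-|].
  rewrite [RHS](eq_bigl xpredT) //; apply: eq_bigr => X _.
  rewrite -big_mkcond /=.
  have [/fintype.forallP h|nh] := boolP [forall i in X, P i].
    rewrite mulr1 -prodr_const; apply: eq_bigr => i iX.
    by have := h i; rewrite iX => /= ->.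
  have [i0] : exists i, ~~ ((i \in X) ==> P i).
    by apply/fintype.existsP; rewrite -negb_forall.
  rewrite negb_imply => /andP[iX nP].
  by rewrite (bigD1 i0) //= (negPf nP) mul0r mulr0.
have [/fintype.forallP h|nh] := boolP [forall i, ~~ P i].
  by rewrite big1 // => i _; rewrite (negPf (h i)) /= add0r.
have [i0] : exists i, ~~ ~~ P i by apply/fintype.existsP; rewrite -negb_forall.
by rewrite negbK => Pi; rewrite (bigD1 i0) //= Pi addNr mul0r.
Qed.

Section InclusionExclusion.
Variables (R : realType) (M : nat) (J : nat -> R).
Hypothesis M0 : (0 < M)%N.
Hypothesis Jper : forall i j, i = j %[mod M] -> J i = J j.
Hypothesis Jeven : forall i j, (M %| i + j)%N -> J i = J j.
Hypothesis nonvanishing : forall xi, admissible xi -> dser (dual M J) xi != 0.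
Hypothesis unit_inv : forall u n, coprime u M -> dual M J (u * n)%N = dual M J n.

(** J(M/e) is the sum of h(d)/d over the divisors d of M divisible by e, so the signed sum over X
    keeps exactly the d prime to every p_i. Thus S is the divisor polynomial at 0 on the primes p_i
    and at 1 on the others, while J(0) is its value at 1 throughout. *)
Lemma inclusion_exclusion (N : nat) (p : 'I_N -> nat) :
  injective p -> (forall i, prime (p i)) -> (\prod_i p i %| M)%N ->
  let S := \sum_(X : {set 'I_N}) (-1) ^+ #|X| * J (M %/ \prod_(i in X) p i)%N in
  0 <= dual M J 1 * S /\ (J 0 != 0 -> S != 0).
Proof.
move=> pinj pp pM S.
have per := dual_per J M0.
have [h hE] := divisor_expansion M0 per unit_inv.
have JE e : (e %| M)%N -> J (M %/ e)%N = \sum_(d < M.+1 | (d %| M)%N && (e %| d)%N) h d / d%:R.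
  by move=> eM; rewrite (dual_inv M0 Jper Jeven) (fourier_divisor M0 hE).
have nz xi : admissible xi -> dpoly M h xi != 0.
  move=> axi; have := nonvanishing axi; rewrite (dser_dpoly M0 per hE axi).
  by rewrite mulf_eq0 negb_or => /andP[].
have h1 : dual M J 1 = h 1%N.
  rewrite hE; have M1 : (1 < M.+1)%N by rewrite ltnS.
  rewrite (bigD1 (Ordinal M1)) ?dvd1n //= big1 ?addr0 // => d /andP[/andP[_]].
  by rewrite dvdn1 => /eqP d1 /eqP; case; apply: val_inj.
have J0 : J 0 = \sum_(d < M.+1 | (d %| M)%N) h d / d%:R.
  rewrite (@Jper 0 (M %/ 1)) ?divn1 ?modnn ?mod0n // -{1}(divn1 M) JE ?dvd1n //.
  by apply: eq_bigl => d; rewrite dvd1n andbT.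
pose T q := [exists i, p i == q].
have SE : S = \sum_(d < M.+1 | (d %| M)%N &&
     [forall q : 'I_M.+1, prime q && T q ==> ~~ (q %| d)%N]) h d / d%:R.
  have pX (X : {set 'I_N}) d : (\prod_(i in X) p i %| d)%N = [forall i in X, p i %| d]%N.
    rewrite -big_enum /= prod_primes_dvd ?enum_uniq //.
    apply/allP/fintype.forallP => [hX i|hX i]; first by apply/implyP => iX; apply: hX; rewrite mem_enum.
    by rewrite mem_enum => iX; have := hX i; rewrite iX.
  have pXM (X : {set 'I_N}) : (\prod_(i in X) p i %| M)%N.
    apply: dvdn_trans pM; rewrite [X in (_ %| X)%N](bigID (mem X)) /=.
    exact: dvdn_mulr.
  rewrite /S; under eq_bigr => X _.
    rewrite JE // big_mkcondr mulr_sumr.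
    over.
  rewrite exchange_big /= [RHS]big_mkcondr; apply: eq_bigr => d dM.
  have d0 : (0 < d)%N by apply: dvdn_gt0 dM.
  transitivity (\sum_(X : {set 'I_N}) (-1) ^+ #|X| * ([forall i in X, p i %| d]%N)%:R * (h d / d%:R)).
    apply: eq_bigr => X _; rewrite pX; case: ifP => _; rewrite ?mulr1 //.
    by rewrite !mulr0 mul0r.
  rewrite -mulr_suml sum_subsets_sign.
  have -> : [forall i, ~~ (p i %| d)%N] = [forall q : 'I_M.+1, prime q && T q ==> ~~ (q %| d)%N].
    apply/fintype.forallP/fintype.forallP => [H q|H i].
      by apply/implyP => /andP[_ /fintype.existsP[i /eqP <-]].
    have piM : (p i < M.+1)%N.
      by rewrite ltnS dvdn_leq // (dvdn_trans _ pM) // (bigD1 i) //= dvdn_mulr.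
    have /implyP := H (Ordinal piM); apply; rewrite /= pp /=.
    by apply/fintype.existsP; exists i.
  by case: ifP => _; rewrite ?mul1r ?mul0r.
rewrite h1 SE; split; first exact: divisor_sum_sign.
by rewrite J0; apply: divisor_sum_neq0.
Qed.

End InclusionExclusion.

(** * Sine coefficients and density *)

Section UnitInterval.
Variable R : realType.
Implicit Types f g : R -> R.

Local Notation D := (`]0%R, 1%R[%classic : set R).
Local Notation mu := (@lebesgue_measure R).

(** An algebra of integrable functions that contains every integrand below, which reduces
    integrability to closure properties. *)
Definition bmeas f := measurable_fun D f /\ exists B, forall x, D x -> `|f x| <= B.

Definition I01 f : R := \int[mu]_(x in D) f x.

Lemma bmeas_integrable f : bmeas f -> mu.-integrable D (EFin \o f).
Proof.
move=> [mf [B hB]]; apply: measurable_bounded_integrable => //.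
  by rewrite /= lebesgue_measure_itv /= lte_fin ltr01 -EFinB ltry.
by exists B; split; rewrite ?num_real // => y By x Dx; apply: le_trans (hB x Dx) (ltW By).
Qed.

Lemma bmeas_cst c : bmeas (fun=> c).
Proof. by split; [exact: measurable_cst | exists `|c|]. Qed.

Lemma bmeasD f g : bmeas f -> bmeas g -> bmeas (fun x => f x + g x).
Proof.
move=> [mf [B hB]] [mg [B' hB']]; split; first exact: measurable_funD.
by exists (B + B') => x Dx; rewrite (le_trans (ler_normD _ _)) // lerD ?hB ?hB'.
Qed.

Lemma bmeasM f g : bmeas f -> bmeas g -> bmeas (fun x => f x * g x).
Proof.
move=> [mf [B hB]] [mg [B' hB']]; split; first exact: measurable_funM.
by exists (B * B') => x Dx; rewrite normrM ler_pM ?hB ?hB'.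
Qed.

Lemma bmeasZ c f : bmeas f -> bmeas (fun x => c * f x).
Proof. exact/bmeasM/bmeas_cst. Qed.

Lemma bmeasN f : bmeas f -> bmeas (fun x => - f x).
Proof.
move=> /(bmeasZ (-1)); congr bmeas; apply/funext => x; exact: mulN1r.
Qed.

Lemma bmeas_sum (I : Type) (r : seq I) (P : pred I) (F : I -> R -> R) :
  (forall i, bmeas (F i)) -> bmeas (fun x => \sum_(i <- r | P i) F i x).
Proof.
move=> h; elim: r => [|i r IHr].
  by under eq_fun do rewrite big_nil; exact: bmeas_cst.
under eq_fun do rewrite big_cons; case: (P i) => //.
exact: bmeasD.
Qed.

Lemma bmeas_indic (A : set R) : measurable A -> bmeas (\1_A : R -> R).
Proof.
move=> mA; split; first exact: measurable_indic.
by exists 1 => x _; rewrite indicE; case: (_ \in _); rewrite ?normr1 ?normr0.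
Qed.

Definition sinpin (n : nat) (x : R) : R := sin (n%:R * pi * x).

Lemma continuous_sin_lin (c : R) : continuous (fun x : R => sin (c * x)).
Proof.
move=> x; apply: (@continuous_comp _ _ _ (fun x => c * x) (@sin R)).
  by apply: cvgM; [exact: cvg_cst | exact: cvg_id].
exact: continuous_sin.
Qed.

Lemma continuous_cos_lin (c : R) : continuous (fun x : R => cos (c * x)).
Proof.
move=> x; apply: (@continuous_comp _ _ _ (fun x => c * x) (@cos R)).
  by apply: cvgM; [exact: cvg_cst | exact: cvg_id].
exact: continuous_cos.
Qed.

Lemma bmeas_continuous f : continuous f -> (exists B, forall x, `|f x| <= B) -> bmeas f.
Proof.
move=> cf [B bf]; split; last by exists B.
by apply: measurable_funTS; exact: continuous_measurable_fun.
Qed.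

Lemma bmeas_sinpin n : bmeas (sinpin n).
Proof.
apply: bmeas_continuous; first exact: continuous_sin_lin.
by exists 1 => x; exact: sin_max.
Qed.

Lemma bmeas_cos_lin (c : R) : bmeas (fun x => cos (c * x)).
Proof.
apply: bmeas_continuous; first exact: continuous_cos_lin.
by exists 1 => x; exact: cos_max.
Qed.

Lemma I01D f g : bmeas f -> bmeas g -> I01 (fun x => f x + g x) = I01 f + I01 g.
Proof. by move=> bf bg; apply: RintegralD => //; exact: bmeas_integrable. Qed.

Lemma I01Z c f : bmeas f -> I01 (fun x => c * f x) = c * I01 f.
Proof. by move=> bf; apply: RintegralZl => //; exact: bmeas_integrable. Qed.

Lemma I01_sum (I : Type) (r : seq I) (P : pred I) (F : I -> R -> R) :
  (forall i, bmeas (F i)) ->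
  I01 (fun x => \sum_(i <- r | P i) F i x) = \sum_(i <- r | P i) I01 (F i).
Proof.
move=> h; elim: r => [|i r IHr].
  rewrite big_nil; under eq_fun do rewrite big_nil.
  by rewrite /I01 Rintegral_cst // mul0r.
rewrite big_cons; under eq_fun do rewrite big_cons; case: (P i) => //.
by rewrite I01D ?IHr //; exact: bmeas_sum.
Qed.

Lemma bmeas_ext f g : (forall x, 0 < x < 1 -> f x = g x) -> bmeas f -> bmeas g.
Proof.
move=> fg [mf [B hB]]; split; last first.
  by exists B => x Dx; rewrite -fg ?hB //; move: Dx; rewrite /= in_itv.
by apply: eq_measurable_fun mf => x; rewrite inE /= in_itv /=; exact: fg.
Qed.

Lemma I01_le f g : bmeas f -> bmeas g -> (forall x, f x <= g x) -> I01 f <= I01 g.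
Proof. by move=> bf bg fg; apply: le_Rintegral => //; exact: bmeas_integrable. Qed.

Lemma I01_ext f g : (forall x, 0 < x < 1 -> f x = g x) -> I01 f = I01 g.
Proof. by move=> fg; apply: eq_Rintegral => x; rewrite inE /= in_itv /=; exact: fg. Qed.

Lemma Rintegral_FTC f F (a b : R) : a < b -> continuous f ->
  (forall x : R, is_derive x (1 : R) F (f x)) ->
  \int[mu]_(x in `]a, b[) f x = F b - F a.
Proof.
move=> ab cf dF.
have cF : continuous F.
  by move=> x; apply: differentiable_continuous; apply/derivable1_diffP; have [] := dF x.
rewrite /Rintegral -(@integral_itv_bndoo _ a b (EFin \o f) true false); last first.
  by apply/measurable_EFinP; apply: measurable_funTS; exact: continuous_measurable_fun.
rewrite (continuous_FTC2 ab (F := F)) //.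
- exact: continuous_subspaceT.
- split=> [x _||]; first by have [] := dF x.
  + by apply: cvg_at_right_filter; exact: cF.
  + by apply: cvg_at_left_filter; exact: cF.
by move=> x _; rewrite derive1E; have [_ ->] := dF x.
Qed.

End UnitInterval.

Section SineIntegrals.
Variable R : realType.

Local Notation D := (`]0%R, 1%R[%classic : set R).
Local Notation mu := (@lebesgue_measure R).

Lemma is_derive_sin_lin (c x : R) :
  is_derive x (1 : R) (fun x => sin (c * x)) (c * cos (c * x)).
Proof.
have h : is_derive x (1 : R) (fun x : R => c * x) (c * 1).
  exact: (is_deriveZ _ (is_derive_id _ _)).
have := @is_derive1_comp R (@sin R) (fun x => c * x) x _ _ (is_derive_sin _) h.
by rewrite mulr1 mulrC.
Qed.

Lemma is_derive_cos_lin (c x : R) :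
  is_derive x (1 : R) (fun x => cos (c * x)) (- (c * sin (c * x))).
Proof.
have h : is_derive x (1 : R) (fun x : R => c * x) (c * 1).
  exact: (is_deriveZ _ (is_derive_id _ _)).
have := @is_derive1_comp R (@cos R) (fun x => c * x) x _ _ (is_derive_cos _) h.
by rewrite mulr1 mulNr mulrC.
Qed.

Let pin0 n : (0 < n)%N -> n%:R * pi != 0 :> R.
Proof. by move=> n0; rewrite mulf_neq0 ?pnatr_eq0 -?lt0n // gt_eqF // pi_gt0. Qed.

Lemma sin_pin n : sin (n%:R * pi) = 0 :> R.
Proof.
elim: n => [|n IHn]; first by rewrite mul0r sin0.
by rewrite -natr1 mulrDl mul1r sinDpi IHn oppr0.
Qed.

Lemma I01_cos j : (0 < j)%N -> I01 (fun x : R => cos (j%:R * pi * x)) = 0.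
Proof.
move=> j0; pose F (x : R) := (j%:R * pi)^-1 * sin (j%:R * pi * x).
have dF (x : R) : is_derive x (1 : R) F (cos (j%:R * pi * x)).
  have := is_deriveZ (j%:R * pi)^-1 (is_derive_sin_lin (j%:R * pi) x).
  by rewrite /= -[_ *: _]/(_ * _) mulKf ?pin0.
rewrite /I01 (Rintegral_FTC ltr01 (@continuous_cos_lin R _) dF).
by rewrite /F mulr1 mulr0 sin0 sin_pin !mulr0 subr0.
Qed.

Lemma I01_sinpin2 m n : (0 < m)%N -> (0 < n)%N ->
  I01 (fun x : R => sinpin m x * sinpin n x) = if m == n then 2^-1 else 0.
Proof.
wlog mn : m n / (n <= m)%N => [h m0 n0|m0 n0].
  have [/h -> //|/ltnW nm] := leqP n m.
  by rewrite eq_sym -h //; apply: I01_ext => x _; rewrite mulrC.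
have -> : (fun x : R => sinpin m x * sinpin n x) =
    (fun x => 2^-1 * cos ((m - n)%:R * pi * x) + - 2^-1 * cos ((m + n)%:R * pi * x)).
  apply/funext => x; rewrite /sinpin natrB // natrD !mulrDl !mulNr cosB cosD.
  by field.
rewrite I01D ?I01Z; try by [apply: bmeas_cos_lin | apply: bmeasZ; apply: bmeas_cos_lin].
rewrite (@I01_cos (m + n)) ?addn_gt0 ?m0 // mulr0 addr0.
case: eqVneq => [->|ne]; last by rewrite I01_cos ?mulr0 // subn_gt0 ltn_neqAle eq_sym ne.
rewrite subnn; under [X in I01 X]eq_fun do rewrite mul0r mul0r cos0.
by rewrite /I01 Rintegral_cst //= lebesgue_measure_itv /= lte_fin ltr01 oppr0 addr0 mul1r mulr1.
Qed.

Lemma I01_indic (A : set R) f : measurable A -> A `<=` D ->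
  I01 (fun x => \1_A x * f x) = \int[mu]_(x in A) f x.
Proof.
move=> mA AD; rewrite -[in RHS](setIidr AD) Rintegral_mkcondr; apply: eq_Rintegral => x _.
by rewrite patchE indicE; case: ifP; rewrite ?mul1r ?mul0r.
Qed.

Lemma I01_itv_sinpin n (a b : R) : (0 < n)%N -> 0 <= a -> a < b -> b <= 1 ->
  I01 (fun x => \1_(`]a, b[%classic : set R) x * sinpin n x) =
  (cos (n%:R * pi * a) - cos (n%:R * pi * b)) / (n%:R * pi).
Proof.
move=> n0 a0 ab b1; rewrite I01_indic //; last first.
  move=> x /=; rewrite !in_itv /= => /andP[ax xb].
  by rewrite (le_lt_trans a0 ax) (lt_le_trans xb b1).
pose F (x : R) := - (n%:R * pi)^-1 * cos (n%:R * pi * x).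
have dF (x : R) : is_derive x (1 : R) F (sin (n%:R * pi * x)).
  have := is_deriveZ (- (n%:R * pi)^-1) (is_derive_cos_lin (n%:R * pi) x).
  by rewrite /= -[_ *: _]/(_ * _) mulrNN mulKf ?pin0.
rewrite (Rintegral_FTC ab (@continuous_sin_lin R _) dF) /F.
by move: (n%:R * pi) (pin0 n0) => c c0; field; exact: c0.
Qed.

Lemma I01_point (t : R) f : I01 (fun x => \1_([set t] : set R) x * f x) = 0.
Proof.
have [tD|tD] := pselect (D t).
  rewrite I01_indic //; first exact: Rintegral_set1.
  by move=> _ ->.
rewrite (@I01_ext _ _ (fun=> 0)) ?/I01 ?Rintegral_cst ?mul0r // => x x01.
rewrite indicE memNset ?mul0r //= => xt; apply: tD; rewrite -xt /= in_itv /=.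
exact: x01.
Qed.

End SineIntegrals.

(** * The obstruction to density *)

Section Density.
Variables (R : realType) (phi : R -> R) (a : nat -> R).

Local Notation D := (`]0%R, 1%R[%classic : set R).
Local Notation mu := (@lebesgue_measure R).

Hypothesis phiC : in_C phi.
Let dil k (x : R) := oddext phi (k%:R * x).
Hypothesis dil_bmeas : forall k, (0 < k)%N -> bmeas (dil k).
Hypothesis dil_sin : forall k n, (0 < k)%N -> (0 < n)%N ->
  I01 (fun x => dil k x * sinpin n x) = if (k %| n)%N then a (n %/ k)%N else 0.

Variable l : nat -> R[i].
Hypothesis l0 : l 0 = 0.
Hypothesis l1 : l 1 = 1.
Hypothesis lM : forall m n, l (m * n)%N = l m * l n.
Hypothesis l_le1 : forall n, normc (l n) <= 1.
Hypothesis l_sum : exists C, forall X, \sum_(n < X) normc (l n) <= C.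

Let psi X (x : R) := \sum_(n < X) complex.Re (l n) * sinpin n x.

Let psi_bmeas X : bmeas (psi X).
Proof. by apply: bmeas_sum => n; apply: bmeasZ; exact: bmeas_sinpin. Qed.

Let I01_sin_psi m X : (0 < m)%N -> I01 (fun x => sinpin m x * psi X x) =
  \sum_(n < X) (if n == m :> nat then complex.Re (l m) / 2 else 0).
Proof.
move=> m0; under [X in I01 X]eq_fun do rewrite mulr_sumr.
rewrite I01_sum; last by move=> n; apply: bmeasM; [exact: bmeas_sinpin | apply: bmeasZ; exact: bmeas_sinpin].
apply: eq_bigr => n _; under [X in I01 X]eq_fun do rewrite mulrCA.
rewrite I01Z; last by apply: bmeasM; exact: bmeas_sinpin.
have [->|n0] := posnP n; first by rewrite l0 mul0r ltn_eqF.
by rewrite I01_sinpin2 // eq_sym; case: eqP => [->|]; rewrite ?mulr0.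
Qed.

(** Parseval, with (Re l(n))^2 <= |l(n)| because |l(n)| <= 1. *)
Let I01_psi2 C X : (forall X, \sum_(n < X) normc (l n) <= C) ->
  I01 (fun x => psi X x * psi X x) <= C / 2.
Proof.
move=> hC; under [Y in I01 Y]eq_fun do rewrite {1}/psi mulr_suml.
rewrite I01_sum; last by move=> n; apply: bmeasM => //; apply: bmeasZ; exact: bmeas_sinpin.
apply: (@le_trans _ _ (\sum_(n < X) normc (l n) / 2)); last first.
  by rewrite -mulr_suml ler_wpM2r ?invr_ge0.
apply: ler_sum => n _; under [Y in I01 Y]eq_fun do rewrite -mulrA.
rewrite I01Z; last by apply: bmeasM => //; exact: bmeas_sinpin.
have [->|n0] := posnP n; first by rewrite l0 mul0r divr_ge0 ?normc_ge0.
rewrite I01_sin_psi // (bigD1 n) //= eqxx big1 ?addr0; last first.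
  by move=> i /negPf; rewrite -val_eqE /= => ->.
rewrite mulrA ler_wpM2r ?invr_ge0 // -expr2.
have := ler_Re_normc (l n); have := l_le1 n; have := normc_ge0 (l n).
rewrite ler_norml => h1 h2 /andP[h3 h4]; nra.
Qed.

(* Let G be a combination of dilations close to sin(pi x).  The partial sums psi are
   bounded in L^2 and pair with sin(pi x) to 1/2; if the series vanishes, their
   pairing with G tends to 0. *)
Theorem series_not_null : ~ cvgC (fun X => \sum_(n < X) (a n)%:C * l n) 0.
Proof.
move=> cv; have [C hC] := l_sum.
have C0 : 0 <= C by have := hC 0%N; rewrite big_ord0.
pose eta := (C + 1)^-1; have eta0 : 0 < eta by rewrite invr_gt0 ltr_wpDl.
have sinL2 : inL2 (fun x : R => sinpin 1 x).
  split; first by have [] := bmeas_sinpin R 1.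
  have bs2 := bmeasM (bmeas_sinpin R 1) (bmeas_sinpin R 1).
  under eq_integral do rewrite expr2.
  exact: integral_fune_lt_pinfty (bmeas_integrable bs2).
have [N [c hc]] := phiC.2 _ sinL2 (eta / 4) (divr_gt0 eta0 (ltr0Sn _ _)).
have dil_b k : bmeas (dil k).
  have [->|/dil_bmeas //] := posnP k.
  by rewrite /dil; under eq_fun do rewrite mul0r; exact: bmeas_cst.
pose G (x : R) := \sum_(k < N) c k.+1 * dil k.+1 x.
have bG : bmeas G by apply: bmeas_sum => k; exact: bmeasZ.
pose g x := sinpin 1 x + - G x.
have bg : bmeas g by apply: bmeasD; [exact: bmeas_sinpin | exact: bmeasN].
have g2 : I01 (fun x => g x * g x) < eta / 4.
  rewrite /I01 /Rintegral.
  have <- : (\int[mu]_(x in D) ((sinpin 1 x - \sum_(1 <= k < N.+1) c k * oddext phi (k%:R * x)) ^+ 2)%:E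
     = \int[mu]_(x in D) (g x * g x)%:E)%E.
    by apply: eq_integral => x _; rewrite big_add1 /= big_mkord -expr2.
  move: hc; case: (integral _ _ _) => [r| |]; rewrite ?lte_fin //.
  by move=> _; rewrite divr_gt0.
(* Every k <= N divides P, so the multiples of k below P Y correspond to a complete partial sum of
   the series, of length (P/k) Y. *)
pose P := N`!.
have P0 : (0 < P)%N by exact: fact_gt0.
pose S X := \sum_(n < X) (a n)%:C * l n.
pose V Y := \sum_(k < N) (c k.+1)%:C * l k.+1 * S ((P %/ k.+1) * Y)%N.
have kP (k : 'I_N) : (k.+1 %| P)%N by apply: dvdn_fact; rewrite /= ltn_ord.
have cvV : cvgC V 0.
  have -> : 0 = \sum_(k < N) (c k.+1)%:C * l k.+1 * 0 :> R[i].
    by rewrite big1 // => k _; rewrite mulr0.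
  apply: cvgC_sum => k _; apply: cvgCM; apply: cvgC_mul cv.
  by rewrite divn_gt0 // dvdn_leq.
(* Complete multiplicativity: l(km) = l(k) l(m), so a dilation pairs with psi as l(k) times a
   partial sum of the null series. *)
have dilpsi (k : 'I_N) Y : I01 (fun x => dil k.+1 x * psi (P * Y) x) =
    complex.Re (l k.+1 * S ((P %/ k.+1) * Y)%N).
  under [X in I01 X]eq_fun do rewrite mulr_sumr.
  rewrite I01_sum; last by move=> n; apply: bmeasM => //; apply: bmeasZ; exact: bmeas_sinpin.
  pose h m := l k.+1 * ((a m)%:C * l m).
  have -> : l k.+1 * S ((P %/ k.+1) * Y)%N = \sum_(n < (P * Y)%N) (if (k.+1 %| n)%N then h (n %/ k.+1)%N else 0).
    have -> : (P * Y = k.+1 * (P %/ k.+1 * Y))%N by rewrite mulnA [(k.+1 * _)%N]mulnC divnK.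
    by rewrite (sum_multiples h) // mulr_sumr.
  rewrite Re_sum; apply: eq_bigr => n _; under [X in I01 X]eq_fun do rewrite mulrCA.
  rewrite I01Z; last by apply: bmeasM => //; exact: bmeas_sinpin.
  have [->|n0] := posnP n; first by rewrite l0 dvdn0 div0n /h l0 !mulr0 /= mul0r.
  rewrite dil_sin //; case: ifP => kn; last by rewrite mulr0.
  by rewrite /h mulrCA -lM [(k.+1 * _)%N]mulnC divnK // ReZ mulrC.
have gpsi Y : (1 < Y)%N -> I01 (fun x => g x * psi (P * Y) x) = 2^-1 - complex.Re (V Y).
  move=> Y1; have Y1' : (1 < P * Y)%N by rewrite (leq_trans Y1) // leq_pmull.
  under [X in I01 X]eq_fun do rewrite mulrDl mulNr -mulN1r.
  rewrite I01D; last 2 first.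
  - by apply: bmeasM => //; exact: bmeas_sinpin.
  - by apply: bmeasZ; exact: bmeasM.
  rewrite I01Z ?mulN1r; last exact: bmeasM.
  rewrite I01_sin_psi // (bigD1 (Ordinal Y1')) //= big1 ?addr0; last first.
    by move=> i /negPf; rewrite -val_eqE /= => ->.
  rewrite l1 /= div1r; congr (_ - _).
  rewrite /V Re_sum; under [X in I01 X]eq_fun do rewrite mulr_suml.
  rewrite I01_sum; last by move=> k; apply: bmeasM => //; exact: bmeasZ.
  apply: eq_bigr => k _; under [X in I01 X]eq_fun do rewrite -mulrA.
  by rewrite I01Z ?dilpsi -?mulrA ?ReZ //; apply: bmeasM.
(* Young's inequality with weight eta: at most 1/8 from g and 1/4 from psi, in total 3/8, below the
   limit 1/2 of the pairing. *)
have ub Y : I01 (fun x => g x * psi (P * Y) x) <= 3 / 8.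
  apply: (@le_trans _ _ (I01 (fun x => (2 * eta)^-1 * (g x * g x) + eta / 2 * (psi (P * Y) x * psi (P * Y) x)))).
    apply: I01_le => [||x]; first exact: bmeasM.
      by apply: bmeasD; apply: bmeasZ; exact: bmeasM.
    rewrite -subr_ge0; set y := psi _ x; set z := g x.
    have -> : (2 * eta)^-1 * (z * z) + eta / 2 * (y * y) - z * y = (2 * eta)^-1 * (z - eta * y) ^+ 2.
      by field; rewrite gt_eqF.
    by rewrite mulr_ge0 ?sqr_ge0 // invr_ge0 mulr_ge0 // ltW.
  rewrite I01D ?I01Z; try by [exact: bmeasM | apply: bmeasZ; exact: bmeasM].
  have h1 : (2 * eta)^-1 * I01 (fun x => g x * g x) <= 1 / 8.
    have -> : 1 / 8 = (2 * eta)^-1 * (eta / 4) by field; rewrite gt_eqF.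
    by rewrite ler_wpM2l ?(ltW g2) // invr_ge0 mulr_ge0 // ltW.
  have h2 : eta / 2 * I01 (fun x => psi (P * Y) x * psi (P * Y) x) <= 1 / 4.
    apply: (@le_trans _ _ (eta / 2 * (C / 2))).
      by rewrite ler_wpM2l ?(@I01_psi2 C) // divr_ge0 // ltW.
    have : eta * C <= 1 by rewrite /eta mulrC ler_pdivrMr ?ltr_wpDl // mul1r lerDl.
    have -> : eta / 2 * (C / 2) = eta * C / 4 by move: (eta) => e; field.
    by move: (eta * C) => e; lra.
  lra.
have : \forall Y \near \oo, complex.Re (V Y) < 1 / 8.
  by apply: (cvgr_lt _ cvV.1); rewrite /= divr_gt0.
move=> [Y0 _ hY]; have := hY (maxn Y0 2) (leq_maxl _ _); rewrite /= => lt8.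
have := ub (maxn Y0 2); rewrite gpsi ?leq_maxr // => le38.
by move: lt8 le38; lra.
Qed.

End Density.

(** * Jumps of step functions *)

Section FiniteSets.
Variable R : realType.
Implicit Types (F : seq R) (t x y : R).

Lemma gap_right F t : exists2 e : R, 0 < e & forall u, u \in F -> ~~ (t < u < t + e).
Proof.
elim: F => [|v F [e e0 he]]; first by exists 1.
have [tv|vt] := ltP t v; last first.
  exists e => // u; rewrite inE => /predU1P[->|/he //].
  by rewrite ltNge vt.
exists (Num.min e (v - t)); first by rewrite lt_min e0 subr_gt0.
move=> u; rewrite inE => /predU1P[->|/he].
  by rewrite tv /= -leNgt -lerBrDl ge_min lexx orbT.
apply: contra => /andP[-> /= h]; apply: lt_le_trans h _.
by rewrite lerD2l ge_min lexx.
Qed.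

Lemma gap_left F t : exists2 e : R, 0 < e & forall u, u \in F -> ~~ (t - e < u < t).
Proof.
have [e e0 he] := gap_right [seq - u | u <- F] (- t).
exists e => // u uF; have := he (- u) (map_f _ uF).
by apply: contra => /andP[h1 h2]; apply/andP; split; lra.
Qed.

Lemma avoid_finite F (a b : R) : a < b -> exists2 x, a < x < b & x \notin F.
Proof.
move=> ab; have [e e0 he] := gap_right F a.
pose x := a + Num.min e (b - a) / 2.
have m0 : 0 < Num.min e (b - a) by rewrite lt_min e0 subr_gt0.
have m1 : Num.min e (b - a) <= e by rewrite ge_min lexx.
have m2 : Num.min e (b - a) <= b - a by rewrite ge_min lexx orbT.
exists x; first by rewrite /x; apply/andP; split; lra.
apply/negP => /he /negP; apply; rewrite /x; apply/andP; split; lra.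
Qed.

Lemma lim_at_right_cst (f : R -> R) t (e c : R) : 0 < e ->
  (forall y, t < y < t + e -> f y = c) -> lim (f y @[y --> t^'+]) = c.
Proof.
move=> e0 h; apply: cvg_lim => //; apply: cvg_near_cst; near=> y.
apply: h; apply/andP; split; first by near: y; exact: nbhs_right_gt.
by near: y; apply: nbhs_right_lt; rewrite ltrDl.
Unshelve. all: by end_near. Qed.

Lemma lim_at_left_cst (f : R -> R) t (e c : R) : 0 < e ->
  (forall y, t - e < y < t -> f y = c) -> lim (f y @[y --> t^'-]) = c.
Proof.
move=> e0 h; apply: cvg_lim => //; apply: cvg_near_cst; near=> y.
apply: h; apply/andP; split; last by near: y; exact: nbhs_left_lt.
by near: y; apply: nbhs_left_gt; rewrite ltrBlDr ltrDl.
Unshelve. all: by end_near. Qed.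

End FiniteSets.

Section OddExtension.
Variables (R : realType) (phi : R -> R).

Lemma oddext_low (j : nat) (r : R) : 0 < r < 1 -> oddext phi (2 * j%:R + r) = phi r.
Proof.
move=> /andP[r0 r1]; rewrite /oddext.
have -> : Num.floor ((2 * j%:R + r) / 2) = j%:Z.
  by apply: floor_def; rewrite intrD; apply/andP; split; lra.
rewrite -pmulrn; have -> : 2 * j%:R + r - 2 * j%:R = r by ring.
by rewrite r0 r1.
Qed.

Lemma oddext_high (j : nat) (r : R) : 0 < r < 1 ->
  oddext phi (2 * j.+1%:R - r) = - phi r.
Proof.
move=> /andP[r0 r1]; rewrite /oddext.
have -> : Num.floor ((2 * j.+1%:R - r) / 2) = j%:Z.
  by apply: floor_def; rewrite intrD -pmulrn -(natr1 j); apply/andP; split; lra.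
rewrite -pmulrn -(natr1 j); have -> : 2 * (j%:R + 1) - r - 2 * j%:R = 2 - r by ring.
have -> : (2 - r < 1) = false by apply/negbTE; rewrite -leNgt; lra.
rewrite andbF; have -> : (1 < 2 - r) && (2 - r < 2) by apply/andP; split; lra.
by congr (- phi _); ring.
Qed.

Lemma oddext01 (r : R) : 0 < r < 1 -> oddext phi r = phi r.
Proof. by move=> h; rewrite -(oddext_low 0 h) mulr0 add0r. Qed.

End OddExtension.

Section StepStructure.
Variables (R : realType) (phi : R -> R) (s : seq R).
Hypothesis s01 : forall t, t \in s -> 0 < t < 1.
Hypothesis step : forall x y : R, 0 < x -> x <= y -> y < 1 ->
  (forall t, t \in s -> ~~ (x <= t <= y)) -> phi x = phi y.
Hypothesis rational_jumps : forall x : R, 0 < x < 1 -> Jump phi x != 0 -> is_rational x.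

(** The list s may contain irrational points. Since phi has no jump there, only the rational points
    are cleared and [removable] crosses the others. *)
Lemma common_denominator : exists2 q0, (0 < q0)%N &
  forall t, t \in s -> is_rational t -> forall q, (q0 %| q)%N -> exists i : nat, t * q%:R = i%:R.
Proof.
elim: s s01 => [|t s' IHs] h01; first by exists 1%N.
have [|q0 q00 hq] := IHs; first by move=> u us; apply: h01; rewrite inE us orbT.
have [[r rt]|nr] := pselect (is_rational t); last first.
  by exists q0 => // u; rewrite inE => /predU1P[->|/hq//] [r ru]; case: nr; exists r.
have t0 : 0 < t by have /andP[] := h01 t (mem_head _ _).
have r0 : 0 < r by rewrite rt ltr0q in t0.
exists (q0 * `|denq r|)%N.
  by rewrite muln_gt0 q00 absz_gt0 denq_neq0.
move=> u; rewrite inE => /predU1P[->|us] ru q dq; last first.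
  by apply: (hq u us ru); apply: dvdn_trans dq; rewrite dvdn_mulr.
have /dvdnP[k ->] : (`|denq r| %| q)%N by apply: dvdn_trans dq; rewrite dvdn_mull.
exists (k * `|numq r|)%N; rewrite !natrM mulrCA; congr (_ * _).
have d0 : (denq r)%:~R != 0 :> R by rewrite intr_eq0 denq_neq0.
rewrite !pmulrn !gez0_abs ?denq_ge0 ?numq_ge0 ?(ltW r0) //.
by rewrite rt /ratr divfK.
Qed.

(** Induction on the number of points of s strictly between x and y. At such a point t the jump
    vanishes, so the constants on both sides agree, although phi(t) itself may differ; hence x and y
    are kept off s. *)
Lemma removable (a b x y : R) : 0 <= a -> b <= 1 ->
  (forall t, t \in s -> a < t < b -> ~ is_rational t) ->
  a < x -> x <= y -> y < b -> x \notin s -> y \notin s -> phi x = phi y.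
Proof.
move=> a0 b1 irr; have [n] := ubnP (count (fun t => x < t < y) s).
elim: n x y => // n IHn x y cn ax xy yb xs ys.
have [/hasP[t ts /andP[xt ty]]|/hasPn no] := boolP (has (fun t => x < t < y) s); last first.
  apply: step => //; [exact: le_lt_trans ax|exact: lt_le_trans b1|].
  move=> t ts; apply: contra (no t ts) => /andP[xt ty].
  rewrite !lt_neqAle xt ty !andbT; apply/andP; split.
    by apply: contraNneq xs => ->.
  by apply: contraNneq ys => <-.
have t01 := s01 ts.
have J0 : Jump phi t = 0.
  apply/eqP; apply/negP => /negP /(rational_jumps t01).
  by apply: irr => //; rewrite (lt_trans ax) // (lt_trans _ yb).
have [e e0 he] := gap_left s t; have [e' e'0 he'] := gap_right s t.
(* x' and y' are closer to t than any other point of s on their side, so phi is constant on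
   [x', t) and on (t, y']. *)
pose x' := Num.max ((x + t) / 2) (t - e / 2).
pose y' := Num.min ((y + t) / 2) (t + e' / 2).
have x'1 : x < x' < t.
  by rewrite /x' lt_max gt_max; apply/andP; split; [apply/orP; left|apply/andP; split]; lra.
have y'1 : t < y' < y.
  by rewrite /y' gt_min lt_min; apply/andP; split; [apply/andP; split|apply/orP; left]; lra.
have x'e : t - e < x' by rewrite /x' lt_max; apply/orP; right; lra.
have y'e : y' < t + e' by rewrite /y' gt_min; apply/orP; right; lra.
have /andP[xx' x't] := x'1; have /andP[ty' yy'] := y'1.
have x's : x' \notin s by apply/negP => /he; rewrite x'e x't.
have y's : y' \notin s by apply/negP => /he'; rewrite y'e ty'.
have cl : forall z, x' <= z < t -> phi z = phi x'.
  move=> z /andP[x'z zt]; symmetry; apply: step => //.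
  - by rewrite (le_lt_trans a0) // (lt_trans ax).
  - by rewrite (lt_trans zt) //; case/andP: t01.
  move=> u /he; apply: contra => /andP[h1 h2].
  by rewrite (lt_le_trans x'e) // (le_lt_trans h2).
have cr : forall z, t < z <= y' -> phi z = phi y'.
  move=> z /andP[tz zy']; apply: step => //.
  - by rewrite (lt_trans _ tz) //; case/andP: t01.
  - by rewrite (lt_le_trans yy') // (le_trans (ltW yb)).
  move=> u /he'; apply: contra => /andP[h1 h2].
  by rewrite (lt_le_trans tz) // (le_lt_trans h2).
have eqxy : phi x' = phi y'.
  have /eqP := J0; rewrite /Jump subr_eq0 => /eqP.
  rewrite (@lim_at_right_cst _ _ _ (y' - t) (phi y')) ?subr_gt0 //; last first.
    move=> z /andP[h1 h2]; have zy : z < y' by move: h2; lra.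
    rewrite oddext01 ?cr ?h1 ?ltW //; case/andP: t01 => t0 t1.
    by rewrite (lt_trans t0) //= (lt_trans zy) // (lt_trans yy') // (lt_le_trans yb).
  rewrite (@lim_at_left_cst _ _ _ (t - x') (phi x')) ?subr_gt0 //.
  move=> z /andP[h1 h2]; have zx : x' < z by move: h1; lra.
  rewrite oddext01 ?cl ?h2 ?ltW //; case/andP: t01 => t0 t1.
  by rewrite (lt_trans h2) // andbT (le_lt_trans a0) // (lt_trans ax) // (lt_trans xx').
have lt_count (P Q : pred R) : (forall u, P u -> Q u) -> Q t -> ~~ P t ->
    (count P s < count Q s)%N.
  move=> PQ Qt nPt.
  have t1 : (0 < count (pred1 t) s)%N by rewrite -has_count has_pred1.
  have := count_predUI P (pred1 t) s; rewrite (@eq_count _ (predI P (pred1 t)) pred0) ?count_pred0.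
    rewrite addn0 => e1; apply: leq_trans (_ : count P s + count (pred1 t) s <= _)%N.
      by rewrite -addn1 leq_add2l.
    rewrite -e1; apply: sub_count => u /orP[/PQ //|/eqP ->]; exact: Qt.
  by move=> u /=; case: eqP => [->|]; rewrite ?andbF // andbT; apply: negbTE.
have cx : (count (fun u => (x < u < x')%R) s < n)%N.
  apply: leq_trans (lt_count _ (fun u => (x < u < y)%R) _ _ _) cn; rewrite ?xt ?ty //.
    by move=> u /andP[-> ux'] /=; rewrite (lt_trans ux') // (lt_trans x't).
  by rewrite negb_and -!leNgt (ltW x't) orbT.
have cy : (count (fun u => (y' < u < y)%R) s < n)%N.
  apply: leq_trans (lt_count _ (fun u => (x < u < y)%R) _ _ _) cn; rewrite ?xt ?ty //.
    by move=> u /andP[uy' ->] /=; rewrite (lt_trans xt) // (lt_trans ty').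
  by rewrite negb_and -!leNgt (ltW ty').
transitivity (phi x').
  by apply: (IHn x x') => //; [exact: ltW | rewrite (lt_trans x't) // (lt_trans ty)].
rewrite eqxy; apply: (IHn y' y) => //; last exact: ltW.
by rewrite (lt_trans ax) // (lt_trans xt).
Qed.

End StepStructure.

Section Pieces.
Variables (R : realType) (phi : R -> R) (s : seq R) (q : nat).
Hypothesis s01 : forall t, t \in s -> 0 < t < 1.
Hypothesis step : forall x y : R, 0 < x -> x <= y -> y < 1 ->
  (forall t, t \in s -> ~~ (x <= t <= y)) -> phi x = phi y.
Hypothesis rational_jumps : forall x : R, 0 < x < 1 -> Jump phi x != 0 -> is_rational x.
Hypothesis q_gt0 : (0 < q)%N.
Hypothesis q_denom : forall t, t \in s -> is_rational t -> exists i : nat, t * q%:R = i%:R.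

Let qR : 0 < q%:R :> R. Proof. by rewrite ltr0n. Qed.

Lemma piece_constants : exists c : nat -> R, forall i x, (i < q)%N ->
  i%:R / q%:R < x < i.+1%:R / q%:R -> x \notin s -> phi x = c i.
Proof.
suff /boolp.choice[c hc] : forall i : nat, exists c, (i < q)%N -> forall x,
    i%:R / q%:R < x < i.+1%:R / q%:R -> x \notin s -> phi x = c.
  by exists c => i x iq; apply: hc.
move=> i; have [iq|iq] := ltnP i q; last by exists 0.
have ab : i%:R / q%:R < i.+1%:R / q%:R :> R by rewrite ltr_pM2r ?invr_gt0 // ltr_nat.
have [y /andP[ay yb] ys] := avoid_finite s ab.
exists (phi y) => _ x /andP[ax xb] xs.
have a0 : 0 <= i%:R / q%:R :> R by rewrite divr_ge0 // ltW.
have b1 : i.+1%:R / q%:R <= 1 :> R by rewrite ler_pdivrMr // mul1r ler_nat.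
have irr t : t \in s -> i%:R / q%:R < t < i.+1%:R / q%:R -> ~ is_rational t.
  move=> ts /andP[it ti] /(q_denom ts)[j tj].
  move: it ti; rewrite ltr_pdivrMr // ltr_pdivlMr // tj !ltr_nat; clear; lia.
have [xy|yx] := leP x y.
  by apply: (removable s01 step rational_jumps a0 b1 irr).
by symmetry; apply: (removable s01 step rational_jumps a0 b1 irr) => //; exact: ltW.
Qed.

Variable c : nat -> R.
Hypothesis cP : forall i x, (i < q)%N ->
  i%:R / q%:R < x < i.+1%:R / q%:R -> x \notin s -> phi x = c i.

Let M := (2 * q)%N.

(** The value of the odd extension between i/q and (i+1)/q up to finitely many points; it is
    antisymmetric under i |-> 2q - 1 - i. *)
Definition oddpiece i : R :=
  let r := (i %% (2 * q))%N in if (r < q)%N then c r else - c (2 * q - r.+1)%N.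

Lemma oddpiece_mod i j : i = j %[mod M] -> oddpiece i = oddpiece j.
Proof. by rewrite /oddpiece => ->. Qed.

Lemma oddpiece_odd i j : (M %| (i + j).+1)%N -> oddpiece j = - oddpiece i.
Proof.
have M0 : (0 < M)%N by rewrite muln_gt0.
move=> dv; have iM : (i %% M < M)%N by rewrite ltn_mod.
have jE : (j %% M = M - (i %% M).+1)%N.
  have : (M %| (i %% M + j %% M).+1)%N.
    by rewrite /dvdn -addn1 -modnDml modnDm modnDml addn1.
  have jM : (j %% M < M)%N by rewrite ltn_mod.
  move=> /dvdnP[k kE]; suff : k = 1%N by move=> k1; move: kE; rewrite k1 mul1n; lia.
  case: k kE => [|[|k]] //; rewrite !mulSn; move: iM jM; clear.
  move: M (j %% M)%N (i %% M)%N (k * M)%N => N y x a xN yN e.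
  by have := leq_add xN yN; rewrite addSn addnS e addnA ltnNge leq_addr.
have low x : (x < q)%N -> (M - x.+1 < q)%N = false.
  by rewrite /M => xq; apply/negbTE; rewrite -leqNgt; lia.
have high x : (q <= x)%N -> (x < M)%N -> (M - x.+1 < q)%N by rewrite /M; lia.
have sub2 x : (x < M)%N -> (M - (M - x.+1).+1 = x)%N by rewrite /M; lia.
rewrite /oddpiece -/M jE; case: (ltnP (i %% M) q) => iq.
  by rewrite low // sub2.
by rewrite high // opprK.
Qed.

Lemma oddext_piece L : exists F : seq R, forall i y, (i < L)%N ->
  i%:R / q%:R < y < i.+1%:R / q%:R -> y \notin F -> oddext phi y = oddpiece i.
Proof.
have M0 : (0 < M)%N by rewrite muln_gt0.
pose F1 := [seq 2 * (j%:R : R) + t | j <- iota 0 L, t <- s].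
pose F2 := [seq 2 * (j.+1%:R : R) - t | j <- iota 0 L, t <- s].
exists (F1 ++ F2) => i y iL /andP[iy yi]; rewrite mem_cat negb_or => /andP[yF1 yF2].
set j := (i %/ M)%N; set r := (i %% M)%N.
have rM : (r < M)%N by rewrite ltn_mod.
have jL : j \in iota 0 L by rewrite mem_iota /= add0n (leq_ltn_trans (leq_div _ _)).
have iE : i%:R = j%:R * (2 * q%:R) + r%:R :> R.
  by rewrite {1}(divn_eq i M) natrD !natrM.
rewrite ltr_pdivrMr // in iy; rewrite ltr_pdivlMr // -natr1 in yi.
rewrite /oddpiece -/M -/r; case: ltnP => rq.
  have yE : y = 2 * j%:R + (y - 2 * j%:R) by ring.
  have z1 : r%:R / q%:R < y - 2 * j%:R < r.+1%:R / q%:R.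
    rewrite ltr_pdivrMr // ltr_pdivlMr // -natr1 mulrBl; apply/andP; split; lra.
  rewrite yE oddext_low; first apply: cP => //.
    by apply: contra yF1 => ts; rewrite yE; apply: allpairs_f.
  have /andP[z2 z3] := z1; rewrite (le_lt_trans _ z2) ?divr_ge0 ?(ltW qR) //=.
  by apply: lt_le_trans z3 _; rewrite ler_pdivrMr // mul1r ler_nat.
have yE : y = 2 * j.+1%:R - (2 * j.+1%:R - y) by ring.
set r' := (M - r.+1)%N; have r'q : (r' < q)%N by rewrite /r' /M; lia.
have r'E : r'%:R = 2 * q%:R - (r%:R + 1) :> R.
  by rewrite /r' natrB // natrM natr1.
have z1 : r'%:R / q%:R < 2 * j.+1%:R - y < r'.+1%:R / q%:R.
  rewrite ltr_pdivrMr // ltr_pdivlMr // -(natr1 r') -(natr1 j) r'E mulrBl; apply/andP; split; lra.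
rewrite yE oddext_high; first congr (- _).
  apply: cP => //; apply: contra yF2 => ts; rewrite yE.
  exact: (allpairs_f (fun (j : nat) t => 2 * j.+1%:R - t)).
have /andP[z2 z3] := z1; rewrite (le_lt_trans _ z2) ?divr_ge0 ?(ltW qR) //=.
by apply: lt_le_trans z3 _; rewrite ler_pdivrMr // mul1r ler_nat.
Qed.

(** i + (2q - 1) is i - 1 modulo the period 2q, and makes sense at i = 0 too. *)
Definition jump_seq i : R := oddpiece i - oddpiece (i + (2 * q - 1)).

Lemma jump_seq_mod i j : i = j %[mod M] -> jump_seq i = jump_seq j.
Proof.
move=> ij; rewrite /jump_seq; congr (_ - _); apply: oddpiece_mod => //.
by rewrite -modnDml ij modnDml.
Qed.

Lemma jump_seq_even i j : (M %| i + j)%N -> jump_seq i = jump_seq j.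
Proof.
have M0 : (0 < M)%N by rewrite muln_gt0.
move=> ij; have e : ((i + (2 * q - 1) + j).+1 = i + j + M)%N by rewrite -/M; lia.
have e' : ((i + (j + (2 * q - 1))).+1 = i + j + M)%N by rewrite -/M; lia.
have h1 : (M %| (i + (2 * q - 1) + j).+1)%N by rewrite e dvdn_addl.
have h2 : (M %| (i + (j + (2 * q - 1))).+1)%N by rewrite e' dvdn_addl.
by rewrite /jump_seq (oddpiece_odd h1) (oddpiece_odd h2) opprK addrC.
Qed.

Lemma Jump_piece i : (0 < i)%N -> Jump phi (i%:R / q%:R) = jump_seq i.
Proof.
move=> i0; have [F FP] := oddext_piece i.+1.
set t : R := i%:R / q%:R.
have [e e0 he] := gap_right F t; have [e' e'0 he'] := gap_left F t.
rewrite /Jump /jump_seq; congr (_ - _).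
  apply: (@lim_at_right_cst _ _ _ (Num.min e q%:R^-1)) => [|y].
    by rewrite lt_min e0 invr_gt0.
  rewrite -ltrBlDl lt_min !ltrBlDl => /and3P[ty ye yq].
  apply: FP => //; last by apply/negP => /he; rewrite ty ye.
  by rewrite ty -natr1 mulrDl mul1r.
apply: (@lim_at_left_cst _ _ _ (Num.min e' q%:R^-1)) => [|y].
  by rewrite lt_min e'0 invr_gt0.
rewrite ltrBlDr -ltrBlDl lt_min !ltrBlDl => /andP[/andP[ye yq] yt].
have -> : oddpiece (i + (2 * q - 1)) = oddpiece i.-1.
  apply: oddpiece_mod; have -> : (i + (2 * q - 1) = i.-1 + M)%N by rewrite -/M /M; lia.
  by rewrite modnDr.
apply: FP; first by rewrite (leq_ltn_trans (leq_pred i)).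
  rewrite prednK // yt andbT.
  have -> : i.-1%:R / q%:R = t - q%:R^-1.
    by rewrite /t -{2}(prednK i0) -natr1 mulrDl mul1r addrK.
  by rewrite ltrBlDr.
by apply/negP => /he'; rewrite yt ltrBlDr ye.
Qed.

Lemma jump_seq0 : jump_seq 0 = 2 * rlim0 phi.
Proof.
have [e e0 he] := gap_right s 0.
have -> : rlim0 phi = c 0.
  apply: (@lim_at_right_cst _ _ _ (Num.min e q%:R^-1)) => [|y].
    by rewrite lt_min e0 invr_gt0.
  rewrite add0r lt_min => /and3P[y0 ye yq].
  apply: cP => //; first by rewrite mul0r y0 div1r.
  by apply/negP => /he; rewrite y0 add0r ye.
have h : (M %| (0 + (0 + (2 * q - 1))).+1)%N.
  by have -> : ((0 + (0 + (2 * q - 1))).+1 = M)%N by rewrite /M; lia.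
rewrite /jump_seq (oddpiece_odd h) opprK /oddpiece mod0n q_gt0.
by ring.
Qed.

End Pieces.

(** * Sine coefficients of the dilations *)

Section Dilations.
Variables (R : realType) (phi : R -> R) (s : seq R) (q : nat).
Hypothesis q_gt0 : (0 < q)%N.
Variable c : nat -> R.
Hypothesis cP : forall i x, (i < q)%N ->
  i%:R / q%:R < x < i.+1%:R / q%:R -> x \notin s -> phi x = c i.

Local Notation M := (2 * q)%N.
Local Notation d := (oddpiece q c).
Local Notation J := (jump_seq q c).

(** Finitely many exceptional values are corrected by indicators of points, so measurability and
    integrals transfer without an almost-everywhere argument; [undup] prevents correcting a point
    twice. *)
Lemma point_correction (f g : R -> R) (T : seq R) :
  (forall x, 0 < x < 1 -> x \notin T -> f x = g x) ->
  forall x, 0 < x < 1 ->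
    f x = g x + \sum_(t <- undup T) (f t - g t) * \1_([set t] : set R) x.
Proof.
move=> fg x x01; have [xT|xT] := boolP (x \in T).
  rewrite (bigD1_seq x) ?mem_undup ?undup_uniq //= big1 => [|t tx].
    by rewrite indicE mem_set // mulr1 addr0 subrKC.
  by rewrite indicE memNset ?mulr0 // => /= xt; rewrite xt eqxx in tx.
rewrite fg // big_seq big1 ?addr0 // => t; rewrite mem_undup => tT.
rewrite indicE memNset ?mulr0 // => /= xt.
by rewrite xt tT in xT.
Qed.

Lemma bmeas_finite_ext (f g : R -> R) (T : seq R) :
  (forall x, 0 < x < 1 -> x \notin T -> f x = g x) -> bmeas g -> bmeas f.
Proof.
move=> fg bg; have h := point_correction fg.
apply: (@bmeas_ext _ (fun x => g x + \sum_(t <- undup T) (f t - g t) * \1_([set t] : set R) x)).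
  by move=> x x01; rewrite -h.
apply: bmeasD => //; apply: bmeas_sum => t; apply: bmeasZ.
exact: bmeas_indic.
Qed.

Lemma I01_finite_ext (f g h : R -> R) (T : seq R) :
  (forall x, 0 < x < 1 -> x \notin T -> f x = g x) -> bmeas g -> bmeas h ->
  I01 (fun x => f x * h x) = I01 (fun x => g x * h x).
Proof.
move=> fg bg bh; have fE := point_correction fg.
have b1 t : bmeas (fun x => \1_([set t] : set R) x * h x).
  by apply: bmeasM => //; apply: bmeas_indic.
rewrite (@I01_ext _ _ (fun x => g x * h x + \sum_(t <- undup T) (f t - g t) * (\1_([set t] : set R) x * h x))).
  rewrite I01D; [|exact: bmeasM|by apply: bmeas_sum => t; apply: bmeasZ].
  rewrite I01_sum => [|t]; last exact: bmeasZ.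
  by rewrite big1 ?addr0 // => t _; rewrite I01Z // I01_point mulr0.
move=> x x01; rewrite {1}fE // mulrDl mulr_suml; congr (_ + _).
by apply: eq_bigr => t _; rewrite mulrA.
Qed.

Section OneDilation.
Variable k : nat.
Hypothesis k0 : (0 < k)%N.

Let K := (k * q)%N.
Let K0 : (0 < K)%N. Proof. by rewrite muln_gt0 k0. Qed.
Let KR : 0 < K%:R :> R. Proof. by rewrite ltr0n. Qed.
Let kR : 0 < k%:R :> R. Proof. by rewrite ltr0n. Qed.
Let qR : 0 < q%:R :> R. Proof. by rewrite ltr0n. Qed.

Let A (i : nat) : set R := `]i%:R / K%:R, i.+1%:R / K%:R[%classic.
Let g (x : R) := \sum_(i < K) d i * \1_(A i) x.

Let A_bmeas i : bmeas (\1_(A i) : R -> R).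
Proof. by apply: bmeas_indic; exact: measurable_itv. Qed.

Let g_bmeas : bmeas g.
Proof. by apply: bmeas_sum => i; apply: bmeasZ; exact: A_bmeas. Qed.

Let dil_eq : exists T : seq R, forall x, 0 < x < 1 -> x \notin T ->
  oddext phi (k%:R * x) = g x.
Proof.
have [F FP] := oddext_piece q_gt0 cP K.
exists ([seq i%:R / K%:R | i <- iota 0 K] ++ [seq u / k%:R | u <- F]).
move=> x /andP[x0 x1]; rewrite mem_cat negb_or => /andP[xG xF].
pose i := Num.truncn (x * K%:R).
have xK0 : 0 <= x * K%:R by rewrite mulr_ge0 ?ltW.
have /andP[ix xi] := truncn_itv xK0; rewrite -/i in ix xi.
have iK : (i < K)%N.
  by rewrite -(ltr_nat R) (le_lt_trans ix) // gtr_pMl.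
have ix' : i%:R / K%:R < x.
  rewrite lt_neqAle ler_pdivrMr // ix andbT; apply: contraNneq xG => <-.
  by apply: map_f; rewrite mem_iota.
have xi' : x < i.+1%:R / K%:R by rewrite ltr_pdivlMr.
rewrite /g (bigD1 (Ordinal iK)) //= indicE mem_set; last by rewrite /A /= in_itv /= ix' xi'.
rewrite mulr1 big1 ?addr0 => [|j ji].
  apply: FP => //; last first.
    have e : k%:R * x / k%:R = x by rewrite mulrAC divff ?gt_eqF // mul1r.
    apply: contra xF => kxF; rewrite -{1}e; exact: (map_f (fun u => u / k%:R)).
  have kK y : k%:R * (y / K%:R) = y / q%:R :> R.
    by rewrite /K natrM; field; rewrite !gt_eqF.
  by rewrite -!kK !ltr_pM2l // ix' xi'.
rewrite indicE memNset ?mulr0 // /A /= in_itv /= => /andP[jx xj].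
case/eqP: ji; apply: val_inj => /=; rewrite ltr_pdivrMr // in jx.
rewrite ltr_pdivlMr // in xj.
have h1 := le_lt_trans ix xj; have h2 := lt_trans jx xi.
rewrite !ltr_nat ltnS in h1 h2; apply/eqP.
by rewrite eqn_leq h1 andbT -ltnS.
Qed.

Lemma dil_bmeas : bmeas (fun x => oddext phi (k%:R * x)).
Proof. by have [T TP] := dil_eq; apply: bmeas_finite_ext TP g_bmeas. Qed.

Let C n i : R := cos (n%:R * pi * (i%:R / K%:R)).

Let dil_sum n : (0 < n)%N -> I01 (fun x => oddext phi (k%:R * x) * sinpin n x) =
  (\sum_(i < K) d i * (C n i - C n i.+1)) / (n%:R * pi).
Proof.
move=> n0; have [T TP] := dil_eq.
rewrite (I01_finite_ext TP g_bmeas (bmeas_sinpin R n)).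
under [X in I01 X]eq_fun do rewrite /g mulr_suml.
rewrite I01_sum => [|i]; last first.
  by apply: bmeasM; [apply: bmeasZ; exact: A_bmeas | exact: bmeas_sinpin].
rewrite mulr_suml; apply: eq_bigr => i _.
under [X in I01 X]eq_fun do rewrite -mulrA.
rewrite I01Z; last by apply: bmeasM; [exact: A_bmeas | exact: bmeas_sinpin].
have a0 : 0 <= i%:R / K%:R :> R by rewrite divr_ge0 // ltW.
have ab : i%:R / K%:R < i.+1%:R / K%:R :> R by rewrite ltr_pM2r ?invr_gt0 // ltr_nat.
have b1 : i.+1%:R / K%:R <= 1 :> R by rewrite ler_pdivrMr // mul1r ler_nat.
by rewrite (I01_itv_sinpin n0 a0 ab b1) mulrA.
Qed.

Let C_cosq n i : C n i = cosq R (K + K) (n * i).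
Proof.
rewrite /C /cosq natrD natrM; congr cos; move: K%:R KR (pi : R) => x x0 p.
by field; rewrite !gt_eqF ?addr_gt0.
Qed.

Let KM : (K + K = M * k)%N.
Proof. by rewrite /K; lia. Qed.

Let sum_shift (F : nat -> R) N : F N = F 0 -> \sum_(i < N) F i.+1 = \sum_(i < N) F i.
Proof.
case: N => [|N] FN; first by rewrite !big_ord0.
by rewrite big_ord_recr [RHS]big_ord_recl /= FN addrC.
Qed.

(** The reflection i |-> 2K - 1 - i changes the sign of both d and the difference of cosines.
    Passing to a full period makes the later summation by parts cyclic, without boundary terms. *)
Let fold_half n : 2 * (\sum_(i < K) d i * (C n i - C n i.+1)) =
  \sum_(i < K + K) d i * (C n i - C n i.+1).
Proof.
rewrite big_split_ord /= mulr_natl mulr2n; congr (_ + _).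
rewrite [RHS](reindex_inj rev_ord_inj) /=; apply: eq_bigr => i _.
have iK := ltn_ord i.
have Csym j j' : (j + j' = K + K)%N -> C n j = C n j'.
  move=> e; rewrite /C -[LHS](cosN) -(cosD2pin _ n); congr cos.
  have -> : j%:R = K%:R + K%:R - j'%:R :> R by rewrite -natrD -e natrD addrK.
  by move: K%:R KR (pi : R) => x x0 p; field; rewrite gt_eqF.
have -> : C n (K + (K - i.+1)) = C n i.+1 by apply: Csym; lia.
have -> : C n (K + (K - i.+1)).+1 = C n i by apply: Csym; lia.
rewrite (@oddpiece_odd _ _ q_gt0 c i (K + (K - i.+1))%N); last first.
  have e : ((i + (K + (K - i.+1))).+1 = M * k)%N by rewrite -KM; lia.
  by rewrite e dvdn_mulr.
by ring.
Qed.

Let sum_by_parts n : \sum_(i < K + K) d i * (C n i - C n i.+1) =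
  \sum_(i < K + K) J i * C n i.
Proof.
have dp (i j : nat) : i = j %[mod M] -> d i = d j by apply: oddpiece_mod.
have e : \sum_(i < K + K) d i * C n i.+1 = \sum_(i < K + K) d (i + (M - 1))%N * C n i.
  rewrite -(@sum_shift (fun i => d (i + (M - 1))%N * C n i)); last first.
    congr (_ * _); first by apply: dp; rewrite KM -modnDml modnMr.
    rewrite !C_cosq; apply: cosq_mod; rewrite ?addn_gt0 ?K0 // muln0 modnMl mod0n //.
  apply: eq_bigr => i _; congr (_ * _); apply: dp.
  have -> : (i.+1 + (M - 1) = i + M)%N by lia.
  by rewrite modnDr.
under eq_bigr do rewrite mulrBr; rewrite sumrB e -sumrB.
by apply: eq_bigr => i _; rewrite /jump_seq mulrBl.
Qed.

Lemma dil_sinpin n : (0 < n)%N ->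
  I01 (fun x => oddext phi (k%:R * x) * sinpin n x) =
  if (k %| n)%N then dual M J (n %/ k) / (2 * (n %/ k)%:R * pi) else 0.
Proof.
move=> n0; rewrite dil_sum //.
have MR : 0 < M%:R :> R by rewrite ltr0n muln_gt0.
(* Writing the index as M l + i with l < k, J depends on i alone, and the cosines summed over l
   vanish unless k divides n. *)
have main : \sum_(i < K + K) J i * C n i = if (k %| n)%N then k%:R * dual M J (n %/ k) else 0.
  rewrite KM (sum_blocks (fun i => J i * C n i)) exchange_big /=.
  transitivity (\sum_(i < M) J i * (if (k %| n)%N then k%:R * cos (2 * pi * ((n * i)%:R / (M * k)%:R)) else 0)).
    apply: eq_bigr => i _; rewrite -cos_sum // mulr_sumr; apply: eq_bigr => l _.
    congr (_ * _); first by apply: jump_seq_mod; rewrite mulnC modnMDl.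
    rewrite C_cosq KM /cosq; congr cos; rewrite !natrM !natrD !natrM.
    move: (pi : R) => p; field; rewrite !gt_eqF //.
  case: ifP => kn; last by rewrite big1 // => i _; rewrite mulr0.
  rewrite /dual mulr_sumr; apply: eq_bigr => i _; rewrite mulrCA; congr (_ * (_ * cos _)).
  rewrite -{1}(divnK kn) !natrM; move: (pi : R) => p; field.
  by rewrite !gt_eqF // ltr0n.
have := fold_half n; rewrite sum_by_parts main => e.
have -> : \sum_(i < K) d i * (C n i - C n i.+1) = 2^-1 * (if (k %| n)%N then k%:R * dual M J (n %/ k) else 0).
  by rewrite -e mulKf ?pnatr_eq0.
case: ifP => kn; last by rewrite mulr0 mul0r.
have nk0 : 0 < (n %/ k)%:R :> R by rewrite ltr0n divn_gt0 // dvdn_leq.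
have pi0 := pi_gt0 R; rewrite -{2}(divnK kn) natrM; move: (pi : R) pi0 => p p0.
by field; rewrite !gt_eqF.
Qed.

End OneDilation.

Theorem dual_nonvanishing : in_C phi ->
  forall xi, admissible xi -> dser (dual M J) xi != 0.
Proof.
move=> phiC xi axi; apply/negP => /eqP d0.
have M0 : (0 < M)%N by rewrite muln_gt0.
have bd : bounded_seq (dual M J) := periodic_bounded M0 (dual_per J M0).
have cv := dser_cvg bd axi; rewrite d0 in cv.
have [C hC] := lam_summable axi.
pose a n := dual M J n / (2 * n%:R * pi).
apply: (@series_not_null R phi a phiC _ _ (lam xi)) => //.
- by move=> k k0; exact: dil_bmeas.
- by move=> k n k0 n0; exact: dil_sinpin.
- exact: lam1.
- exact: lamM.
- by move=> n; apply: normc_lam_le1 => p; apply: ltW; case: axi.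
- by exists C.
have -> : (fun X => \sum_(n < X) (a n)%:C * lam xi n) =
    (fun X => ((2 * pi)^-1)%:C * psum (dual M J) xi X).
  apply/funext => X; rewrite /psum mulr_sumr; apply: eq_bigr => n _.
  rewrite mulrA -rmorphM; congr (_%:C * _); rewrite /a.
  by rewrite !invfM; ring.
have -> : 0 = ((2 * pi)^-1)%:C * 0 :> R[i] by rewrite mulr0.
exact: cvgCM.
Qed.

End Dilations.

(** * Consequences for the jumps *)

Section UnitInvariance.
Variables (R : realType) (M : nat) (J : nat -> R).
Hypothesis M0 : (0 < M)%N.
Hypothesis Jper : forall i j, i = j %[mod M] -> J i = J j.
Hypothesis Jeven : forall i j, (M %| i + j)%N -> J i = J j.
Hypothesis nonvanishing : forall xi, admissible xi -> dser (dual M J) xi != 0.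

Lemma dual1_neq0 : dual M J 1 != 0.
Proof.
have bd : bounded_seq (dual M J) := periodic_bounded M0 (dual_per J M0).
have := nonvanishing (admissible0 R); rewrite (dser0 bd).
by apply: contraNneq => ->.
Qed.

(** e J(i) = J(ui) = J(i) with J(i) nonzero forces e = 1. *)
Lemma unit_inv_fixed u i : coprime u M -> u * i = i %[mod M] -> J i != 0 ->
  forall n, dual M J (u * n)%N = dual M J n.
Proof.
move=> uM ui Ji n; have [e _ [-> he]] := J_unit M0 Jper Jeven nonvanishing uM.
suff -> : e = 1 by rewrite mul1r.
by apply: (mulIf Ji); rewrite -he mul1r; apply: Jper.
Qed.

Lemma unit_inv_neq0 u n : J 0 != 0 -> coprime u M -> dual M J (u * n)%N = dual M J n.
Proof. by move=> J0 uM; apply: (@unit_inv_fixed u 0) => //; rewrite muln0. Qed.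

(* By the Chinese remainder theorem every unit is a product of a unit congruent
   to 1 mod p and a unit congruent to 1 mod p'. *)
Lemma unit_inv_two_primes p p' u n : prime p -> prime p' -> p != p' ->
  (p %| M)%N -> (p' %| M)%N -> J (M %/ p)%N != 0 -> J (M %/ p')%N != 0 ->
  coprime u M -> dual M J (u * n)%N = dual M J n.
Proof.
move=> pp pp' npp' pM p'M Jp Jp' uM.
have MAB := partnC p M0.
set A := (M`_p)%N in MAB; set B := (M`_p^')%N in MAB.
have cAB : coprime A B by rewrite coprime_partC.
have AM : (A %| M)%N by rewrite -MAB dvdn_mulr.
have BM : (B %| M)%N by rewrite -MAB dvdn_mull.
have pA : (p %| A)%N.
  rewrite /A p_part; apply: dvdn_exp => //.
  by rewrite logn_gt0 mem_primes pp M0 pM.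
have p'B : (p' %| B)%N.
  have : (p' %| A * B)%N by rewrite MAB.
  rewrite Euclid_dvdM // => /orP[] //; rewrite /A p_part Euclid_dvdX // dvdn_prime2 // eq_sym.
  by rewrite (negPf npp').
have cu1 (x y : nat) : coprime x A -> coprime y B -> coprime (chinese A B x y) M.
  move=> xA yB; rewrite -MAB coprimeMr; apply/andP; split.
    by rewrite -coprime_modl chinese_modl // coprime_modl.
  by rewrite -coprime_modl chinese_modr // coprime_modl.
have uA : coprime u A by apply: coprime_dvdr uM.
have uB : coprime u B by apply: coprime_dvdr uM.
have fixJ v r : prime r -> (r %| M)%N -> v = 1 %[mod r] ->
    v * (M %/ r) = M %/ r %[mod M].
  move=> pr rM v1; move: (divnK rM); move: (M %/ r)%N => N <-.
  by rewrite [(N * r)%N]mulnC -muln_modl v1 muln_modl mul1n.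
have m1 x y r : (r %| A)%N -> x = 1 %[mod A] -> chinese A B x y = 1 %[mod r].
  move=> rA x1; rewrite -(modn_dvdm (chinese A B x y) rA) chinese_modl // x1.
  by rewrite modn_dvdm.
have m2 x y r : (r %| B)%N -> y = 1 %[mod B] -> chinese A B x y = 1 %[mod r].
  move=> rB y1; rewrite -(modn_dvdm (chinese A B x y) rB) chinese_modr // y1.
  by rewrite modn_dvdm.
have i1 := unit_inv_fixed (cu1 1%N u (coprime1n _) uB) (fixJ _ _ pp pM (m1 _ _ _ pA erefl)) Jp.
have i2 := unit_inv_fixed (cu1 u 1%N uA (coprime1n _)) (fixJ _ _ pp' p'M (m2 _ _ _ p'B erefl)) Jp'.
rewrite -[RHS]i2 -[RHS]i1; apply: dual_per => //; rewrite mulnA -modnMml -[RHS]modnMml.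
congr (_ * _ %% _)%N; apply/eqP; rewrite -MAB chinese_remainder //; apply/andP; split; apply/eqP.
  by rewrite -modnMml chinese_modl // modnMml mul1n chinese_modl.
by rewrite -modnMm !chinese_modr // modnMm muln1.
Qed.

End UnitInvariance.

Section Model.
Variables (R : realType) (phi : R -> R).

(** Any multiple q of q0 is allowed, so that prescribed primes can divide 2q. The last clause
    expresses the transform at 1 by an integral in which q does not occur, which makes its sign
    comparable between different q. *)
Lemma jump_model : in_Sr phi -> in_C phi ->
  exists2 q0, (0 < q0)%N & forall q, (0 < q)%N -> (q0 %| q)%N ->
  exists J : nat -> R,
    [/\ forall i j, i = j %[mod 2 * q] -> J i = J j,
        forall i j, (2 * q %| i + j)%N -> J i = J j &
        forall xi, admissible xi -> dser (dual (2 * q) J) xi != 0] /\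
    [/\ J 0 = 2 * rlim0 phi,
        forall i, (0 < i)%N -> Jump phi (i%:R / q%:R) = J i &
        dual (2 * q) J 1 = 2 * pi * I01 (fun x => oddext phi x * sinpin 1 x)].
Proof.
case=> -[s [s01 step]] rat phiC; have [q0 q00 h0] := common_denominator s01.
exists q0 => // q q_gt0 q0q.
have qd t : t \in s -> is_rational t -> exists i : nat, t * q%:R = i%:R.
  by move=> ts rt; apply: h0.
have [c cP] := piece_constants s01 step rat q_gt0 qd.
exists (jump_seq q c); split; split.
- exact: jump_seq_mod.
- exact: jump_seq_even.
- exact: dual_nonvanishing cP phiC.
- exact: jump_seq0 cP.
- exact: Jump_piece cP.
- have := @dil_sinpin _ _ _ _ q_gt0 _ cP 1 isT 1 isT.
  rewrite dvd1n divn1 => e.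
  under eq_fun do rewrite -[X in oddext phi X]mul1r.
  rewrite e mulr1 mulrC divfK // mulf_neq0 ?pnatr_eq0 // gt_eqF //; exact: pi_gt0.
Qed.

Lemma Jump_div q (J : nat -> R) P : (0 < q)%N ->
  (forall i, (0 < i)%N -> Jump phi (i%:R / q%:R) = J i) -> (P %| 2 * q)%N ->
  Jump phi (2 / P%:R) = J (2 * q %/ P)%N.
Proof.
move=> q0 JJ PM; have M0 : (0 < 2 * q)%N by rewrite muln_gt0.
have P0 := dvdn_gt0 M0 PM.
rewrite -JJ; last by rewrite divn_gt0 // dvdn_leq.
congr (Jump phi).
have PR : P%:R != 0 :> R by rewrite pnatr_eq0 -lt0n.
have qR : q%:R != 0 :> R by rewrite pnatr_eq0 -lt0n.
by rewrite natf_div // natrM; field; rewrite PR qR.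
Qed.

End Model.

Section Parts.
Variables (R : realType) (phi : R -> R).
Hypotheses (phiS : in_Sr phi) (phiC : in_C phi).

Lemma jump_inclusion_exclusion (N : nat) (p : 'I_N -> nat) :
  0 < rlim0 phi -> injective p -> (forall i, prime (p i)) ->
  \sum_(X : {set 'I_N} | X != finset.set0)
     (-1) ^+ (#|X|.+1) * Jump phi (2 / (\prod_(i in X) p i)%:R) < 2 * rlim0 phi.
Proof.
move=> r0 pinj pp; have [q0 q00 model] := jump_model phiS phiC.
pose P := (\prod_i p i)%N; pose q := (q0 * P)%N.
have P0 : (0 < P)%N by apply: prodn_gt0 => i; exact: prime_gt0.
have q_gt0 : (0 < q)%N by rewrite muln_gt0 q00.
have [J [[Jper Jeven nonv] [J0 JJ _]]] := model q q_gt0 (dvdn_mulr _ (dvdnn _)).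
have M0 : (0 < 2 * q)%N by rewrite muln_gt0.
have J0pos : 0 < J 0 by rewrite J0 mulr_gt0.
have J0n : J 0 != 0 by rewrite gt_eqF.
have PM : (P %| 2 * q)%N by rewrite /q mulnA dvdn_mull.
have XM (X : {set 'I_N}) : (\prod_(i in X) p i %| 2 * q)%N.
  by apply: dvdn_trans PM; rewrite [Y in (_ %| Y)%N](bigID (mem X)) /= dvdn_mulr.
have ui u n : coprime u (2 * q) -> dual (2 * q) J (u * n)%N = dual (2 * q) J n.
  exact: unit_inv_neq0.
have J2q : J (2 * q)%N = J 0 by apply: Jper; rewrite modnn mod0n.
(* The empty family of primes: the alternating sum is J(0) > 0, which fixes the sign of the
   transform at 1. *)
have w0 : 0 < dual (2 * q) J 1.
  rewrite lt_def (dual1_neq0 M0 nonv) /=.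
  have p0 : injective (fun _ : 'I_0 => 2%N) by case.
  have [|h _] := inclusion_exclusion M0 Jper Jeven nonv ui p0 (fun i => isT).
    by rewrite big_ord0 dvd1n.
  move: h; rewrite (bigD1 finset.set0) //= [X in _ + X]big1 => [|X /negP[]].
    by rewrite big_set0 cards0 expr0 mul1r divn1 addr0 J2q pmulr_lge0.
  by apply/eqP/setP => -[].
have [S0 /(_ J0n) Sn] := inclusion_exclusion M0 Jper Jeven nonv ui pinj pp PM.
move: S0 Sn; rewrite pmulr_rge0 // => S0 Sn.
have := lt_def 0 (\sum_(X : {set 'I_N}) (-1) ^+ #|X| * J (2 * q %/ \prod_(i in X) p i)%N).
rewrite S0 Sn /= (bigD1 finset.set0) //= big_set0 cards0 expr0 mul1r divn1 J2q J0.
move=> h; rewrite -subr_gt0 -sumrN.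
apply: etrans h; congr (0 < _ + _); apply: eq_bigr => X _.
by rewrite (Jump_div q_gt0 JJ) // exprS mulN1r mulNr opprK.
Qed.

Lemma jump_sign : rlim0 phi = 0 ->
  (forall p : nat, prime p -> 0 <= Jump phi (2 / p%:R)) \/
  (forall p : nat, prime p -> Jump phi (2 / p%:R) <= 0).
Proof.
move=> r0; have [q0 q00 model] := jump_model phiS phiC.
(* With at most one nonzero jump among the points 2/p the claim is immediate; two of them make the
   unit action trivial. *)
have [[p [p' [pp pp' npp' [Jp Jp']]]]|no] := pselect (exists p p', [/\ prime p, prime p', p != p' &
    Jump phi (2 / p%:R) != 0 /\ Jump phi (2 / p'%:R) != 0]); last first.
  have [[p [pp Jp]]|no1] := pselect (exists p, prime p /\ Jump phi (2 / p%:R) != 0); last first.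
    left=> p pp; have [->//|Jp] := eqVneq (Jump phi (2 / p%:R)) 0.
    by case: no1; exists p.
  have zero r : prime r -> r != p -> Jump phi (2 / r%:R) = 0.
    by move=> pr rp; apply/eqP/negPn/negP => Jr; apply: no; exists r, p.
  have [J0|/ltW J0] := leP 0 (Jump phi (2 / p%:R)); [left|right] => r pr;
    by have [->//|rp] := eqVneq r p; rewrite zero.
(* The modulus chosen below depends on r, but the sign of w must serve all r at once. *)
pose w := 2 * pi * I01 (fun x => oddext phi x * sinpin 1 x).
suff main r : prime r -> w != 0 /\ 0 <= w * - Jump phi (2 / r%:R).
  have [w0 _] := main p pp.
  have [wn|wp|w00] := ltgtP w 0; last by rewrite w00 eqxx in w0.
    by left=> r /main[_]; rewrite nmulr_rge0 // oppr_le0.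
  by right=> r /main[_]; rewrite pmulr_rge0 // oppr_ge0.
move=> pr; pose q := (q0 * (p * p' * r))%N.
have q_gt0 : (0 < q)%N by rewrite !muln_gt0 q00 !prime_gt0.
have [J [[Jper Jeven nonv] [J0 JJ Jw]]] := model q q_gt0 (dvdn_mulr _ (dvdnn _)).
have M0 : (0 < 2 * q)%N by rewrite muln_gt0.
have pM : (p %| 2 * q)%N by apply/dvdn_mull/dvdn_mull; rewrite -mulnA dvdn_mulr.
have p'M : (p' %| 2 * q)%N by apply/dvdn_mull/dvdn_mull; rewrite dvdn_mulr // dvdn_mull.
have rM : (r %| 2 * q)%N by apply/dvdn_mull/dvdn_mull; rewrite dvdn_mull.
have JD := Jump_div q_gt0 JJ; rewrite !JD // in Jp Jp' *.
rewrite /w -Jw; split; first exact: dual1_neq0.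
have ui u n : coprime u (2 * q) -> dual (2 * q) J (u * n)%N = dual (2 * q) J n.
  exact: (unit_inv_two_primes M0 Jper Jeven nonv n pp pp').
have pinj : injective (fun _ : 'I_1 => r) by move=> i j _; rewrite (ord1 i) (ord1 j).
(* For the single prime r the alternating sum is J(0) - J(M/r) with J(0) = 0. *)
have [|h _] := inclusion_exclusion M0 Jper Jeven nonv ui pinj (fun i => pr).
  by rewrite big_ord1.
have J2q : J (2 * q)%N = 0 by rewrite -[RHS](mulr0 2) -r0 -J0; apply: Jper; rewrite modnn mod0n.
move: h; rewrite (bigD1 finset.set0) //= (bigD1 [set: 'I_1]%SET) /=; last first.
  by rewrite -card_gt0 cardsT card_ord.
rewrite [X in _ + (_ + X)]big1 => [|X /andP[X0 X1]]; last first.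
  case/set0Pn: X0 => i iX; case/eqP: X1; apply/setP => j.
  by rewrite (ord1 j) -(ord1 i) iX inE.
rewrite big_set0 cards0 divn1 J2q mulr0 add0r addr0 cardsT card_ord expr1 mulN1r.
by rewrite (eq_bigl xpredT) ?big_ord1 // => i; rewrite inE.
Qed.

Lemma jump_prime3 (p k : nat) : prime p -> (p %% 4 = 3)%N -> (0 < k)%N ->
  forall m n : nat, (0 < m)%N -> (0 < n)%N ->
    ~~ (p %| m * n)%N -> m = n %[mod 2] ->
    Jump phi (m%:R / (p ^ k)%:R) = Jump phi (n%:R / (p ^ k)%:R).
Proof.
move=> pp p3 k0 m n m0 n0; rewrite Euclid_dvdM // negb_or => /andP[pm pn] mn.
have [q0 q00 model] := jump_model phiS phiC.
pose q := (q0 * p ^ k)%N.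
have pk0 : (0 < p ^ k)%N by rewrite expn_gt0 prime_gt0.
have q_gt0 : (0 < q)%N by rewrite muln_gt0 q00.
have [J [[Jper Jeven nonv] [_ JJ _]]] := model q q_gt0 (dvdn_mulr _ (dvdnn _)).
have M0 : (0 < 2 * q)%N by rewrite muln_gt0.
have pkM : (2 * p ^ k %| 2 * q)%N by rewrite dvdn_pmul2l // dvdn_mull.
have E l : (0 < l)%N -> Jump phi (l%:R / (p ^ k)%:R) = J (l * (2 * q %/ (2 * p ^ k)))%N.
  move=> l0; rewrite divnMl // mulnK // -JJ ?muln_gt0 ?l0 //; congr (Jump phi).
  have xn : (p ^ k)%:R != 0 :> R by rewrite pnatr_eq0 -lt0n.
  have qn : q0%:R != 0 :> R by rewrite pnatr_eq0 -lt0n.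
  by rewrite /q !natrM; move: (p ^ k)%:R xn => x xn; field; rewrite xn qn.
rewrite !E //; exact: (J_prime3 M0 Jper Jeven nonv pp p3 k0).
Qed.

End Parts.

Theorem theorem1p6 (R : realType) (phi : R -> R) :
  in_Sr phi -> in_C phi ->
  ((0 < rlim0 phi) ->
     forall (N : nat) (p : 'I_N -> nat), injective p -> (forall i, prime (p i)) ->
       \sum_(S : {set 'I_N} | S != finset.set0)
          (-1) ^+ (#|S|.+1) * Jump phi (2 / (\prod_(i in S) p i)%:R)
       < 2 * rlim0 phi)
  /\
  (rlim0 phi = 0 ->
     (forall p : nat, prime p -> 0 <= Jump phi (2 / p%:R)) \/
     (forall p : nat, prime p -> Jump phi (2 / p%:R) <= 0))
  /\
  (forall (p k : nat), prime p -> (p %% 4 = 3)%N -> (0 < k)%N ->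
     forall m n : nat, (1 <= m <= p ^ k - 1)%N -> (1 <= n <= p ^ k - 1)%N ->
       ~~ (p %| m * n)%N -> (2 %| (m%:Z - n%:Z))%Z ->
       Jump phi (m%:R / (p ^ k)%:R) = Jump phi (n%:R / (p ^ k)%:R)).
Proof.
move=> phiS phiC; split; [|split].
- by move=> r0 N p; exact: jump_inclusion_exclusion.
- exact: jump_sign.
- move=> p k pp p3 k0 m n /andP[m0 _] /andP[n0 _] pmn mn.
  apply: jump_prime3 => //; lia.
Qed.
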